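(* Let $V$ be an irreducible integrable $\tau$-module on which $K_0$ acts as a scalar $C_0>0$ and $K_i$ acts trivially for $1\le i\le n$, with associated finite-dimensional $\tilde L$-module $\tilde V=T/W$. Let $\bar p\in\Lambda$ have order $N_p$, let $\theta$ be a $\bar p$-graded $\tilde L$-module automorphism of $\tilde V$ with $\theta^{N_p}=1$, and for $0\le i<N_p$ let $\tilde M_i=\{v\in\tilde V:\theta(v)=\zeta^{-i}v\}$, $\zeta$ a primitive $N_p$-th root of unity. Assume that each $\tilde M_i$ is an irreducible $\tilde L$-module. Then each $\tilde M_i$ is an irreducible finite-dimensional module for the direct sum $\mathfrak{gl}_n\oplus\mathring{\mathfrak g}$; that is, the action of $\tilde L$ on $\tilde M_i$ factors through the quotient map $\tilde L\to\mathfrak{gl}_n\oplus\mathring{\mathfrak g}$ described in the context.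
   Context: All vector spaces and algebras are over $\mathbb C$; $\mathbb N=\{0,1,2,\dots\}$. **The Lie algebra $\tau$.** Let $\mathfrak g$ be a finite-dimensional simple Lie algebra with a non-degenerate symmetric invariant bilinear form $(\cdot,\cdot)$. Fix $n\ge1$ and commuting automorphisms $\sigma_0,\dots,\sigma_n$ of $\mathfrak g$ of finite orders $m_0,\dots,m_n$; let $\xi_i$ be a primitive $m_i$-th root of unity, $\Gamma_0=m_0\mathbb Z$, $\Gamma=m_1\mathbb Z\oplus\cdots\oplus m_n\mathbb Z$, $\Lambda_0=\mathbb Z/\Gamma_0$, $\Lambda=\mathbb Z^n/\Gamma$; bars denote images in $\Lambda_0$, $\Lambda$. For $k_0\in\mathbb Z$, $k\in\mathbb Z^n$ put $\mathfrak g(\bar k_0,\bar k)=\{x\in\mathfrak g:\sigma_ix=\xi_i^{k_i}x,\ 0\le i\le n\}$, $t^k=t_1^{k_1}\cdots t_n^{k_n}$, $L(\mathfrak g,\sigma)=\bigoplus_{(k_0,k)\in\mathbb Z^{n+1}}\mathfrak g(\bar k_0,\bar k)\otimes t_0^{k_0}t^k$, and $X(k_0,k)=X\otimes t_0^{k_0}t^k$. Let $Z(m_0,m)$ be the space spanned by symbols $t_0^{r_0}t^rK_i$ ($0\le i\le n$, $r_0\in\Gamma_0$, $r\in\Gamma$) modulo the span of all $\sum_{i=0}^n r_it_0^{r_0}t^rK_i$. Let $D(m_0,m)$ be the derivation algebra of $\mathbb C[t_0^{\pm m_0},\dots,t_n^{\pm m_n}]$, with basis $t_0^{r_0}t^rd_i$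 ($0\le i\le n$, $r_0\in\Gamma_0$, $r\in\Gamma$), $d_i=t_i\frac{d}{dt_i}$. Then $\tau=L(\mathfrak g,\sigma)\oplus Z(m_0,m)\oplus D(m_0,m)$ with brackets ($r,s\in\Gamma$, $r_0,s_0\in\Gamma_0$, $0\le a,b\le n$): $[X(k_0,k),Y(l_0,l)]=[X,Y](k_0+l_0,k+l)+(X,Y)\sum_{i=0}^nk_it_0^{k_0+l_0}t^{k+l}K_i$; $Z(m_0,m)$ is abelian and commutes with $L(\mathfrak g,\sigma)$; $[t_0^{r_0}t^rd_a,X(k_0,k)]=k_aX(k_0+r_0,k+r)$; $[t_0^{r_0}t^rd_a,t_0^{s_0}t^sK_b]=s_at_0^{r_0+s_0}t^{r+s}K_b+\delta_{ab}\sum_{p=0}^nr_pt_0^{r_0+s_0}t^{r+s}K_p$; $[t_0^{r_0}t^rd_a,t_0^{s_0}t^sd_b]=s_at_0^{r_0+s_0}t^{r+s}d_b-r_bt_0^{r_0+s_0}t^{r+s}d_a+\varphi(t_0^{r_0}t^rd_a,t_0^{s_0}t^sd_b)$, where $\varphi$ is a fixed linear combination of the cocycles $\varphi_1(t_0^{r_0}t^rd_a,t_0^{s_0}t^sd_b)=-s_ar_b\sum_{p=0}^nr_pt_0^{r_0+s_0}t^{r+s}K_p$ and $\varphi_2(t_0^{r_0}t^rd_a,t_0^{s_0}t^sd_b)=r_as_b\sum_{p=0}^nr_pt_0^{r_0+s_0}t^{r+s}K_p$. **Standing assumptions.** $\mathfrak g(\bar0,\bar0)$ is a simple Lie algebra;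 there are Cartan subalgebras $\mathfrak h(0)$ of $\mathfrak g(\bar0,\bar0)$ and $\mathfrak h$ of $\mathfrak g$ with $\mathfrak h(0)\subseteq\mathfrak h$. Let $\Delta_0^\times$ be the root system of $(\mathfrak g(\bar0,\bar0),\mathfrak h(0))$, $\Delta_{0,sh}^\times$ its short roots, $\Delta_{0,en}^\times=\Delta_0^\times\cup2\Delta_{0,sh}^\times$ if $\Delta_0^\times$ is of type $B_l$ and $\Delta_{0,en}^\times=\Delta_0^\times$ otherwise, $\Delta_{0,en}=\Delta_{0,en}^\times\cup\{0\}$. It is assumed that the set of weights (including $0$) of $\mathfrak h(0)$ acting on $\mathfrak g$ by $\mathrm{ad}$ is $\Delta_{0,en}$. **Weights, integrable modules.** $H=\mathfrak h(0)\oplus\sum_{i=0}^n\mathbb CK_i\oplus\sum_{i=0}^n\mathbb Cd_i$. $\delta_i\in H^*$ vanishes on $\mathfrak h(0)$ and all $K_j$, with $\delta_i(d_j)=\delta_{ij}$. Elements of $\mathfrak h(0)^*$ are extended to $H$ by $0$ on $K_i,d_i$. $\mathfrak g(\bar k_0,\bar k,\alpha)=\{x\in\mathfrak g(\bar k_0,\bar k):[h,x]=\alpha(h)x\ \forall h\in\mathfrak h(0)\}$. A $\tau$-module $V$ is integrable if $V=\bigoplus_{\lambda\in H^*}V_\lambda$, $V_\lambda=\{v:hv=\lambda(h)v\ \forall h\in H\}$, with $\dim V_\lambda<\infty$, and $\mathfrak g(\bar k_0,\bar k,\alpha)\otimes t_0^{k_0}t^k$ acts locally nilpotently on $V$ for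 all $\alpha\ne0$. $P(V)=\{\gamma\in H^*:V_\gamma\neq0\}$. **Triangular decomposition.** Let $\alpha_1,\dots,\alpha_p$ be simple roots of $(\mathfrak g(\bar0,\bar0),\mathfrak h(0))$, $\beta_0$ the maximal root in $\Delta_{0,en}$, $\alpha_0=-\beta_0+\delta_0$, $Q^+=\bigoplus_{i=0}^p\mathbb N\alpha_i$; $\beta>0$ means $\beta\in Q^+\setminus\{0\}$. $\tau^+$ is the span of all $\mathfrak g(\bar k_0,\bar k,\alpha)\otimes t_0^{k_0}t^k$ with $\alpha+k_0\delta_0>0$ ($k\in\mathbb Z^n$) and all $t_0^{s_0}t^sK_i$, $t_0^{s_0}t^sd_i$ with $0\le i\le n$, $s_0>0$, $s\in\Gamma$. **The algebras $L$, $\tilde L$.** $(u,s)=\sum u_is_i$ for $u,s\in\mathbb C^n$; $A(m)=\mathbb C[t_1^{\pm m_1},\dots,t_n^{\pm m_n}]$; $D(u,r)=\sum_{i=1}^nu_it^rd_i$ ($u\in\mathbb C^n$, $r\in\Gamma$), spanning $\mathrm{Der}A(m)$. $\mathring{\mathfrak g}=\{X\in\mathfrak g:\sigma_0X=X,\ [h,X]=0\ \forall h\in\mathfrak h(0)\}=\bigoplus_{\bar k\in\Lambda}\mathring{\mathfrak g}_{\bar k}$, $\mathring{\mathfrak g}_{\bar k}=\{X\in\mathring{\mathfrak g}:\sigma_iX=\xi_i^{k_i}X,\ 1\le i\le n\}$; $L(\mathring{\mathfrak g},\sigma)=\bigoplus_{k\in\mathbb Z^n}\mathring{\mathfrak g}_{\bar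 k}\otimes t^k$, $X(k)=X\otimes t^k$ for $X\in\mathring{\mathfrak g}_{\bar k}$. $L=L(\mathring{\mathfrak g},\sigma)\oplus\mathrm{Der}A(m)\oplus A(m)\oplus\sum_{r\in\Gamma}\mathbb Ct^rd_0$ has brackets $[X(k),Y(l)]=[X,Y](k+l)$, $[D(u,r),D(v,s)]=D((u,s)v-(v,r)u,r+s)$, $[D(u,r),t^s]=(u,s)t^{r+s}$, $[D(u,r),X(k)]=(u,k)X(k+r)$, $[D(u,r),t^sd_0]=(u,s)t^{r+s}d_0$, all others zero. $I$ is the span of $I(u,r)=D(u,r)-D(u,0)$, a subalgebra of $\mathrm{Der}A(m)$, and $\tilde L=I\ltimes L(\mathring{\mathfrak g},\sigma)\subset L$. **The quotient $\mathfrak{gl}_n\oplus\mathring{\mathfrak g}$ of $\tilde L$.** Let $I_2\subset I$ be the span of all $I(u,r)-I(u,r+s_1)-I(u,r+s_2)+I(u,r+s_1+s_2)$ ($u\in\mathbb C^n$, $r,s_1,s_2\in\Gamma$); it is an ideal of $I$ and $I/I_2\cong\mathfrak{gl}_n$ via $I(u,r)\mapsto\sum_{i,j}u_ir_jE_{ji}$, where $r=(r_1,\dots,r_n)\in\Gamma$ and $E_{ij}$ are matrix units. Let $F_1\subset L(\mathring{\mathfrak g},\sigma)$ be the span of all $X(k)-X(k+r)$ ($k\in\mathbb Z^n$, $X\in\mathring{\mathfrak g}_{\bar k}$, $r\in\Gamma$); it is an ideal and $L(\mathring{\mathfrak g},\sigma)/F_1\cong\mathring{\mathfrak g}$ via $X(k)\mapsto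 X$. Together these give the quotient map $\tilde L\to\mathfrak{gl}_n\oplus\mathring{\mathfrak g}$ with kernel $I_2\oplus F_1$. **The module $\tilde V$.** For $V$ as in the claim, $T=\{v\in V:\tau^+v=0\}$; it is a nonzero $L$-module, where $t^r\in A(m)$ acts as $C_0^{-1}t^rK_0$ and the other elements act as the corresponding elements of $\tau$ (the $t^rK_p$, $1\le p\le n$, act by $0$ on $T$). Fix $\lambda\in P(V)$ with $T\cap V_\lambda\ne0$; $T=\bigoplus_{k\in\mathbb Z^n}T_k$, $T_k=\{v\in T:d_iv=(\lambda(d_i)+k_i)v,\ 1\le i\le n\}$. $W$ is the span of all $t^r\cdot v-v$ ($r\in\Gamma$, $v\in T$), an $\tilde L$-submodule, and $\tilde V=T/W=\bigoplus_{\bar k\in\Lambda}\tilde V_{\bar k}$ with $\tilde V_{\bar k}$ the image of $T_k$; it is finite-dimensional. An $\tilde L$-module automorphism $\theta$ of $\tilde V$ is called $\bar p$-graded if $\theta(\tilde V_{\bar k})=\tilde V_{\bar k-\bar p}$ for all $\bar k\in\Lambda$. (For $\bar p=0$, $N_p=1$ one has $\theta=1$ and $\tilde M_0=\tilde V$.) *)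

(* Defs.v *)
(* MathComp with MathComp-Analysis.  The ground field is R[i] with R : realType. *)
From HB Require Import structures.
From mathcomp Require Import all_boot all_order all_algebra.
From mathcomp Require Import boolp classical_sets functions fsbigop reals.
From mathcomp Require Import complex.

Set Implicit Arguments.
Unset Strict Implicit.
Unset Printing Implicit Defensive.

Import Order.TTheory GRing.Theory Num.Theory.
Local Open Scope classical_set_scope.
Local Open Scope ring_scope.

(* {vspace V} needs V finite-dimensional; this is its analogue for an arbitrary
   module. *)
Record subspace (F : fieldType) (V : lmodType F) := Subspace {
  ssset :> V -> Prop;
  ss_closed : ssset 0 /\
    forall (c : F) (u v : V), ssset u -> ssset v -> ssset (c *: u + v) }.

Section LinearAlgebra.
Variables (F : fieldType) (V : lmodType F).
Implicit Types (A : set V) (S R : subspace V).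

Definition span_set A : set V := [set v | exists s : seq (F * V),
  (forall p, p \in s -> A p.2) /\ v = \sum_(p <- s) p.1 *: p.2].

Lemma span_set_closed A : span_set A 0 /\
  forall (c : F) (u v : V), span_set A u -> span_set A v -> span_set A (c *: u + v).
Proof.
split; first by exists [::]; split=> //; rewrite big_nil.
move=> c _ _ [s [As ->]] [t [At ->]].
exists ([seq (c * p.1, p.2) | p <- s] ++ t); split=> [p|].
  by rewrite mem_cat => /orP[/mapP[q /As Aq ->]|/At].
rewrite big_cat big_map scaler_sumr; congr (_ + _).
by apply: eq_bigr => p _; rewrite scalerA.
Qed.

Definition lspan A : subspace V := Subspace (span_set_closed A).

Definition finite_dim A := exists (m : nat) (b : 'I_m -> V),
  forall v, A v -> exists c : 'I_m -> F, v = \sum_i c i *: b i.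

Definition in_ss S : {pred V} := fun v => `[< S v >].

Lemma in_ss_closed S : submod_closed (in_ss S).
Proof.
case: (ss_closed S) => S0 Slin; split; first exact/asboolP.
by move=> c u v /asboolP Su /asboolP Sv; apply/asboolP; exact: Slin.
Qed.

HB.instance Definition _ S :=
  GRing.isSubmodClosed.Build F V (in_ss S) (in_ss_closed S).

Definition sub_of S := {v : V | v \in in_ss S}.

HB.instance Definition _ S := SubChoice.on (sub_of S).
HB.instance Definition _ S := [SubChoice_isSubLmodule of sub_of S by <:].

Definition rel_in S R : {pred sub_of S} := fun v => val v \in in_ss R.
Arguments rel_in S R : clear implicits.

Lemma rel_in_closed S R : zmod_closed (rel_in S R).
Proof.
split; first by suff: val (0 : sub_of S) \in in_ss R by []; rewrite raddf0 rpred0.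
move=> u v Ru Rv; suff: val (u - v) \in in_ss R by [].
by rewrite raddfB; apply: rpredB.
Qed.

HB.instance Definition _ S R :=
  GRing.isZmodClosed.Build (sub_of S) (rel_in S R) (@rel_in_closed S R).

(* The quotient S / (S `&` R), as a module. *)
Definition subquo S R := Quotient.quot (rel_in S R).

HB.instance Definition _ S R := GRing.Zmodule.on (subquo S R).

Section Scale.
Variables S R : subspace V.
Local Open Scope quotient_scope.

Definition subquo_scale (c : F) (x : subquo S R) : subquo S R :=
  \pi_(subquo S R) (c *: repr x).

Lemma subquo_scale_pi c (x : sub_of S) :
  subquo_scale c (\pi_(subquo S R) x) = \pi_(subquo S R) (c *: x).
Proof.
apply/eqP; rewrite /subquo_scale -Quotient.idealrBE -scalerBr.
set y := repr _; suff: val (c *: (y - x)) \in in_ss R by [].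
rewrite linearZ; apply: rpredZ.
have := Quotient.idealrBE (rel_in S R) y x.
by rewrite /y reprK eqxx.
Qed.

Lemma subquo_piD (x y : sub_of S) :
  \pi_(subquo S R) (x + y) = \pi_(subquo S R) x + \pi_(subquo S R) y.
Proof. by rewrite !piE. Qed.

Lemma subquo_scaleA a b (x : subquo S R) :
  subquo_scale a (subquo_scale b x) = subquo_scale (a * b) x.
Proof. by rewrite -[x]reprK !subquo_scale_pi scalerA reprK. Qed.

Lemma subquo_scale1 : left_id 1 subquo_scale.
Proof. by move=> x; rewrite -[x]reprK subquo_scale_pi scale1r. Qed.

Lemma subquo_scaleDr : right_distributive subquo_scale +%R.
Proof.
move=> a x y; rewrite -[x]reprK -[y]reprK -subquo_piD !subquo_scale_pi.
by rewrite scalerDr; exact: subquo_piD.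
Qed.

Lemma subquo_scaleDl x : {morph subquo_scale^~ x : a b / a + b}.
Proof.
move=> a b /=; rewrite -[x]reprK !subquo_scale_pi scalerDl.
exact: subquo_piD.
Qed.

HB.instance Definition _ := GRing.Zmodule_isLmodule.Build F (subquo S R)
  subquo_scaleA subquo_scale1 subquo_scaleDr subquo_scaleDl.

(* Class of v; only meaningful for v in S (and 0 for v outside S). *)
Definition sq_pi (v : V) : subquo S R := \pi_(subquo S R) (insubd (0 : sub_of S) v).

Definition sq_repr (x : subquo S R) : V := val (repr x).

End Scale.
End LinearAlgebra.

Arguments rel_in {F V} S R _.
Arguments sq_pi {F V} S R v.

Section Representations.
Variables (F : fieldType) (A V : lmodType F).
Implicit Types (S : A -> Prop) (M : V -> Prop) (br : A -> A -> A) (rho : A -> V -> V).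

Definition stable_on S M rho := forall x v, S x -> M v -> M (rho x v).

(* The Lie algebra (S, br) acts on the vector space M through rho. *)
Definition is_rep S br M rho := [/\ stable_on S M rho,
  forall (c : F) x y v, S x -> S y -> M v ->
    rho (c *: x + y) v = c *: rho x v + rho y v,
  forall (c : F) x v w, S x -> M v -> M w ->
    rho x (c *: v + w) = c *: rho x v + rho x w &
  forall x y v, S x -> S y -> M v ->
    rho (br x y) v = rho x (rho y v) - rho y (rho x v)].

Definition irreducible_on S M rho := [/\ exists2 v, M v & v != 0,
  stable_on S M rho &
  forall U : subspace V, (forall v, U v -> M v) -> stable_on S U rho ->
    (forall v, U v -> v = 0) \/ (forall v, M v -> U v)].

End Representations.

Section LieAlgebras.
Variables (F : fieldType) (g : vectType F) (br : g -> g -> g).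
Implicit Types S J h : {vspace g}.

Definition lie_axioms := [/\
  forall (c : F) x y z, br (c *: x + y) z = c *: br x z + br y z,
  forall (c : F) x y z, br x (c *: y + z) = c *: br x y + br x z,
  forall x, br x x = 0 &
  forall x y z, br x (br y z) + br y (br z x) + br z (br x y) = 0].

Definition lie_subalgebra S := forall x y, x \in S -> y \in S -> br x y \in S.

Definition simple_lie S := [/\ lie_subalgebra S,
  exists x y, [/\ x \in S, y \in S & br x y != 0] &
  forall J, (J <= S)%VS -> (forall x y, x \in S -> y \in J -> br x y \in J) ->
    J = 0%VS \/ J = S].

(* Nilpotent and self-normalizing. *)
Definition cartan_subalgebra S h := [/\ (h <= S)%VS, lie_subalgebra h,
  exists N, forall xs y, size xs = N -> {subset xs <= h} -> y \in h ->
    foldr br y xs = 0 &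
  forall x, x \in S -> (forall y, y \in h -> br x y \in h) -> x \in h].

Definition invariant_form (f : g -> g -> F) := [/\
  forall (c : F) x y z, f (c *: x + y) z = c * f x z + f y z,
  forall x y, f x y = f y x,
  forall x y z, f (br x y) z = f x (br y z) &
  forall x, (forall y, f x y = 0) -> x = 0].

End LieAlgebras.

(* The choices the construction of tau depends on.  Index i : 'I_n.+1 runs
   through 0, ..., n.  [B1_is_A1] records whether rank one root systems count as
   being of type B_1; both conventions are in use, and neither is imposed. *)
Record datum (R : realType) (n : nat) := Datum {
  gg : vectType R[i];
  brk : gg -> gg -> gg;
  gform : gg -> gg -> R[i];
  sigma : 'I_n.+1 -> 'End(gg);
  sord : 'I_n.+1 -> nat;
  xi : 'I_n.+1 -> R[i];
  h0 : {vspace gg};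
  hh : {vspace gg};
  rk : nat;
  simp : 'I_rk -> 'Hom(subvs_of h0, (R[i])^o);
  beta0 : 'Hom(subvs_of h0, (R[i])^o);
  B1_is_A1 : bool;
  phi1_coef : R[i];
  phi2_coef : R[i] }.

Section Extend.
Variables (A : nmodType) (n : nat).

(* v |-> (0, v) *)
Definition cons0 (v : 'rV[A]_n) : 'rV[A]_n.+1 :=
  \row_i (if unlift ord0 i is Some j then v 0 j else 0).

Definition tail0 (v : 'rV[A]_n.+1) : 'rV[A]_n := \row_j v 0 (lift ord0 j).

End Extend.

Section Roots.
Variables (R : realType) (n : nat) (D : datum R n).
Local Notation C := R[i].
Local Notation g := (gg D).
Local Notation br := (@brk _ _ D).
Local Notation h0dual := 'Hom(subvs_of (h0 D), C^o).
Implicit Types (k : 'rV[int]_n.+1) (al be : h0dual).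

(* g(\bar k_0, \bar k) *)
Definition gdeg k : {vspace g} :=
  (\bigcap_i passmx.leigenspace (sigma D i) (xi D i ^ (k 0 i))%R)%VS.

Definition wt_vector al (x : g) := forall h, br (vsval h) x = al h *: x.

Definition h0_weight al := exists2 x, wt_vector al x & x != 0.

Definition h0_root al := al != 0 /\
  exists x, [/\ x \in gdeg 0, wt_vector al x & x != 0].

Definition represents (t : g) al := t \in h0 D /\
  forall h, @gform _ _ D t (vsval h) = al h.

(* Roots of minimal length.  The form is only normalized up to a complex
   scalar, hence lengths are compared through their ratio. *)
Definition short_root al := h0_root al /\ forall be ta tb, h0_root be ->
  represents ta al -> represents tb be ->
  1 <= @gform _ _ D tb tb / @gform _ _ D ta ta.

(* The root system is { +-e_i } `|` { +- e_i +- e_j | i < j }, e a basis. *)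
Definition type_B := exists (l : nat) (e : 'I_l -> h0dual),
  [/\ (0 < l)%N, l = 1%N -> B1_is_A1 D, basis_of fullv [seq e i | i : 'I_l] &
  forall al, h0_root al <->
    (exists (i : 'I_l) (s : bool), al = (-1) ^+ s *: e i) \/
    (exists (i j : 'I_l) (s t : bool), (i < j)%N /\
      al = (-1) ^+ s *: e i + (-1) ^+ t *: e j)].

(* Delta_{0,en}, which contains 0 *)
Definition root_en al := [\/ al = 0, h0_root al |
  type_B /\ exists2 be, short_root be & al = be *+ 2].

Definition simple_combination al := exists c : 'I_(rk D) -> nat,
  al = \sum_i simp i *+ c i.

Definition is_base := [/\ basis_of fullv [seq @simp _ _ D i | i : 'I_(rk D)],
  forall i : 'I_(rk D), h0_root (simp i) &
  forall al, h0_root al -> simple_combination al \/ simple_combination (- al)].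

Definition is_maximal_root be := root_en be /\
  forall al, root_en al -> simple_combination (be - al).

Record standing_assumptions : Prop := {
  sa_lie : lie_axioms br;
  sa_simple : simple_lie br fullv;
  sa_form : invariant_form br (@gform _ _ D);
  sa_aut : forall i x y, sigma D i (br x y) = br (sigma D i x) (sigma D i y);
  sa_comm : forall i j x, sigma D i (sigma D j x) = sigma D j (sigma D i x);
  sa_ord_gt0 : forall i, (0 < sord D i)%N;
  sa_ord_id : forall i x, iter (sord D i) (sigma D i) x = x;
  sa_ord_min : forall i (N : nat), (0 < N)%N ->
    (forall x, iter N (sigma D i) x = x) -> (sord D i <= N)%N;
  sa_xi : forall i, (sord D i).-primitive_root (xi D i);
  sa_g00_simple : simple_lie br (gdeg 0);
  sa_cartan0 : cartan_subalgebra br (gdeg 0) (h0 D);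
  sa_cartan : cartan_subalgebra br fullv (hh D);
  sa_cartan_sub : (h0 D <= hh D)%VS;
  sa_weights : forall al, h0_weight al <-> root_en al;
  sa_base : is_base;
  sa_beta0 : is_maximal_root (beta0 D) }.

(* H^*, in the coordinates H^* -> h(0)^* x C^{n+1} x C^{n+1},
   la |-> (la on h(0), (la K_i)_i, (la d_i)_i). *)
Definition Hdual := (h0dual * 'rV[C]_n.+1 * 'rV[C]_n.+1)%type.

Definition extH al : Hdual := (al, 0, 0).
Definition deltaH (i : 'I_n.+1) : Hdual := (0, 0, delta_mx 0 i).
Definition alpha0 : Hdual := extH (- beta0 D) + deltaH ord0.

Definition positiveH (ga : Hdual) := ga <> 0 /\
  exists (c0 : nat) (c : 'I_(rk D) -> nat),
    ga = alpha0 *+ c0 + \sum_i extH (simp i) *+ c i.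

End Roots.

Definition single_at (K : eqType) (E : zmodType) (k : K) (e : E) : K -> E :=
  fun l => if l == k then e else 0.

Section Tau.
Variables (R : realType) (n : nat) (D : datum R n).
Local Notation C := R[i].
Local Notation g := (gg D).
Local Notation br := (@brk _ _ D).
Local Notation Zn1 := 'rV[int]_n.+1.
Local Notation Cn1 := 'rV[C]_n.+1.
Implicit Types (k l r : Zn1) (i : 'I_n.+1).

(* Gamma_0 (+) Gamma *)
Definition in_Gamma r := [forall i, ((sord D i)%:Z %| (r 0 i)%R)%Z].

Definition cvec m (r : 'rV[int]_m) : 'rV[C]_m := map_mx intr r.

Definition dot m (u v : 'rV[C]_m) : C := \sum_i u 0 i * v 0 i.

(* tau is a quotient of a space of finitely supported functions f on Z^{n+1}:
   f k = (X, w, u) stands for X(k) + \sum_i w_i t^k K_i + \sum_i u_i t^k d_i. *)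
Definition fibre := (g * Cn1 * Cn1)%type.

Definition tau_fun := Zn1 -> fibre.

(* L(g, sigma) (+) (span of the symbols t^r K_i) (+) D(m_0, m) *)
Definition tau_hat : subspace tau_fun := lspan [set f : tau_fun |
  (exists k X, X \in gdeg D k /\ f = single_at k ((X, 0, 0) : fibre)) \/
  (exists r i, in_Gamma r /\ (f = single_at r ((0, delta_mx 0 i, 0) : fibre) \/
                             f = single_at r ((0, 0, delta_mx 0 i) : fibre)))].

Definition K_relations : subspace tau_fun := lspan [set f : tau_fun |
  exists r, in_Gamma r /\ f = single_at r ((0, cvec r, 0) : fibre)].

Definition tau : lmodType C := subquo tau_hat K_relations.

(* The bracket of x in degree k and y in degree l, a vector of degree k + l.
   The term (X, Y) \sum_i k_i t^{k+l} K_i exists only if k + l is in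
   Gamma_0 (+) Gamma; otherwise (X, Y) = 0. *)
Definition fibre_bracket k l (x y : fibre) : fibre :=
  let: (X, w, u) := x in let: (Y, z, v) := y in
  let k' := cvec k in let l' := cvec l in
  (br X Y + dot u l' *: Y - dot v k' *: X,
   (if in_Gamma (k + l) then @gform _ _ D X Y else 0) *: k'
     + (dot u l' *: z + dot u z *: k')
     - (dot v k' *: w + dot v w *: l')
     + (- phi1_coef D * dot u l' * dot v k'
        + phi2_coef D * dot u k' * dot v l') *: k',
   dot u l' *: v - dot v k' *: u).

Definition fun_bracket (x y : tau_fun) : tau_fun := fun m =>
  \sum_(k \in [set: Zn1]) fibre_bracket k (m - k) (x k) (y (m - k)).

Definition tau_pi : tau_fun -> tau := sq_pi tau_hat K_relations.

(* fun_bracket preserves tau_hat, and K_relations is an ideal for it. *)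
Definition tau_bracket (x y : tau) : tau :=
  tau_pi (fun_bracket (sq_repr x) (sq_repr y)).

(* For X in g(\bar k_0, \bar k) resp. r in Gamma_0 (+) Gamma only. *)
Definition tX k (X : g) : tau := tau_pi (single_at k ((X, 0, 0) : fibre)).
Definition tK r i : tau := tau_pi (single_at r ((0, delta_mx 0 i, 0) : fibre)).
Definition td r i : tau := tau_pi (single_at r ((0, 0, delta_mx 0 i) : fibre)).

Definition tau_plus : subspace tau := lspan [set x : tau |
  (exists k X al, [/\ X \in gdeg D k, wt_vector al X,
     positiveH (extH al + deltaH D ord0 *~ k 0 ord0) & x = tX k X]) \/
  (exists r i, [/\ in_Gamma r, 0 < r 0 ord0 & x = tK r i \/ x = td r i])].

End Tau.

Section Modules.
Variables (R : realType) (n : nat) (D : datum R n).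
Local Notation C := R[i].
Local Notation g := (gg D).
Local Notation Zn := 'rV[int]_n.
Variables (V : lmodType C) (rho : tau D -> {linear V -> V}).

Definition tau_module := is_rep setT (@tau_bracket _ _ D) setT (fun x => rho x).

Definition tau_irreducible := irreducible_on setT setT (fun x => rho x).

Definition weight_vector (la : Hdual D) (v : V) := [/\
  forall h : subvs_of (h0 D), rho (tX 0 (vsval h)) v = la.1.1 h *: v,
  forall i, rho (tK D 0 i) v = la.1.2 0 i *: v &
  forall i, rho (td D 0 i) v = la.2 0 i *: v].

(* The sum of the weight spaces is automatically direct. *)
Definition tau_integrable := [/\
  forall v, span_set [set w | exists la, weight_vector la w] v,
  forall la, finite_dim (weight_vector la) &
  forall k X al, al != 0 -> X \in gdeg D k -> wt_vector al X ->
    forall v, exists N, iter N (rho (tX k X)) v = 0].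

(* TV, TV_ k, WV and Vt below are T, T_k, W and \tilde V = T / W; Vt_ k is the
   image of T_k in T / W, which only depends on k modulo Gamma. *)
Definition tau_plus_killed (v : V) := forall x, tau_plus D x -> rho x v = 0.

Lemma tau_plus_killed_closed : tau_plus_killed 0 /\
  forall (c : C) u v, tau_plus_killed u -> tau_plus_killed v ->
    tau_plus_killed (c *: u + v).
Proof.
split=> [x _|c u v Tu Tv x Dx]; first by rewrite linear0.
by rewrite linearP Tu // Tv // scaler0 addr0.
Qed.

Definition TV : subspace V := Subspace tau_plus_killed_closed.

Variable la : Hdual D.

Definition TV_ (k : Zn) (v : V) := TV v /\ forall j : 'I_n,
  rho (td D 0 (lift ord0 j)) v = (la.2 0 (lift ord0 j) + (k 0 j)%:~R) *: v.

Variable C0 : C.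

(* The span of the t^r v - v, where t^r acts as C_0^{-1} t^r K_0. *)
Definition WV : subspace V := lspan [set w | exists (r : Zn) v,
  [/\ in_Gamma D (cons0 r), TV v &
      w = C0^-1 *: rho (tK D (cons0 r) ord0) v - v]].

Definition Vt : lmodType C := subquo TV WV.

Definition Vt_pi : V -> Vt := sq_pi TV WV.

Definition Vt_ (k : Zn) : set Vt := Vt_pi @` [set v | TV_ k v].

(* L~ and its elements, as functions on Z^n: x k = (u, X) stands for
   D(u, k) + X(k). *)
Definition L_fibre := ('rV[C]_n * g)%type.

Definition in_gring (X : g) := sigma D ord0 X = X /\
  forall h, h \in h0 D -> brk h X = 0.

Definition in_gring_ (k : Zn) (X : g) := in_gring X /\
  forall j : 'I_n, sigma D (lift ord0 j) X = xi D (lift ord0 j) ^ k 0 j *: X.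

Definition Ivec (u : 'rV[C]_n) (r : Zn) : Zn -> L_fibre :=
  single_at r ((u, 0) : L_fibre) - single_at 0 ((u, 0) : L_fibre).

Definition Lt : subspace (Zn -> L_fibre) := lspan [set x : Zn -> L_fibre |
  (exists u r, in_Gamma D (cons0 r) /\ x = Ivec u r) \/
  (exists k X, in_gring_ k X /\ x = single_at k ((0, X) : L_fibre))].

(* D(u, r) |-> \sum_i u_i t^r d_i and X(k) |-> X(0, k) *)
Definition to_tau (x : Zn -> L_fibre) : tau D := tau_pi (fun k =>
  if k 0 ord0 == 0 then
    let: (u, X) := x (tail0 k) in ((X, 0, cons0 u) : fibre D)
  else 0).

(* The action on T / W induced by the action on V, which preserves T and W, so
   that the choice of the representative is immaterial. *)
Definition Lt_act (x : Zn -> L_fibre) (v : Vt) : Vt :=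
  Vt_pi (rho (to_tau x) (sq_repr v)).

End Modules.

Arguments TV {R n D V} rho.
Arguments WV {R n D V} rho C0.
Arguments Vt {R n D V} rho C0.
Arguments Vt_ {R n D V} rho la C0 k _.
Arguments Lt_act {R n D V rho C0} x v.

Section GlnGring.
Variables (R : realType) (n : nat) (D : datum R n).
Local Notation C := R[i].

Definition gl_g := ('M[C]_n * gg D)%type.

Definition gl_gring (a : gl_g) := in_gring a.2.

Definition gl_bracket (a b : gl_g) : gl_g :=
  (a.1 *m b.1 - b.1 *m a.1, brk a.2 b.2).

(* I(u, r) |-> \sum_{i,j} u_i r_j E_ji = r^T u and X(k) |-> X *)
Definition Lt_quot (x : 'rV[int]_n -> L_fibre D) : gl_g :=
  (\sum_(r \in [set: 'rV[int]_n]) (cvec R r)^T *m (x r).1,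
   \sum_(k \in [set: 'rV[int]_n]) (x k).2).

End GlnGring.

Section Twist.
Variables (R : realType) (n : nat) (D : datum R n).

(* N is the order of the image of p in Lambda = Z^n / Gamma. *)
Definition has_order (p : 'rV[int]_n) (N : nat) := [/\ (0 < N)%N,
  in_Gamma D (cons0 (p *+ N)) &
  forall M, (0 < M)%N -> in_Gamma D (cons0 (p *+ M)) -> (N <= M)%N].

Definition theta_eigen (U : lmodType R[i]) (theta : U -> U) (zeta : R[i]) (i : nat)
  : set U := [set v | theta v = zeta ^- i *: v].

End Twist.

(* Main.v *)
(* A nonzero v in M_i lifts to a finite sum of weight vectors of T. Modulo W the
   operators t^r with r in Gamma are the identity, so the weight spaces of T at the
   weights of this sum, shifted by a finite set of representatives of Z^n modulo
   Gamma, span a finite-dimensional submodule of T/W containing v; it contains M_i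
   by irreducibility.

   The operators sum_p c_p t^r K_p commute with one another, and each is an
   eigenvector of ad I(e_i,-r) for a nonzero eigenvalue as soon as r_i is nonzero;
   those which preserve M_i are thus nilpotent with a common kernel, which is a
   submodule, and so they vanish on M_i. Hence M_i is a genuine module over the Lie
   algebra I + L(g). On it let E be the Euler field sum_i (t_i - 1) d/dt_i. The
   iterated differences of order k, in r, of I(u,r) and of X(r) are combinations of
   eigenvectors of ad E with eigenvalues growing with k, up to differences of order
   k + 1; as ad E has finitely many eigenvalues, I(u,r) and X(r) are polynomial in r,
   and an eigenvector of E whose eigenvalue is maximal along l + N is killed by
   all second differences of I(u,r) and first differences of X(r), that is by
   I_2 + F_1. The vectors so killed form a submodule, hence all of M_i. *)
Require Import Defs.
From mathcomp Require Import all_boot all_order all_algebra finmap.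
From mathcomp Require Import boolp classical_sets functions cardinality fsbigop reals.
From mathcomp Require Import complex.
From mathcomp Require Import ssrAC ring.
Set Implicit Arguments.
Unset Strict Implicit.
Unset Printing Implicit Defensive.
Import Order.TTheory GRing.Theory Num.Theory.
Local Open Scope classical_set_scope.
Local Open Scope ring_scope.

(** After rescaling [Gamma] to [Z^n], [I] consists of the vector fields that vanish at the point
    [t = 1], and a difference in direction [p] multiplies by [t_p - 1], as
    [t^(r + e_p) - t^r = t^r (t_p - 1)]. Thus [I_2] collects fields vanishing to second order there,
    [F_1] collects loops vanishing there, and [gl_n] is the linear part. The Euler field centred at
    that point measures the order of vanishing, which is why its spectrum decides what acts by zero.
    Two obstacles shape the argument. Exponents may be negative, and then the expansion at [t = 1]
    does not terminate; so polynomiality in [r] must be proved before a top eigenvector of the Euler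
    field can be used. Moreover brackets in [tau] produce central terms [t^r K_p], which are not in
    [Lt], so that neither the commutation rules of [Lt] on [T/W] nor the stability of an irreducible
    submodule under these terms is clear. What helps is that a central term occurring in a bracket
    is a commutator minus elements of [Lt], and therefore does preserve the submodule. *)

Lemma subrACA (T : zmodType) (x y z t : T) : x - y - (z - t) = x - z - (y - t).
Proof. by rewrite opprD addrACA -opprD. Qed.

(** * Iterated differences of functions on the lattice *)

Section Differences.
Variables (F : fieldType) (n : nat).
Local Notation Zn := 'rV[int]_n.

Definition eps (i : 'I_n) : Zn := delta_mx 0 i.

Definition diff (T : zmodType) (p : 'I_n) (f : Zn -> T) : Zn -> T :=
  fun r => f (r + eps p) - f r.

(** With [P] the whole lattice, [f] is polynomial of degree less than [N]. The set [P] only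
    restricts the base points of the [N]-fold differences, so that the property can first be shown
    on a cone. *)
Fixpoint vanishing (T : zmodType) (P : Zn -> Prop) (N : nat) (f : Zn -> T) : Prop :=
  if N is N'.+1 then forall p, vanishing P N' (diff p f)
  else forall r, P r -> f r = 0.

Definition up_closed (P : Zn -> Prop) := forall r p, P r -> P (r + eps p).

Lemma vanishingS (T : zmodType) P N (f : Zn -> T) :
  up_closed P -> vanishing P N f -> vanishing P N.+1 f.
Proof.
move=> Pup; elim: N f => [|N IHN] f vf p; last by apply: IHN; exact: vf.
by move=> r Pr; rewrite /diff !vf ?subrr //; exact: Pup.
Qed.

Lemma vanishing_le (T : zmodType) P N N' (f : Zn -> T) :
  up_closed P -> (N <= N')%N -> vanishing P N f -> vanishing P N' f.
Proof.
move=> Pup /subnKC<-; elim: (N' - N)%N => [|k IHk] vf; first by rewrite addn0.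
by rewrite addnS; apply: vanishingS => //; exact: IHk.
Qed.

Lemma vanishing_sub (T : zmodType) P N (f g : Zn -> T) :
  vanishing P N f -> vanishing P N g -> vanishing P N (fun r => f r - g r).
Proof.
elim: N f g => [|N IHN] f g vf vg; first by move=> r Pr; rewrite vf ?vg ?subrr.
move=> p; suff -> : diff p (fun r => f r - g r) = fun r => diff p f r - diff p g r.
  exact: IHN.
by apply/funext => r; rewrite /diff subrACA.
Qed.

Lemma vanishing_additive (T T' : zmodType) P N (f : Zn -> T) (h : T -> T') :
  (forall x y, h (x - y) = h x - h y) ->
  vanishing P N f -> vanishing P N (fun r => h (f r)).
Proof.
move=> hB; elim: N f => [|N IHN] f vf.
  by move=> r Pr; rewrite vf // -(subrr 0) hB subrr.
move=> p; suff -> : diff p (fun r => h (f r)) = fun r => h (diff p f r) by exact: IHN.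
by apply/funext => r; rewrite /diff hB.
Qed.

Lemma vanishing_shift (T : zmodType) P N (f : Zn -> T) s :
  (forall r, P r -> P (r + s)) -> vanishing P N f -> vanishing P N (fun r => f (r + s)).
Proof.
move=> Ps; elim: N f => [|N IHN] f vf; first by move=> r Pr; rewrite vf //; exact: Ps.
move=> p; suff -> : diff p (fun r => f (r + s)) = fun r => diff p f (r + s) by exact: IHN.
by apply/funext => r; rewrite /diff addrAC.
Qed.

Lemma vanishing_const (T : zmodType) P (c : T) : vanishing P 1 (fun=> c).
Proof. by move=> p r _; rewrite /diff subrr. Qed.

Lemma vanishing_coord (V : lmodType F) P N (f : Zn -> V) j : up_closed P ->
  vanishing P N f -> vanishing P N.+1 (fun r => (r 0 j)%:~R *: f r).
Proof.
move=> Pup; elim: N f => [|N IHN] f vf.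
  by move=> p r Pr; rewrite /diff !vf ?scaler0 ?subrr //; exact: Pup.
(* Leibniz rule: besides [r_j] times the difference of [f], a shifted copy of [f] appears when
   [p = j]. *)
move=> p; rewrite (_ : diff p _ =
  fun r => (r 0 j)%:~R *: diff p f r - (- (p == j)%:R) *: f (r + eps p)).
  apply: vanishing_sub; first exact/IHN/vf.
  apply: (@vanishing_additive _ _ _ _ (fun r => f (r + eps p))) => [x y|].
    by rewrite scalerBr.
  by apply: vanishing_shift => // r; exact: Pup.
apply: funext => r; rewrite /diff !mxE eqxx /= eq_sym rmorphD /= scalerDl scalerBr scaleNr opprK.
by rewrite rmorph_nat addrAC.
Qed.

(** Every lattice point is a translate of the single point [r0], so a statement on [P] about all
    translates of [f] reaches everything. *)
Lemma vanishing_everywhere (T : zmodType) P N (f : Zn -> T) r0 : P r0 ->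
  (forall s, vanishing P N (fun r => f (r + s))) -> vanishing setT N f.
Proof.
move=> Pr0; elim: N f => [|N IHN] f vf.
  by move=> r _; rewrite -(subrKC r0 r) (vf (r - r0)).
move=> p; apply: IHN => s; rewrite (_ : (fun r => _) = diff p (fun r => f (r + s))).
  exact: vf.
by apply/funext => r; rewrite /diff addrAC.
Qed.

End Differences.

(** * Spectra of matrices *)

Section MatrixSpectrum.
Variables (C : numClosedFieldType) (d : nat).
Local Notation Mx := 'M[C]_d.+1.

Definition comm_of (R : pzRingType) (x y : R) := x * y - y * x.

Lemma natr_shift_notin (c : C) (s : seq C) :
  exists N, forall k, (N <= k)%N -> c + k%:R \notin s.
Proof.
elim: s => [|z s [N IHs]]; first by exists 0%N.
have [[k0 zE]|noz] := pselect (exists k : nat, c + k%:R = z); last first.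
  by exists N => k /IHs; rewrite inE negb_or => ->; rewrite andbT; apply/eqP => e; apply: noz;
    exists k.
exists (maxn N k0.+1) => k; rewrite geq_max => /andP[/IHs + lt_k].
rewrite inE negb_or => ->; rewrite andbT -zE.
by rewrite (inj_eq (addrI _)) eqr_nat gtn_eqF.
Qed.

Lemma natr_shift_not_root (c : C) (p : {poly C}) : p != 0 ->
  exists N, forall k, (N <= k)%N -> ~~ root p (c + k%:R).
Proof.
move=> p0; have [s sE] := closed_field_poly_normal p.
have [N HN] := natr_shift_notin c s; exists N => k /HN.
by rewrite sE rootZ ?lead_coef_eq0 // root_prod_XsubC.
Qed.

(** [ad E] is an endomorphism of the finite-dimensional space of matrices: its eigenvalues are the
    roots of one characteristic polynomial, so only finitely many integers occur. *)
Lemma ad_eigen_bound (E : Mx) : exists N, forall (k : nat) (x : Mx),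
  (N <= k)%N -> comm_of E x = k%:R *: x -> x = 0.
Proof.
pose A := lin_mulmx E - lin_mulmxr E : 'M[C]_(d.+1 * d.+1).
have [|N HN] := @natr_shift_not_root 0 (char_poly A).
  exact/monic_neq0/char_poly_monic.
exists N => k x /HN; rewrite add0r -eigenvalue_root_char => + Ex.
apply: contraNeq => x0; apply/eigenvalueP; exists (mxvec x).
  by rewrite mulmxBr !mul_vec_lin -linearB -linearZ /= -Ex.
by rewrite mxvec_eq0.
Qed.

(** Start from any eigenvalue [l0] and take the largest [k] for which [l0 + k] is one. The transpose
    appears because [eigenvalue] speaks of row vectors. *)
Lemma top_eigenvector (E : Mx) : exists (l : C) (w : 'cV[C]_d.+1),
  [/\ w != 0, E *m w = l *: w & forall (k : nat) (v : 'cV[C]_d.+1),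
    (0 < k)%N -> E *m v = (l + k%:R) *: v -> v = 0].
Proof.
have eigP (l : C) : reflect (exists2 w : 'cV[C]_d.+1, E *m w = l *: w & w != 0)
    (root (char_poly E^T) l).
  rewrite -eigenvalue_root_char; apply: (iffP eigenvalueP) => -[w Ew w0].
    exists w^T; last by rewrite trmx_eq0.
    by rewrite -[E]trmxK -trmx_mul Ew linearZ.
  exists w^T; last by rewrite trmx_eq0.
  by rewrite -trmx_mul Ew linearZ.
have p0 : char_poly E^T != 0 by exact/monic_neq0/char_poly_monic.
have [|l0 rl0] := @closed_rootP _ (char_poly E^T) _; first by rewrite size_char_poly.
have [N HN] := natr_shift_not_root l0 p0.
have ex0 : exists k, root (char_poly E^T) (l0 + k%:R) by exists 0%N; rewrite addr0.
have ub k : root (char_poly E^T) (l0 + k%:R) -> (k <= N)%N.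
  by apply: contraTT; rewrite -ltnNge => /ltnW; exact: HN.
case: (ex_maxnP ex0 ub) => m /eigP[w Ew w0] maxm.
exists (l0 + m%:R), w; split=> // k v k0 Ev; apply/eqP; apply: contraTT k0 => v0.
rewrite -leqNgt -(leq_add2l m) addn0; apply: maxm; apply/eigP; exists v => //.
by rewrite Ev -addrA -natrD.
Qed.

End MatrixSpectrum.

Section CommOf.
Variables (F : fieldType) (d : nat).
Implicit Types x y z : 'M[F]_d.+1.

Lemma comm_ofBr x y z : comm_of x (y - z) = comm_of x y - comm_of x z.
Proof. by rewrite /comm_of mulrBr mulrBl subrACA. Qed.

Lemma comm_ofBl x y z : comm_of (x - y) z = comm_of x z - comm_of y z.
Proof. by rewrite /comm_of mulrBr mulrBl subrACA. Qed.

Lemma comm_ofNsum (I : finType) (f : I -> 'M[F]_d.+1) x :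
  comm_of (- \sum_i f i) x = - \sum_i comm_of (f i) x.
Proof.
by rewrite /comm_of mulNr mulrN -opprD mulr_sumr mulr_suml sumrB opprB.
Qed.

End CommOf.

(** The set [b + N^n], generated by unit steps so that identities between differences propagate by
    induction. *)
Inductive cone n (b : 'rV[int]_n) : 'rV[int]_n -> Prop :=
| cone_base : cone b b
| cone_step r p : cone b r -> cone b (r + eps p).

(** * The Euler field in a finite-dimensional representation *)

Section EulerField.
Variables (C : numClosedFieldType) (n d : nat).
Hypothesis n_gt0 : (0 < n)%N.
Local Notation Zn := 'rV[int]_n.
Local Notation Mx := 'M[C]_d.+1.
Variable a : 'I_n -> Zn -> Mx.
Hypothesis a_comm : forall i j r s, comm_of (a i r) (a j s) =
  (s 0 i)%:~R *: (a j (r + s) - a j s) - (r 0 j)%:~R *: (a i (r + s) - a i r).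

(* (t^r - 1) d_i acts as a i r, and euler as \sum_i (t_i - 1) d/dt_i. *)
Definition euler : Mx := - \sum_i a i (- eps i).

(** The model is [f s = t^(s + kap) y] with [y] of weight [l] for the Euler field, since
    [(t_i - 1) d/dt_i] sends [t^q] to [q_i (t^q - t^(q - e_i))]. The constant [c] accounts for the
    subtracted [d_j] in [a j s = t^s d_j - d_j]. *)
Definition euler_eigen (kap : 'rV[C]_n) (l : C) (c : Mx) (f : Zn -> Mx) :=
  forall s, comm_of euler (f s) =
    \sum_i (kap 0 i + (s 0 i)%:~R) *: (f s - f (s - eps i)) + l *: f s + c.

(** The relation satisfied by the loops [X(k + s)] for a fixed [X]; [kap] is the degree of the base
    point [k]. *)
Definition module_family (kap : 'rV[C]_n) (y : Zn -> Mx) :=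
  forall i r s, comm_of (a i r) (y s) =
    (kap 0 i + (s 0 i)%:~R) *: (y (s + r) - y s).

(** Differencing the coefficient [s_p] leaves one extra copy of [diff p f], which raises the
    eigenvalue by one; the constant drops out. *)
Lemma euler_eigen_diff kap l c f p :
  euler_eigen kap l c f -> euler_eigen kap (l + 1) 0 (diff p f).
Proof.
move=> Ef s; rewrite comm_ofBr !Ef [_ + _ + c in X in _ - X]addrC addrKA addr0.
rewrite opprD addrACA -scalerBr scalerDl scale1r addrA [RHS]addrAC; congr (_ + _).
have dE : \sum_i (i == p)%:R *: (f (s + eps p) - f (s + eps p - eps i)) = diff p f s.
  rewrite (bigD1 p) //= eqxx scale1r addrK big1 ?addr0 // => i /negPf->.
  by rewrite scale0r.
rewrite -sumrB -[X in _ = _ + X]dE -big_split; apply: eq_bigr => i _ /=;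
  rewrite !mxE eqxx /= rmorphD /=.
rewrite rmorph_nat addrA scalerDl addrAC -scalerBr; congr (_ *: _ + _).
by rewrite /diff subrACA [s - _ + _]addrAC.
Qed.

Lemma euler_eigen_module kap y : module_family kap y -> euler_eigen kap 0 0 y.
Proof.
move=> y_rel s; rewrite comm_ofNsum scale0r !addr0 -sumrN.
by apply: eq_bigr => i _; rewrite y_rel -scalerN opprB.
Qed.

(** Shift and weight come from writing [t^s d_j = t^(s + e_j) d/dt_j], where [d/dt_j] has weight
    [-1]. *)
Lemma euler_eigen_a j : euler_eigen (map_mx intr (eps j)) (- 1) (a j (- eps j)) (a j).
Proof.
move=> s; rewrite comm_ofNsum -sumrN scaleN1r.
under eq_bigr => i _ do rewrite a_comm opprB -[X in X - _]/(_ *: _) addrC.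
rewrite big_split /=.
have -> : \sum_i (((- eps i) 0 j)%:~R : C) *: (a i (- eps i + s) - a i (- eps i)) =
    a j (- eps j) - a j (s - eps j).
  rewrite (bigD1 j) //= !mxE !eqxx /= rmorphN /= scaleN1r opprB addrC big1 ?add0r.
    by rewrite [- _ + s]addrC.
  by move=> i /negPf ij; rewrite !mxE eq_sym ij andbF oppr0 scale0r.
have -> : \sum_i ((map_mx intr (eps j)) 0 i + (s 0 i)%:~R) *: (a j s - a j (s - eps i)) =
   (a j s - a j (s - eps j)) +
   \sum_i (s 0 i)%:~R *: (a j s - a j (s - eps i)) :> Mx.
  rewrite [X in X + _](_ : _ = \sum_i (i == j)%:R *: (a j s - a j (s - eps i))); last first.
    rewrite (bigD1 j) //= eqxx scale1r big1 ?addr0 // => i /negPf->.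
    by rewrite scale0r.
  rewrite -big_split; apply: eq_bigr => i _ /=; rewrite !mxE eqxx /=.
  by rewrite rmorph_nat scalerDl.
rewrite -[X in _ = X - _ + _]addrA [X in _ = X - _ + _]addrC addrK.
rewrite [X in _ = X + _]addrC -addrA; congr (_ + _); last exact: addrC.
by apply: eq_bigr => i _; rewrite -scalerN opprB [- _ + s]addrC.
Qed.

(** At the vertex [- eps j] all coefficients [kap_i + s_i] vanish, so [f] is there a true
    eigenvector, for an eigenvalue that is too large. A unit step adds a difference of [f], whose
    eigenvalue is larger still. *)
Lemma euler_eigen_cone (N : nat) kap : (forall (k : nat) (x : Mx),
    (N <= k)%N -> comm_of euler x = k%:R *: x -> x = 0) ->
  forall j, kap = map_mx intr (eps j) ->
  forall f k, (N <= k)%N -> euler_eigen kap k%:R 0 f ->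
  forall r, cone (- eps j) r -> f r = 0.
Proof.
move=> HN j -> f k + + r Pr; elim: Pr f k => [|{}r p _ IHr] f k Nk Ef.
  apply: (HN k) => //; rewrite Ef addr0 big1 ?add0r // => i _.
  by rewrite !mxE rmorphN /= subrr scale0r.
rewrite -(subrK (f r) (f _)) -/(diff p f r) (IHr f k) // addr0.
apply: (IHr _ k.+1); first exact: leqW.
by rewrite -natr1; apply: euler_eigen_diff Ef.
Qed.

Lemma vanishing_cone : exists N, forall j, vanishing (cone (- eps j)) N.+1 (a j).
Proof.
have [N HN] := ad_eigen_bound euler; exists N => j p.
have van k f l : (N <= l + k)%N -> euler_eigen (map_mx intr (eps j)) l%:R 0 f ->
    vanishing (cone (- eps j)) k f.
  elim: k f l => [|k IHk] f l Nlk Ef.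
    by apply: (euler_eigen_cone HN) Ef; rewrite // -(addn0 l).
  move=> q; apply: (IHk _ l.+1); first by rewrite addSnnS.
  by rewrite -natr1; apply: euler_eigen_diff Ef.
(* One difference brings the eigenvalue of [a j] from [-1] to [0] and removes its constant; [N] more
   reach the bound. *)
apply: (van _ _ 0%N); first by rewrite add0n.
by have := euler_eigen_diff p (@euler_eigen_a j); rewrite addNr.
Qed.

(* The relation of a j r with a j s, read at (r, s) and (r + e_j, s - e_j),
   isolates a j (r + s), whatever the sign of r + s. *)
Lemma vanishing_a : exists N, forall j, vanishing setT N.+1 (a j).
Proof.
have [N HN] := vanishing_cone; exists N.+1 => j.
have cup : up_closed (cone (- eps j)) by move=> r p; exact: cone_step.
pose G (s r : Zn) := ((s 0 j)%:~R - (r 0 j)%:~R) *: a j (r + s).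
have vG s : vanishing (cone (- eps j)) N.+2 (G s).
  have -> : G s = fun r => comm_of (a j r) (a j s) -
      ((r 0 j)%:~R *: a j r - (s 0 j)%:~R *: a j s).
    apply: funext => r; rewrite a_comm /G scalerBl !scalerBr.
    by rewrite -addrA -opprD addrA subrK subrACA subrr subr0.
  apply: vanishing_sub.
    apply: (vanishing_additive (f := a j) (h := fun x => comm_of x (a j s))).
      by move=> x y; exact: comm_ofBl.
    exact: vanishingS.
  apply: vanishing_sub; first exact: vanishing_coord.
  by apply: (@vanishing_le _ _ _ 1) => //; exact: vanishing_const.
apply: (vanishing_everywhere (cone_base (- eps j))) => s.
rewrite (_ : (fun r => _) = fun r => 2^-1 *: (G s r - G (s - eps j) (r + eps j))).
  apply: (vanishing_additive (f := fun r => G s r - G (s - eps j) (r + eps j))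
    (h := fun x => 2^-1 *: x)).
    by move=> x y; rewrite scalerBr.
  apply: vanishing_sub => //.
  by apply: (vanishing_shift (f := G (s - eps j)) (s := eps j)) => // r; exact: cone_step.
apply: funext => r; rewrite /G [r + _ + _]addrACA subrr addr0 -scalerBl scalerA.
rewrite !mxE !eqxx /= rmorphB rmorphD /= [X in _ * X](_ : _ = 2).
  by rewrite mulVf ?scale1r // pnatr_eq0.
by ring.
Qed.

(** Where [kap_i + s_i] is nonzero, the relation of [a i r] with [y s] can be solved for
    [y (r + s)], which inherits polynomiality in [r] from [a i]. *)
Lemma vanishing_module kap y : module_family kap y -> exists N, vanishing setT N y.
Proof.
move=> y_rel; have [N HN] := vanishing_a; exists N.+1.
pose i := Ordinal n_gt0.
have [s ks] : exists s : Zn, kap 0 i + (s 0 i)%:~R != 0.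
  have [k0|] := eqVneq (kap 0 i) 0; [exists (eps i)|exists 0]; last by rewrite mxE addr0.
  by rewrite !mxE !eqxx k0 add0r oner_eq0.
have yE r : y (r + s) = (kap 0 i + (s 0 i)%:~R)^-1 *: comm_of (a i r) (y s) - - y s.
  by rewrite opprK y_rel scalerA mulVf // scale1r subrK addrC.
suff yv : vanishing setT N.+1 (fun r => y (r + s)).
  rewrite (_ : y = fun r => y (r - s + s)); last by apply: funext => r; rewrite subrK.
  exact: (vanishing_shift (f := fun r => y (r + s))).
rewrite (funext yE).
apply: vanishing_sub; last first.
  by apply: (@vanishing_le _ _ _ 1) => //; exact: vanishing_const.
apply: (vanishing_additive (f := a i)
  (h := fun x => (kap 0 i + (s 0 i)%:~R)^-1 *: comm_of x (y s))) => // x z.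
by rewrite comm_ofBl scalerBr.
Qed.

Section TopVector.
Variables (l : C) (w : 'cV[C]_d.+1).
Hypothesis Ew : euler *m w = l *: w.
Hypothesis top : forall (k : nat) (v : 'cV[C]_d.+1),
  (0 < k)%N -> euler *m v = (l + k%:R) *: v -> v = 0.

(** Induction on the degree: the differences of [f] have a larger eigenvalue and already kill [w].
    Applied to [w], the relation of [f] is then an exact eigenvector equation, and [f s *m w] would
    have eigenvalue [l + k], against the maximality of [l]. *)
Lemma top_vector_killed kap k f N : (0 < k)%N -> euler_eigen kap k%:R 0 f ->
  vanishing setT N f -> forall s, f s *m w = 0.
Proof.
elim: N k f => [|N IHN] k f k0 Ef vf s; first by rewrite vf // mul0mx.
have df p r : diff p f r *m w = 0.
  by apply: (IHN k.+1) => //; rewrite -natr1; apply: euler_eigen_diff Ef.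
apply: (top k0); have : comm_of euler (f s) *m w = k%:R *: (f s *m w).
  rewrite Ef addr0 mulmxDl mulmx_suml big1 ?add0r -?scalemxAl // => i _.
  by rewrite -scalemxAl; have := df i (s - eps i); rewrite /diff subrK => ->; rewrite scaler0.
rewrite mulmxBl -!mulmxA Ew -scalemxAr => /eqP; rewrite subr_eq => /eqP->.
by rewrite addrC scalerDl.
Qed.

End TopVector.

Lemma common_killed_vector : exists w : 'cV[C]_d.+1, [/\ w != 0,
  forall j p q r, diff p (diff q (a j)) r *m w = 0 &
  forall kap y, module_family kap y -> forall p s, diff p y s *m w = 0].
Proof.
have [l [w [w0 Ew top]]] := top_eigenvector euler.
exists w; split=> // [j p q r|kap y y_rel p s].
  have [N HN] := vanishing_a.
  apply: (top_vector_killed Ew top (kap := map_mx intr (eps j)) (k := 1) (N := N.+1)) => //.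
    (* The eigenvalue [1] is the first positive one: [a j] reaches it from [-1] by two differences,
       a module family from [0] by one. This is where the orders two and one in [I_2] and [F_1] come
       from. *)
    rewrite -(add0r 1%:R) -(addNr 1); do 2!apply: euler_eigen_diff.
    exact: euler_eigen_a.
  exact: (vanishingS _ (vanishingS _ (HN j)) q p).
have [N HN] := vanishing_module y_rel.
apply: (top_vector_killed Ew top (kap := kap) (k := 1) (N := N)) => //.
  by rewrite -(add0r 1%:R); apply/euler_eigen_diff/euler_eigen_module.
exact: vanishingS HN p.
Qed.

End EulerField.

(** * Commuting nilpotent matrices *)

Section Nilpotent.
Variables (C : numClosedFieldType) (d : nat).
Local Notation Mx := 'M[C]_d.+1.

(** [z ^+ k] is an eigenvector of [ad E] for the eigenvalue [k], unless it is zero, and large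
    integers are not eigenvalues. *)
Lemma ad_eigen_nilpotent (E z : Mx) : comm_of E z = z -> exists N, z ^+ N = 0.
Proof.
move=> Ez; have [N HN] := ad_eigen_bound E; exists N; apply: (HN N) => //.
elim: N {HN} => [|N IHN]; first by rewrite /comm_of expr0 mulr1 mul1r subrr scale0r.
rewrite -natr1 scalerDl scale1r exprS -[X in _ = _ + X * _]Ez scalerAr -IHN.
by rewrite /comm_of mulrBl mulrBr !mulrA [RHS]addrC [RHS]addrA subrK.
Qed.

(** Take a nonzero row space of minimal rank stable under [Zs]. Its intersection with [kermx z] is
    stable because the matrices commute and nonzero because [z] is nilpotent; by minimality it is
    the whole space. *)
Lemma common_kernel_row (Zs : Mx -> Prop) :
  (forall z z', Zs z -> Zs z' -> z *m z' = z' *m z) ->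
  (forall z, Zs z -> exists N, z ^+ N = 0) ->
  exists w : 'rV[C]_d.+1, w != 0 /\ forall z, Zs z -> w *m z = 0.
Proof.
move=> Zcomm Znil.
pose stab (A : Mx) := forall z, Zs z -> (A *m z <= A)%MS.
pose P k := `[< exists A : Mx, [/\ \rank A = k, (0 < k)%N & stab A] >].
have exP : exists k, P k.
  exists d.+1; apply/asboolP; exists 1%:M; split=> //; first by rewrite mxrank1.
  by move=> z _; exact: submx1.
case: (ex_minnP exP) => k /asboolP[A [rA k0 stA]] minA.
have Az z : Zs z -> A *m z = 0.
  move=> Zz; set B := (A :&: kermx z)%MS.
  have stB : stab B.
    move=> z' Zz'; rewrite sub_capmx; apply/andP; split.
      by apply: submx_trans (stA _ Zz'); apply: submxMr; exact: capmxSl.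
    apply/sub_kermxP; rewrite -mulmxA (Zcomm z' z) // mulmxA.
    by have /sub_kermxP-> := capmxSr A (kermx z); rewrite mul0mx.
  have rB : (0 < \rank B)%N.
    rewrite lt0n mxrank_eq0; apply/eqP => B0; have [N zN] := Znil z Zz.
    (* If [z] were injective on [A], every [A *m z ^+ i] would keep the rank of [A]. *)
    have Azk i : (A *m z ^+ i <= A)%MS /\ \rank (A *m z ^+ i) = \rank A.
      elim: i => [|i [sub rk]]; first by rewrite expr0 mulmx1.
      rewrite exprSr -mulmxE mulmxA; split.
        by apply: submx_trans (stA _ Zz); exact: submxMr.
      rewrite -rk -(mxrank_mul_ker (A *m z ^+ i) z).
      suff -> : (A *m z ^+ i :&: kermx z)%MS = 0 by rewrite mxrank0 addn0.
      by apply/eqP; rewrite -submx0 -B0; exact: capmxS.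
    have [_] := Azk N; rewrite zN mulmx0 mxrank0 => rA0.
    by move: k0; rewrite -rA -rA0.
  have kB : (k <= \rank B)%N by apply: minA; apply/asboolP; exists B.
  apply/sub_kermxP; apply: submx_trans (capmxSr A _).
  by rewrite -(geq_leqif (mxrank_leqif_sup (capmxSl A _))) rA.
exists (nz_row A); split; first by rewrite nz_row_eq0 -mxrank_eq0 rA -lt0n.
by move=> z Zz; have /submxP[D ->] := nz_row_sub A; rewrite -mulmxA Az // mulmx0.
Qed.

Lemma common_kernel (Zs : Mx -> Prop) :
  (forall z z', Zs z -> Zs z' -> z *m z' = z' *m z) ->
  (forall z, Zs z -> exists N, z ^+ N = 0) ->
  exists w : 'cV[C]_d.+1, w != 0 /\ forall z, Zs z -> z *m w = 0.
Proof.
move=> Zcomm Znil.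
have [||w [w0 Zw]] := @common_kernel_row (fun z => Zs z^T).
- by move=> z z' Zz Zz'; apply: trmx_inj; rewrite !trmx_mul Zcomm.
- move=> z /Znil[N zN]; exists N; apply: trmx_inj; rewrite trmx0 -zN.
  elim: N {zN} => [|N IHN]; first by rewrite !expr0 trmx1.
  by rewrite exprSr exprS -mulmxE trmx_mul IHN.
exists w^T; split; first by rewrite trmx_eq0.
by move=> z Zz; rewrite -[z]trmxK -trmx_mul Zw ?trmx0 // trmxK.
Qed.

End Nilpotent.

(** A predicate rather than a structure, since operators such as those induced on [T/W] are linear
    only under conditions on their parameters. *)
Definition linear_op (F : fieldType) (U V : lmodType F) (f : U -> V) :=
  forall c u v, f (c *: u + v) = c *: f u + f v.

Section LinearOps.
Variables (F : fieldType) (U V : lmodType F).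
Variables (f : U -> V).
Hypothesis fl : linear_op f.

Lemma linear_opD u v : f (u + v) = f u + f v.
Proof. by have := fl 1 u v; rewrite !scale1r. Qed.

Lemma linear_op0 : f 0 = 0.
Proof. by have /eqP := linear_opD 0 0; rewrite addr0 -subr_eq0 opprD addNKr oppr_eq0 => /eqP. Qed.

Lemma linear_opZ c u : f (c *: u) = c *: f u.
Proof. by have := fl c u 0; rewrite linear_op0 !addr0. Qed.

Lemma linear_opB u v : f (u - v) = f u - f v.
Proof. by rewrite linear_opD -[- v]scaleN1r linear_opZ scaleN1r. Qed.

Lemma linear_op_sum (I : Type) (s : seq I) (P : pred I) (E : I -> U) :
  f (\sum_(i <- s | P i) E i) = \sum_(i <- s | P i) f (E i).
Proof.
apply: (big_morph f); [exact: linear_opD|exact: linear_op0].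
Qed.

End LinearOps.

(** * Coordinates on finite-dimensional subspaces *)

Section SubspaceLemmas.
Variables (F : fieldType) (U : lmodType F).
Implicit Types S : subspace U.

Lemma ss0 S : S 0. Proof. by case: (ss_closed S). Qed.

Lemma ssP S c u v : S u -> S v -> S (c *: u + v).
Proof. by case: (ss_closed S) => _; apply. Qed.

Lemma ssD S u v : S u -> S v -> S (u + v).
Proof. by move=> Su Sv; rewrite -[u]scale1r; exact: ssP. Qed.

Lemma ssZ S c u : S u -> S (c *: u).
Proof. by move=> Su; rewrite -[_ *: _]addr0; apply: ssP => //; exact: ss0. Qed.

Lemma ssB S u v : S u -> S v -> S (u - v).
Proof. by move=> Su Sv; rewrite addrC -scaleN1r; exact: ssP. Qed.

Lemma ss_sum S (I : Type) (s : seq I) (P : pred I) (E : I -> U) :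
  (forall i, P i -> S (E i)) -> S (\sum_(i <- s | P i) E i).
Proof. by move=> SE; apply: big_ind SE; [exact: ss0|exact: ssD]. Qed.

Lemma ss_sum_seq S (I : eqType) (s : seq I) (E : I -> U) :
  (forall i, i \in s -> S (E i)) -> S (\sum_(i <- s) E i).
Proof. by move=> SE; rewrite big_seq; exact: ss_sum. Qed.

Lemma lspan_sub (A : set U) S : (forall v, A v -> S v) -> forall v, lspan A v -> S v.
Proof.
move=> AS _ [s [As ->]]; apply: ss_sum_seq => p /As /AS Sp; exact: ssZ.
Qed.

Lemma sub_lspan (A : set U) v : A v -> lspan A v.
Proof.
move=> Av; exists [:: (1, v)]; split; first by move=> p; rewrite inE => /eqP->.
by rewrite big_seq1 scale1r.
Qed.

(** The family in [finite_dim] may lie outside [S], so coordinates are built by induction on its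
    size: dropping one vector from the family either still covers [S] or cuts it to a hyperplane
    [S'], complemented by the line of any [v0] in [S] outside it. *)
Lemma finite_dim_model S : finite_dim S ->
  exists (k : nat) (vec : 'cV[F]_k -> U),
    [/\ linear_op vec, injective vec & forall v, S v <-> exists x, v = vec x].
Proof.
case=> m; elim: m S => [|m IHm] S [b bP].
  exists 0%N, (fun=> 0); split.
  - by move=> c u v; rewrite scaler0 addr0.
  - by move=> x y _; rewrite [x]flatmx0 [y]flatmx0.
  move=> v; split=> [/bP[c ->]|[x ->]]; last exact: ss0.
  by exists 0; rewrite big_ord0.
pose sp v := exists c : 'I_m -> F, v = \sum_i c i *: b (lift ord0 i).
have S'c : (S 0 /\ sp 0) /\ forall (c : F) (u v : U), S u /\ sp u -> S v /\ sp v ->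
    S (c *: u + v) /\ sp (c *: u + v).
  split=> [|c u v [Su [cu uE]] [Sv [cv vE]]]; first split; first exact: ss0.
    by exists (fun=> 0); rewrite big1 // => i _; rewrite scale0r.
  split; first exact: ssP.
  exists (fun i => c * cu i + cv i); rewrite uE vE scaler_sumr -big_split.
  by apply: eq_bigr => i _; rewrite scalerDl scalerA.
pose S' := @Subspace _ _ (fun v => S v /\ sp v) S'c.
have [|k [vec [vl vi vP]]] := IHm S'; first by exists (b \o lift ord0) => v [_ []] c; exists c.
have [SS'|] := pselect (forall v, S v -> S' v).
  exists k, vec; split=> // v; split=> [/SS'/vP //|/vP[]//].
move=> /existsNP[v0 /not_implyP[Sv0 nS'v0]].
have [c0 v0E] := bP _ Sv0.
have c00 : c0 ord0 != 0.
  apply/eqP => c00; apply: nS'v0; split=> //.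
  by exists (c0 \o lift ord0); rewrite v0E big_ord_recl c00 scale0r add0r.
exists (1 + k)%N, (fun x : 'cV_(1 + k) => usubmx x 0 0 *: v0 + vec (dsubmx x)); split.
- move=> c x y; rewrite (linearP dsubmx) vl (linearP usubmx) !mxE.
  by rewrite scalerDl scalerDr scalerA addrACA.
- move=> x y; set p := usubmx x 0 0; set q := usubmx y 0 0 => e.
  have pq : p = q.
    apply/eqP/negPn/negP; rewrite -subr_eq0 => pq; apply: nS'v0.
    have {}e : (p - q) *: v0 = vec (dsubmx y - dsubmx x).
      by rewrite (linear_opB vl) scalerBl; apply/eqP;
        rewrite subr_eq addrAC eq_sym subr_eq addrC -e.
    rewrite -[v0](scalerK pq) e -(linear_opZ vl); apply/vP; by eexists.
  move: e; rewrite pq => /addrI/vi e; rewrite -[x]vsubmxK -[y]vsubmxK e; congr col_mx.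
  by apply/matrixP => i j; rewrite !ord1.
move=> v; split=> [Sv|[x ->]]; last first.
  apply: ssP => //; suff: S' (vec (dsubmx x)) by case.
  by apply/vP; eexists.
have [c vE] := bP _ Sv; pose e := c ord0 / c0 ord0.
have /vP[x xE] : S' (v - e *: v0).
  split; first by apply: ssB => //; exact: ssZ.
  exists (fun i => c (lift ord0 i) - e * c0 (lift ord0 i)).
  rewrite vE v0E scaler_sumr -sumrB big_ord_recl scalerA -scalerBl divfK //.
  rewrite subrr scale0r add0r; apply: eq_bigr => i _.
  by rewrite scalerA -scalerBl.
exists (col_mx (const_mx e) x); rewrite col_mxKu col_mxKd mxE -xE addrC subrK //.
Qed.

Lemma finite_dim_basis S : finite_dim S ->
  exists (k : nat) (b : 'I_k -> U), (forall i, S (b i)) /\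
    forall v, S v -> exists c : 'I_k -> F, v = \sum_i c i *: b i.
Proof.
move=> /finite_dim_model[k [vec [vl _ vP]]].
exists k, (fun i => vec (delta_mx i 0)); split=> [i|v /vP[x ->]].
  by apply/vP; eexists.
exists (x ^~ 0); rewrite {1}[x]matrix_sum_delta (linear_op_sum vl).
by apply: eq_bigr => i _; rewrite big_ord1 (linear_opZ vl).
Qed.

Lemma nonzero_model S : finite_dim S -> (exists2 v, S v & v != 0) ->
  exists (d : nat) (vec : 'cV[F]_d.+1 -> U),
    [/\ linear_op vec, injective vec & forall v, S v <-> exists x, v = vec x].
Proof.
move=> /finite_dim_model[[|d] [vec [vl vi vP]]] [v Sv v0]; last by exists d, vec.
case/vP: Sv v0 => x ->; by rewrite [x]flatmx0 (linear_op0 vl) eqxx.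
Qed.

Lemma op_matrix S k (vec : 'cV[F]_k -> U) (f : U -> U) : linear_op vec ->
  (forall v, S v <-> exists x, v = vec x) -> linear_op f -> (forall v, S v -> S (f v)) ->
  exists X : 'M[F]_k, forall x, f (vec x) = vec (X *m x).
Proof.
move=> vl vP fl Sf.
have /choice[crd crdE] i : exists y, f (vec (delta_mx i 0)) = vec y.
  by apply/vP/Sf/vP; eexists.
exists (\matrix_(i, j) crd j i 0) => x.
rewrite {1}[x]matrix_sum_delta (linear_op_sum vl) (linear_op_sum fl).
have -> : (\matrix_(i, j) crd j i 0) *m x = \sum_j x j 0 *: crd j.
  apply/matrixP => i j; rewrite !mxE summxE ord1; apply: eq_bigr => l _.
  by rewrite !mxE mulrC.
rewrite (linear_op_sum vl); apply: eq_bigr => i _.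
by rewrite big_ord1 !(linear_opZ vl) (linear_opZ fl) crdE.
Qed.

End SubspaceLemmas.

Section Dot.
Variables (R : realType) (m : nat).
Implicit Types (u v w : 'rV[R[i]]_m) (c : R[i]).

Lemma dotC u v : dot u v = dot v u.
Proof. by apply: eq_bigr => i _; rewrite mulrC. Qed.

Lemma dot_linl c u v w : dot (c *: u + v) w = c * dot u w + dot v w.
Proof.
by rewrite /dot mulr_sumr -big_split; apply: eq_bigr => i _; rewrite !mxE mulrDl mulrA.
Qed.

Lemma dot_linr c u v w : dot w (c *: u + v) = c * dot w u + dot w v.
Proof. by rewrite dotC dot_linl ![dot w _]dotC. Qed.

Lemma dot0l v : dot 0 v = 0.
Proof. by rewrite /dot big1 // => i _; rewrite mxE mul0r. Qed.

Lemma dot0r v : dot v 0 = 0.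
Proof. by rewrite dotC dot0l. Qed.

Lemma dot_deltal (i : 'I_m) v : dot (delta_mx 0 i) v = v 0 i.
Proof.
rewrite /dot (bigD1 i) //= big1 => [|j /negPf ji]; last by rewrite !mxE ji andbF mul0r.
by rewrite !mxE !eqxx mul1r addr0.
Qed.

Lemma dotDr u v w : dot u (v + w) = dot u v + dot u w.
Proof. by rewrite /dot -big_split; apply: eq_bigr => i _; rewrite mxE mulrDr. Qed.

Lemma cvecD (r s : 'rV[int]_m) : cvec R (r + s) = cvec R r + cvec R s.
Proof. exact: map_mxD. Qed.

End Dot.

Section LatticeFunctions.
Variables (n : nat) (T : zmodType).
Implicit Types f : 'rV[int]_n -> T.

Lemma diff0_const f : (forall p r, diff p f r = 0) -> forall r s, f (r + s) = f r.
Proof.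
move=> df; have step p r : f (r + eps p) = f r by apply/eqP; rewrite -subr_eq0 -/(diff p f r) df.
pose P s := forall r, f (r + s) = f r.
have P0 : P 0 by move=> r; rewrite addr0.
have PD s s' : P s -> P s' -> P (s + s') by move=> Ps Ps' r; rewrite addrA Ps' Ps.
have PN s : P s -> P (- s) by move=> Ps r; rewrite -(Ps (r - s)) subrK.
have Pn p (k : nat) : P (k%:Z *: eps p).
  elim: k => [|k IHk]; first by rewrite scale0r.
  have -> : k.+1%:Z = k%:Z + 1 by rewrite -addn1.
  rewrite scalerDl scale1r; apply: PD => // r; exact: step.
move=> r s; rewrite [s]row_sum_delta; suff: P (\sum_j s 0 j *: delta_mx 0 j) by apply.
apply: (big_ind P) => // p _; case: (s 0 p) => k; first exact: Pn.
by rewrite NegzE scaleNr; apply: PN; exact: Pn.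
Qed.

(** Each [diff q f] is constant, so [t |-> f (t + s) - f t] has zero differences and keeps the value
    [f s] that it takes at [0]. *)
Lemma diff2_additive f : f 0 = 0 -> (forall p q r, diff p (diff q f) r = 0) ->
  forall r s, f (r + s) = f r + f s.
Proof.
move=> f0 d2f r s.
have dc q t : diff q f t = diff q f 0.
  by have := diff0_const (fun p r => d2f p q r) 0 t; rewrite add0r.
pose h t := f (t + s) - f t.
have /diff0_const hc : forall p t, diff p h t = 0.
  move=> p t; rewrite /diff /h subrACA [t + _ + s]addrAC -/(diff p f (t + s)).
  by rewrite -/(diff p f t) !(dc p) subrr.
have := hc 0 r; rewrite /h add0r f0 subr0 !add0r => /eqP.
by rewrite subr_eq [f s + _]addrC => /eqP.
Qed.

End LatticeFunctions.

(** * Irreducible representations with central terms *)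

Section TwistedJets.
Variables (R : realType) (n : nat) (n_gt0 : (0 < n)%N).
Local Notation C := R[i].
Local Notation Zn := 'rV[int]_n.
Local Notation Cn := 'rV[C]_n.
Variables (m : 'I_n -> nat) (m_gt0 : forall i, (0 < m i)%N).

(** Identifies [Z^n] with [Gamma], to transport the results on the Euler field, which are stated
    over the full lattice. *)
Definition dilate (r : Zn) : Zn := \row_j (r 0 j * (m j)%:Z).
Definition lattice (r : Zn) : Prop := exists s, r = dilate s.

Lemma dilateD r s : dilate (r + s) = dilate r + dilate s.
Proof. by apply/rowP => j; rewrite !mxE mulrDl. Qed.

Lemma dilate0 : dilate 0 = 0.
Proof. by apply/rowP => j; rewrite !mxE mul0r. Qed.

Lemma latticeD r s : lattice r -> lattice s -> lattice (r + s).
Proof. by move=> [r' ->] [s' ->]; exists (r' + s'); rewrite dilateD. Qed.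

Lemma latticeN r : lattice r -> lattice (- r).
Proof. by move=> [r' ->]; exists (- r'); apply/rowP => j; rewrite !mxE mulNr. Qed.

Variables (g : Type) (bra : g -> g -> g) (G : Zn -> g -> Prop) (U : lmodType C).
Variables (A : Cn -> Zn -> U -> U) (Y : g -> Zn -> U -> U) (Z : Cn -> Zn -> U -> U).
Variables (gA : Cn -> Cn -> Zn -> Zn -> C) (gY : g -> g -> Zn -> Zn -> C).

(* A u r, Y X k and Z c r stand for I(u,r), X(k) and \sum_p c_p t^r K_p acting on
   T/W; the gA and gY terms come from the cocycle and from the invariant form. *)
Record twisted_relations : Prop := {
  tr_linA : forall u r, lattice r -> linear_op (A u r);
  tr_linY : forall X k, G k X -> linear_op (Y X k);
  tr_linZ : forall c r, lattice r -> linear_op (Z c r);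
  tr_A : forall r w, lattice r -> linear_op (fun u : Cn => A u r w);
  tr_A0 : forall u w, A u 0 w = 0;
  tr_Z : forall r w, lattice r -> linear_op (fun c : Cn => Z c r w);
  tr_Z0 : forall c w, Z c 0 w = 0;
  tr_GD : forall k r X, lattice r -> G k X -> G (k + r) X;
  tr_Gbra : forall k l X X', G k X -> G l X' -> G (k + l) (bra X X');
  tr_AA : forall u v r s w, lattice r -> lattice s ->
    A u r (A v s w) - A v s (A u r w) =
    dot u (cvec R s) *: (A v (r + s) w - A v s w)
    - dot v (cvec R r) *: (A u (r + s) w - A u r w)
    + gA u v r s *: Z (cvec R r) (r + s) w;
  tr_AY : forall u r X k w, lattice r -> G k X ->
    A u r (Y X k w) - Y X k (A u r w) =
    dot u (cvec R k) *: (Y X (k + r) w - Y X k w);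
  tr_YY : forall X X' k l w, G k X -> G l X' ->
    Y X k (Y X' l w) - Y X' l (Y X k w) =
    Y (bra X X') (k + l) w + gY X X' k l *: Z (cvec R k) (k + l) w;
  tr_gY : forall X X' k l, gY X X' k l != 0 -> lattice (k + l);
  tr_AZ : forall u s c r w, lattice s -> lattice r ->
    A u s (Z c r w) - Z c r (A u s w) =
    dot u (cvec R r) *: (Z c (r + s) w - Z c r w)
    + dot u c *: Z (cvec R s) (r + s) w;
  tr_YZ : forall X k c r w, G k X -> lattice r ->
    Y X k (Z c r w) = Z c r (Y X k w);
  tr_ZZ : forall c r c' r' w, lattice r -> lattice r' ->
    Z c r (Z c' r' w) = Z c' r' (Z c r w) }.

Hypothesis TR : twisted_relations.
Variable M : subspace U.
(** Irreducibility as an induction principle. Stability of [K] is tested at vectors of [M] only,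
    because the relations freed from their central terms are available only there. *)
Hypothesis M_AY : forall K : subspace U,
  (forall u r w, lattice r -> K w -> M w -> K (A u r w)) ->
  (forall X k w, G k X -> K w -> M w -> K (Y X k w)) ->
  (exists2 w, M w /\ K w & w != 0) -> forall w, M w -> K w.
Hypothesis M_A : forall u r w, lattice r -> M w -> M (A u r w).
Hypothesis M_Y : forall X k w, G k X -> M w -> M (Y X k w).
Hypothesis M_fd : finite_dim M.
Hypothesis M_neq0 : exists2 w, M w & w != 0.

(** [M] is a module for the [A] and the [Y]; that a given [Z c r] maps it to itself has to be known
    separately. *)
Definition preserving c r := lattice r /\ forall w, M w -> M (Z c r w).

(* Z c r is an eigenvector of ad A(e_i, -r) with eigenvalue -r_i, since Z c 0 = 0. *)
Lemma Z_trivial c r w : preserving c r -> M w -> Z c r w = 0.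
Proof.
move=> pZ Mw; have := pZ.
pose KZ v := forall c r, preserving c r -> Z c r v = 0.
have KZc : KZ 0 /\ forall (a : C) u v, KZ u -> KZ v -> KZ (a *: u + v).
  split=> [c' r' [lr' _]|a u v Ku Kv c' r' pz]; first exact: (linear_op0 (tr_linZ TR _ lr')).
  by have [lr' _] := pz; rewrite (tr_linZ TR _ lr') Ku // Kv // scaler0 addr0.
move: c r {pZ}; apply: (M_AY (K := Subspace KZc)) w Mw => [u s w ls Kw Mw|X k w GX Kw Mw|] /=.
(* By [tr_AZ], the commutator of [A u s] with [Z c r], plus a multiple of [Z c r], is a single
   [Z c' (r + s)]. It again preserves [M], so it kills [w], and this makes the common kernel
   stable. *)
- move=> c r [lr Mz]; pose c' := dot u (cvec R r) *: c + dot u c *: cvec R s.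
  have lrs : lattice (r + s) by exact: latticeD.
  have cE v : Z c' (r + s) v =
      A u s (Z c r v) - Z c r (A u s v) + dot u (cvec R r) *: Z c r v.
    rewrite (tr_AZ TR) // scalerBr addrAC subrK.
    by rewrite /c' (tr_Z TR _ lrs) (linear_opZ (tr_Z TR _ lrs)).
  have : Z c' (r + s) w = 0.
    apply: Kw; split=> // v Mv; rewrite cE; apply: ssD; last by apply: ssZ; exact: Mz.
    by apply: ssB; [apply: M_A => //; exact: Mz|apply: Mz; exact: M_A].
  rewrite cE Kw // scaler0 addr0 (linear_op0 (tr_linA TR u ls)) sub0r => /eqP.
  by rewrite oppr_eq0 => /eqP.
- move=> c r [lr Mz]; rewrite -(tr_YZ TR) // Kw //; exact: (linear_op0 (tr_linY TR GX)).
have [d [vec [vl vi vP]]] := nonzero_model M_fd M_neq0.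
pose Zs (X : 'M[C]_d.+1) := exists c r, preserving c r /\ forall x, Z c r (vec x) = vec (X *m x).
have mE (X X' : 'M[C]_d.+1) : (forall x, vec (X *m x) = vec (X' *m x)) -> X = X'.
  move=> e; apply/matrixP => i j.
  by have /vi/colP/(_ i) := e (delta_mx j 0); rewrite -!colE !mxE.
have [|z [c [r [[lr Mz] zE]]]|w [w0 Zw]] := @common_kernel _ d Zs.
- move=> z z' [c [r [[lr _] zE]]] [c' [r' [[lr' _] zE']]]; apply: mE => x.
  by rewrite -!mulmxA -zE -!zE' -zE (tr_ZZ TR).
- have [r0|] := pselect (r = 0).
    exists 1%N; apply: mE => x; rewrite expr1 -zE r0 (tr_Z0 TR).
    by rewrite mul0mx (linear_op0 vl).
  move=> /eqP/rV0Pn[i ri].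
  have lNr := latticeN lr; pose u : Cn := delta_mx 0 i.
  have [E EE] := op_matrix vl vP (tr_linA TR u lNr) (fun w => @M_A u (- r) w lNr).
  have dE : dot u (cvec R r) = (r 0 i)%:~R.
    rewrite /dot (bigD1 i) //= big1 => [|j /negPf ji]; last by rewrite !mxE ji andbF mul0r.
    by rewrite !mxE !eqxx mul1r addr0.
  have ri' : - (r 0 i)%:~R != 0 :> C by rewrite oppr_eq0 intr_eq0.
  apply: (@ad_eigen_nilpotent _ _ ((- (r 0 i)%:~R)^-1 *: E)); apply: mE => x.
  rewrite /comm_of -scalerAl -scalerAr -scalerBr -scalemxAl (linear_opZ vl) mulmxBl (linear_opB vl).
  rewrite -!mulmxE -!mulmxA -!EE -!zE -EE (tr_AZ TR) // dE subrr !(tr_Z0 TR) sub0r.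
  by rewrite scaler0 addr0 scalerN -scaleNr scalerA mulVf // scale1r.
exists (vec w); last by apply: contra w0 => /eqP; rewrite -(linear_op0 vl) => /vi->.
split; first by apply/vP; eexists.
move=> c r pz; have [lr Mz] := pz.
have [X XE] := op_matrix vl vP (tr_linZ TR c lr) Mz.
by rewrite XE Zw ?(linear_op0 vl) //; exists c, r.
Qed.

(** The coefficient stays in the statement because, for the term with the invariant form, the
    exponent is known to lie in the lattice only when the coefficient is nonzero. Dividing by it
    then shows that [Z c r] itself preserves [M]. *)
Lemma scaled_Z_trivial a c r w : (a != 0 -> lattice r) ->
  (forall v, M v -> M (a *: Z c r v)) -> M w -> a *: Z c r w = 0.
Proof.
have [->|a0] := eqVneq a 0; first by rewrite scale0r.
move=> /(_ isT) lr Ma Mw; rewrite Z_trivial ?scaler0 //; split=> // v /Ma.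
by move=> /(ssZ a^-1); rewrite scalerA mulVf // scale1r.
Qed.

(** The central term equals a commutator minus operators that all preserve [M]; hence it preserves
    [M] and vanishes there. The same argument gives [commYY]. *)
Lemma commAA u v r s w : lattice r -> lattice s -> M w ->
  A u r (A v s w) - A v s (A u r w) =
  dot u (cvec R s) *: (A v (r + s) w - A v s w)
  - dot v (cvec R r) *: (A u (r + s) w - A u r w).
Proof.
move=> lr ls Mw; have lrs := latticeD lr ls.
rewrite (tr_AA TR) // scaled_Z_trivial ?addr0 // => x Mx.
rewrite (_ : _ *: _ = A u r (A v s x) - A v s (A u r x) -
  (dot u (cvec R s) *: (A v (r + s) x - A v s x)
  - dot v (cvec R r) *: (A u (r + s) x - A u r x))); last first.
  by rewrite (tr_AA TR) // [RHS]addrC addKr.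
by do ?[apply: M_A|apply: ssB|apply: ssZ] => //.
Qed.

Lemma commYY X X' k l w : G k X -> G l X' -> M w ->
  Y X k (Y X' l w) - Y X' l (Y X k w) = Y (bra X X') (k + l) w.
Proof.
move=> GX GX' Mw; have GXX := tr_Gbra TR GX GX'.
rewrite (tr_YY TR) // scaled_Z_trivial ?addr0 // => [/(tr_gY TR) //|x Mx].
rewrite (_ : _ *: _ = Y X k (Y X' l x) - Y X' l (Y X k x) - Y (bra X X') (k + l) x).
  by do ?[apply: M_Y|apply: ssB|apply: ssZ] => //.
by rewrite (tr_YY TR) // [RHS]addrC addKr.
Qed.

(* The vectors killed by I_2 and F_1. *)
Definition jet v :=
  (forall u r r', lattice r -> lattice r' -> A u (r + r') v = A u r v + A u r' v) /\
  (forall X k r, G k X -> lattice r -> Y X (k + r) v = Y X k v).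

Lemma jet_closed : jet 0 /\ forall (a : C) u v, jet u -> jet v -> jet (a *: u + v).
Proof.
split=> [|a x y [xA xY] [yA yY]]; split.
- move=> u r r' lr lr'; have lrr := latticeD lr lr'.
  by rewrite !(linear_op0 (tr_linA TR _ _)) // addr0.
- move=> X k r GX lr; have := tr_GD TR lr GX => GX'.
  by rewrite (linear_op0 (tr_linY TR GX)) (linear_op0 (tr_linY TR GX')).
- move=> u r r' lr lr'; have lrr := latticeD lr lr'.
  by rewrite !(tr_linA TR) // xA // yA // scalerDr addrACA.
- move=> X k r GX lr; have := tr_GD TR lr GX => GX'.
  by rewrite (tr_linY TR GX) (tr_linY TR GX') xY // yY.
Qed.

(** The vectors [e i = m_i^-1 e_i] and the exponents [dilate s] turn the relations over [Gamma] into
    those of the Euler field over [Z^n]. Zero second differences then mean additivity, as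
    [A u 0 = 0], and zero first differences mean invariance under [Gamma]. *)
Lemma jet_nonzero : exists2 w, M w /\ jet w & w != 0.
Proof.
have [d [vec [vl vi vP]]] := nonzero_model M_fd M_neq0.
have mE (X X' : 'M[C]_d.+1) : (forall x, vec (X *m x) = vec (X' *m x)) -> X = X'.
  move=> e; apply/matrixP => i j.
  by have /vi/colP/(_ i) := e (delta_mx j 0); rewrite -!colE !mxE.
have ldil s : lattice (dilate s) by exists s.
pose e i : Cn := (m i)%:R^-1 *: delta_mx 0 i.
have mR i : (m i)%:R != 0 :> C by rewrite pnatr_eq0 -lt0n.
have dot_e i v : dot (e i) v = (m i)%:R^-1 * v 0 i.
  rewrite /dot (bigD1 i) //= big1 => [|j /negPf ji]; last by rewrite !mxE ji andbF mulr0 mul0r.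
  by rewrite !mxE !eqxx mulr1 addr0.
have dot_ed i s : dot (e i) (cvec R (dilate s)) = (s 0 i)%:~R.
  by rewrite dot_e !mxE intrM mulrCA mulVf ?mulr1.
have /choice[a aE] : forall p : 'I_n * Zn, exists X : 'M[C]_d.+1,
    forall x, A (e p.1) (dilate p.2) (vec x) = vec (X *m x).
  move=> p; apply: (op_matrix vl vP); first exact: tr_linA.
  by move=> w; exact: M_A.
have aE' i r x : A (e i) (dilate r) (vec x) = vec (a (i, r) *m x) by exact: (aE (i, r)).
have [|w [w0 wA wY]] := @common_killed_vector _ n d n_gt0 (fun i r => a (i, r)).
  move=> i j r s; apply: mE => x; have Mx : M (vec x) by apply/vP; eexists.
  have := commAA (e i) (e j) (ldil r) (ldil s) Mx; rewrite -dilateD !dot_ed !aE'.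
  rewrite /comm_of -!mulmxE !mulmxBl -!scalemxAl !mulmxBl.
  by rewrite !(linear_opB vl, linear_opZ vl) -!mulmxA.
exists (vec w); last by apply: contra w0 => /eqP; rewrite -(linear_op0 vl) => /vi->.
have Mw : M (vec w) by apply/vP; eexists.
split=> //; split=> [u _ _ [r ->] [r' ->]|X k _ GX [r ->]].
  have AE s : A u (dilate s) (vec w) =
      \sum_i (u 0 i * (m i)%:R) *: A (e i) (dilate s) (vec w).
    rewrite {1}[u]row_sum_delta (linear_op_sum (tr_A TR _ (ldil s))).
    apply: eq_bigr => i _; rewrite -(linear_opZ (tr_A TR _ (ldil s))).
    by rewrite /e scalerA -mulrA mulfV // mulr1.
  rewrite -dilateD !AE -big_split; apply: eq_bigr => i _ /=.
  rewrite !aE' -scalerDr -(linear_opD vl); congr (_ *: vec _).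
  apply: (diff2_additive (f := fun s => a (i, s) *m w)).
    by apply: vi; rewrite -aE' dilate0 (tr_A0 TR) (linear_op0 vl).
  by move=> p q s; rewrite /diff -!mulmxBl; exact: (wA i p q s).
have GXs s : G (k + dilate s) X by exact: tr_GD.
have /choice[y yE] : forall s, exists B : 'M[C]_d.+1,
    forall x, Y X (k + dilate s) (vec x) = vec (B *m x).
  move=> s; apply: (op_matrix vl vP); first exact: (tr_linY TR).
  by move=> v; exact: M_Y.
(* In the rescaled lattice the base degree [k] becomes fractional, which is what the shift [kap]
   allows for. *)
have yM : module_family (fun i r => a (i, r)) (\row_i ((k 0 i)%:~R / (m i)%:R)) y.
  move=> i s t; apply: mE => x.
  have := tr_AY TR (e i) (vec x) (ldil s) (GXs t); rewrite -addrA -dilateD.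
  rewrite (_ : dot _ _ = (k 0 i)%:~R / (m i)%:R + (t 0 i)%:~R); last first.
    by rewrite cvecD dotDr dot_ed dot_e !mxE mulrC.
  rewrite !aE' !yE !aE' mxE /comm_of -!mulmxE mulmxBl -scalemxAl mulmxBl.
  by rewrite !(linear_opB vl, linear_opZ vl) -!mulmxA.
rewrite yE -[k in RHS]addr0 -dilate0 yE; congr vec; rewrite -[r]add0r.
apply: (diff0_const (f := fun s => y s *m w)) => p s.
by rewrite /diff -mulmxBl; exact: (wY _ _ yM).
Qed.

(** By irreducibility it is enough that the jets are stable. On a jet the differences in the
    commutation relations simplify: commuting past [A v' s] or [Y X' l] leaves terms that are again
    additive in [r] or invariant under [Gamma]. *)
Lemma jet_all v : M v -> jet v.
Proof.
move: v; refine (@M_AY (Subspace jet_closed) _ _ jet_nonzero) => /= [v' s w ls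
  [wA wY] Mw|X' l w GX' [wA wY] Mw].
  have key u r : lattice r -> A u r (A v' s w) =
      A v' s (A u r w) + (dot u (cvec R s) *: A v' r w - dot v' (cvec R r) *: A u s w).
    move=> lr; have := commAA u v' lr ls Mw; rewrite !wA // [A u r w + _]addrC !addrK.
    by move=> <-; rewrite addrC subrK.
  split=> [u r r' lr lr'|X k r GX lr].
    have lrr := latticeD lr lr'.
    rewrite !key // !wA // cvecD dotDr scalerDl !scalerDr (linear_opD (tr_linA TR _ ls)).
    rewrite [RHS]addrACA; congr (_ + _); rewrite opprD; exact: addrACA.
  have GXr := tr_GD TR lr GX.
  have keyY t : G t X -> Y X t (A v' s w) = A v' s (Y X t w).
    move=> Gt; have := tr_AY TR v' w ls Gt; rewrite wY // subrr scaler0 => /eqP.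
    by rewrite subr_eq0 => /eqP.
  by rewrite !keyY // wY.
split=> [u r r' lr lr'|X k r GX lr].
  have key t : lattice t -> A u t (Y X' l w) = Y X' l (A u t w).
    move=> lt; have := tr_AY TR u w lt GX'; rewrite wY // subrr scaler0 => /eqP.
    by rewrite subr_eq0 => /eqP.
  by rewrite !key ?wA //; [exact: (linear_opD (tr_linY TR GX'))|exact: latticeD].
have GXr := tr_GD TR lr GX.
have key t : G t X -> Y X t (Y X' l w) = Y X' l (Y X t w) + Y (bra X X') (t + l) w.
  by move=> Gt; rewrite -commYY // addrC subrK.
rewrite !key // wY // addrAC; congr (_ + _); apply: wY => //.
exact: (tr_Gbra TR).
Qed.

End TwistedJets.

(** * Subquotients and weight decompositions *)

Section Subquotients.
Variables (F : fieldType) (V : lmodType F) (S R : subspace V).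
Local Open Scope quotient_scope.

Lemma insubd_ss u : S u -> val (insubd (0 : sub_of S) u) = u.
Proof. by move=> Su; rewrite insubdK //; exact/asboolP. Qed.

Lemma sq_pi_linear c u v : S u -> S v ->
  sq_pi S R (c *: u + v) = c *: sq_pi S R u + sq_pi S R v.
Proof.
move=> Su Sv; rewrite /sq_pi.
have -> : insubd (0 : sub_of S) (c *: u + v) = c *: insubd 0 u + insubd 0 v.
  apply: val_inj; rewrite linearP insubd_ss; last exact: ssP.
  by congr (_ *: _ + _); rewrite -[LHS]insubd_ss.
by rewrite subquo_piD; congr (_ + _); symmetry; exact: subquo_scale_pi.
Qed.

Lemma sq_repr_in (x : subquo S R) : S (sq_repr x).
Proof. by have /asboolP := valP (repr x). Qed.

Lemma sq_reprK (x : subquo S R) : sq_pi S R (sq_repr x) = x.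
Proof. by rewrite /sq_pi /sq_repr valKd reprK. Qed.

Lemma sq_pi0 : sq_pi S R 0 = 0.
Proof.
have := sq_pi_linear 1 (ss0 S) (ss0 S); rewrite !scale1r addr0 => /eqP.
by rewrite -[X in X == _]addr0 (inj_eq (addrI _)) eq_sym => /eqP.
Qed.

Lemma sq_piD u v : S u -> S v -> sq_pi S R (u + v) = sq_pi S R u + sq_pi S R v.
Proof. by move=> Su Sv; rewrite -[u]scale1r sq_pi_linear // !scale1r. Qed.

Lemma sq_piZ c u : S u -> sq_pi S R (c *: u) = c *: sq_pi S R u.
Proof. by move=> Su; rewrite -[c *: u]addr0 sq_pi_linear ?sq_pi0 ?addr0 //; exact: ss0. Qed.

Lemma sq_piB u v : S u -> S v -> sq_pi S R (u - v) = sq_pi S R u - sq_pi S R v.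
Proof.
move=> Su Sv; rewrite sq_piD //; last by rewrite -scaleN1r; exact: ssZ.
by rewrite -scaleN1r sq_piZ // scaleN1r.
Qed.

Lemma sq_pi_sum (I : Type) (s : seq I) (P : pred I) (E : I -> V) :
  (forall i, P i -> S (E i)) ->
  sq_pi S R (\sum_(i <- s | P i) E i) = \sum_(i <- s | P i) sq_pi S R (E i).
Proof.
move=> SE; pose K v w := S v /\ sq_pi S R v = w.
suff [] : K (\sum_(i <- s | P i) E i) (\sum_(i <- s | P i) sq_pi S R (E i)) by [].
apply: (big_rec2 K) => [|i v w Pi [Sw <-]]; first by split; [exact: ss0|exact: sq_pi0].
have SEi := SE i Pi.
by split; [exact: ssD|exact: sq_piD].
Qed.

Lemma sq_pi_eq0 v : S v -> (sq_pi S R v = 0 <-> R v).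
Proof.
move=> Sv; have S0 := ss0 S.
have : (val (insubd (0 : sub_of S) v - insubd 0 0) \in in_ss R) =
    (sq_pi S R v == sq_pi S R 0).
  exact: (Quotient.idealrBE (rel_in S R)).
have -> : val (insubd (0 : sub_of S) v - insubd 0 0) = v.
  by rewrite raddfB -[RHS]subr0; congr (_ - _); exact: insubd_ss.
rewrite sq_pi0 => e; split=> [/eqP|Rv]; first by rewrite -e => /asboolP.
by apply/eqP; rewrite -e; exact/asboolP.
Qed.

Lemma sq_pi_eq u v : S u -> S v -> R (u - v) -> sq_pi S R u = sq_pi S R v.
Proof.
move=> Su Sv Ruv; apply/eqP; rewrite -subr_eq0 -sq_piB //; apply/eqP.
by apply/sq_pi_eq0 => //; exact: ssB.
Qed.

Lemma sq_repr_pi v : S v -> R (sq_repr (sq_pi S R v) - v).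
Proof.
move=> Sv; apply/sq_pi_eq0; first by apply: ssB => //; exact: sq_repr_in.
by rewrite sq_piB ?sq_reprK ?subrr //; exact: sq_repr_in.
Qed.

End Subquotients.

Section JointEigenvectors.
Variables (F : fieldType) (V : lmodType F) (H : Type) (W : eqType).
Variables (f : H -> V -> V) (chi : W -> H -> F) (S : subspace V).
Hypothesis f_lin : forall h, linear_op (f h).
Hypothesis f_S : forall h v, S v -> S (f h v).

(** [f h - chi w0 h] removes the term at [w0] and multiplies each other term by a scalar, nonzero
    for a suitable [h]. With [S] zero this is linear independence; in general, a stable subspace
    contains the components of its elements. *)
Lemma joint_eigenvectors (s : seq W) (E : W -> V) : uniq s ->
  (forall w w', w \in s -> w' \in s -> w != w' -> exists h, chi w h <> chi w' h) ->
  (forall w h, w \in s -> f h (E w) = chi w h *: E w) ->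
  S (\sum_(w <- s) E w) -> forall w, w \in s -> S (E w).
Proof.
elim: s E => [|w0 s IHs] E //= /andP[w0s us] sep eig Ssum.
have SE w : w \in s -> S (E w).
  move=> ws; have [|||h /eqP hne] := sep w0 w.
  - by rewrite mem_head.
  - by rewrite in_cons ws orbT.
  - by apply: contraNneq w0s => ->.
  rewrite eq_sym -subr_eq0 in hne.
  rewrite -[E w](scalerK hne); apply: ssZ; move: w ws hne.
  have IH := IHs (fun w => (chi w h - chi w0 h) *: E w) us; move=> w ws _.
  apply: IH => //.
  - by move=> w1 w2 w1s w2s; apply: sep; rewrite in_cons ?w1s ?w2s orbT.
  - move=> w1 h1 w1s; rewrite (linear_opZ (f_lin h1)) eig ?in_cons ?w1s ?orbT //.
    by rewrite !scalerA mulrC.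
  have : S (f h (\sum_(w <- w0 :: s) E w) - chi w0 h *: \sum_(w <- w0 :: s) E w).
    by apply: ssB; [exact: f_S|exact: ssZ].
  rewrite (linear_op_sum (f_lin h)) scaler_sumr -sumrB big_cons.
  rewrite eig ?mem_head // subrr add0r.
  rewrite [X in S X -> _](_ : _ = \sum_(w <- s) (chi w h - chi w0 h) *: E w) //.
  rewrite big_seq [RHS]big_seq; apply: eq_bigr => w1 w1s.
  by rewrite eig ?in_cons ?w1s ?orbT // scalerBl.
move=> w; rewrite in_cons => /orP[/eqP->|]; last exact: SE.
have -> : E w0 = \sum_(w <- w0 :: s) E w - \sum_(w <- s) E w by rewrite big_cons addrK.
by apply: ssB => //; exact: ss_sum_seq.
Qed.

End JointEigenvectors.

Lemma sum_by_key (W I : eqType) (V : zmodType) (s : seq I) (key : I -> W) (E : I -> V) :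
  \sum_(i <- s) E i = \sum_(w <- undup (map key s)) \sum_(i <- s | key i == w) E i.
Proof.
rewrite (exchange_big_dep xpredT) //= big_seq [RHS]big_seq; apply: eq_bigr => i si.
rewrite (eq_bigl (fun w => w == key i)); last by move=> w; rewrite eq_sym.
rewrite -big_filter (_ : [seq w <- _ | w == key i] = [:: key i]) ?big_seq1 //.
rewrite (@filter_pred1_uniq _ _ (key i)) ?undup_uniq // mem_undup.
exact: map_f.
Qed.

Section SingleAt.
Variables (K : eqType) (F : fieldType) (E : lmodType F).

Lemma single_at_linear (k : K) : linear_op (single_at k : E -> (K -> E)).
Proof.
move=> c x y; apply: funext => l; rewrite /single_at.
by rewrite !fctE; case: eqP => _; rewrite ?scaler0 ?addr0.
Qed.

Lemma single_at0 (k : K) : single_at k (0 : E) = 0.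
Proof. exact: (linear_op0 (@single_at_linear k)). Qed.

End SingleAt.

(** Elements of [tau_hat] and of [Lt] are typed as arbitrary functions; sums over the whole lattice
    are meaningful, and additive, only on finite supports. *)
Definition finitely_supported (K : choiceType) (E : zmodType) (f : K -> E) :=
  exists A : {fset K}, forall k, k \notin A -> f k = 0.

Lemma finitely_supported_single (K : choiceType) (E : zmodType) (k : K) (x : E) :
  finitely_supported (single_at k x).
Proof. by exists [fset k]%fset => l; rewrite inE /single_at => /negPf->. Qed.

Lemma finitely_supported_linear (K : choiceType) (F : fieldType) (E : lmodType F)
    (c : F) (f g : K -> E) : finitely_supported f -> finitely_supported g ->
  finitely_supported (c *: f + g).
Proof.
move=> [A fA] [B gB]; exists (A `|` B)%fset => k; rewrite inE negb_or => /andP[kA kB].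
by rewrite !fctE fA // gB // scaler0 addr0.
Qed.

Lemma finitely_supported_lspan (K : choiceType) (F : fieldType) (E : lmodType F)
    (A : set (K -> E)) : (forall f, A f -> finitely_supported f) ->
  forall f, lspan A f -> finitely_supported f.
Proof.
move=> Afs; have S0 : finitely_supported (0 : K -> E) /\ forall (c : F) (f g : K -> E),
    finitely_supported f -> finitely_supported g -> finitely_supported (c *: f + g).
  split; last by move=> c f g; exact: finitely_supported_linear.
  by exists fset0.
exact: (lspan_sub (S := Subspace S0)).
Qed.

(** * The bracket of the toroidal algebra *)

Section FibreBracket.
Variables (R : realType) (n : nat) (D : datum R n) (HD : standing_assumptions D).
Local Notation C := R[i].
Local Notation g := (gg D).
Local Notation br := (@brk _ _ D).
Local Notation Zn1 := 'rV[int]_n.+1.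
Local Notation form := (@gform _ _ D).

Lemma brk_linl c (x y z : g) : br (c *: x + y) z = c *: br x z + br y z.
Proof. by case: (sa_lie HD) => h _ _ _; exact: h. Qed.

Lemma brk_linr c (x y z : g) : br z (c *: x + y) = c *: br z x + br z y.
Proof. by case: (sa_lie HD) => _ h _ _; exact: h. Qed.

Lemma brk0l (x : g) : br 0 x = 0.
Proof. by have := brk_linl (-1) 0 0 x; rewrite scaler0 addr0 scaleN1r addNr. Qed.

Lemma brk0r (x : g) : br x 0 = 0.
Proof. by have := brk_linr (-1) 0 0 x; rewrite scaler0 addr0 scaleN1r addNr. Qed.

Lemma brkC (x y : g) : br x y = - br y x.
Proof.
case: (sa_lie HD) => _ _ alt _; have := alt (x + y).
have -> : x + y = 1 *: x + y by rewrite scale1r.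
rewrite brk_linl !brk_linr !alt !scale1r add0r addr0 => /eqP.
by rewrite addr_eq0 => /eqP.
Qed.

Lemma gform_linl c (x y z : g) : form (c *: x + y) z = c * form x z + form y z.
Proof. by case: (sa_form HD) => h _ _ _; exact: h. Qed.

Lemma gformC (x y : g) : form x y = form y x.
Proof. by case: (sa_form HD) => _ h _ _; exact: h. Qed.

Lemma gform_linr c (x y z : g) : form z (c *: x + y) = c * form z x + form z y.
Proof. by rewrite gformC gform_linl ![form z _]gformC. Qed.

Lemma gform0l (x : g) : form 0 x = 0.
Proof. by have := gform_linl (-1) 0 0 x; rewrite scaler0 addr0 mulN1r addNr. Qed.

Lemma gform0r (x : g) : form x 0 = 0.
Proof. by rewrite gformC gform0l. Qed.

Lemma fibre_bracket_linl k l c (x x' y : fibre D) :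
  fibre_bracket k l (c *: x + x') y = c *: fibre_bracket k l x y + fibre_bracket k l x' y.
Proof.
case: x x' y => [[X w] u] [[X' w'] u'] [[Y z] v] /=; congr (_, _, _).
- rewrite brk_linl dot_linl scalerDl -scalerA scalerDr (scalerA _ c) (mulrC _ c) -scalerA.
  by rewrite /= opprD [(_ + br X' Y) + _]addrACA [LHS]addrACA -scalerDr -scalerBr.
- by apply/rowP => i; rewrite !mxE !dot_linl !dot_linr gform_linl; case: ifP => _; ring.
- by apply/rowP => i; rewrite !mxE !dot_linl; ring.
Qed.

Lemma fibre_bracket_linr k l c (x x' y : fibre D) :
  fibre_bracket k l y (c *: x + x') = c *: fibre_bracket k l y x + fibre_bracket k l y x'.
Proof.
case: x x' y => [[X w] u] [[X' w'] u'] [[Y z] v] /=; congr (_, _, _).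
- rewrite brk_linr dot_linl scalerDl -scalerA scalerDr (scalerA _ c) (mulrC _ c) -scalerA.
  by rewrite /= opprD [(_ + br Y X') + _]addrACA [LHS]addrACA -scalerDr -scalerBr.
- by apply/rowP => i; rewrite !mxE !dot_linl !dot_linr gform_linr; case: ifP => _; ring.
- by apply/rowP => i; rewrite !mxE !dot_linl; ring.
Qed.

End FibreBracket.

Section TauBracket.
Variables (R : realType) (n : nat) (D : datum R n) (HD : standing_assumptions D).
Local Notation C := R[i].
Local Notation g := (gg D).
Local Notation br := (@brk _ _ D).
Local Notation Zn1 := 'rV[int]_n.+1.
Local Notation form := (@gform _ _ D).

Lemma fibre_bracket0l k l (y : fibre D) : fibre_bracket k l 0 y = 0.
Proof. exact: (linear_op0 (fun c x x' => fibre_bracket_linl HD k l c x x' y)). Qed.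

Lemma fibre_bracket0r k l (y : fibre D) : fibre_bracket k l y 0 = 0.
Proof. exact: (linear_op0 (fun c x x' => fibre_bracket_linr HD k l c x x' y)). Qed.

Lemma fun_bracketE (A : {fset Zn1}) (x y : tau_fun D) :
  (forall k, k \notin A -> x k = 0) -> fun_bracket x y =
  fun m => \sum_(k <- A) fibre_bracket k (m - k) (x k) (y (m - k)).
Proof.
move=> xA; apply: funext => m; rewrite /fun_bracket (fsbigTE A) // => k kA.
by rewrite xA // fibre_bracket0l.
Qed.

Lemma fun_bracket_linr (x : tau_fun D) : finitely_supported x -> linear_op (fun_bracket x).
Proof.
move=> [A xA] c y z; rewrite !(fun_bracketE _ xA); apply: funext => m.
rewrite !fctE /= scaler_sumr -big_split; apply: eq_bigr => k _.
exact: fibre_bracket_linr.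
Qed.

Lemma fun_bracket_linl c (x x' y : tau_fun D) :
  finitely_supported x -> finitely_supported x' ->
  fun_bracket (c *: x + x') y = c *: fun_bracket x y + fun_bracket x' y.
Proof.
move=> [A xA] [B xB].
have xAB k : k \notin (A `|` B)%fset -> x k = 0.
  by rewrite inE negb_or => /andP[/xA].
have xBA k : k \notin (A `|` B)%fset -> x' k = 0.
  by rewrite inE negb_or => /andP[_ /xB].
rewrite (fun_bracketE _ xAB) (fun_bracketE _ xBA) (fun_bracketE (A := (A `|` B)%fset)).
  apply: funext => m; rewrite !fctE /= scaler_sumr -big_split; apply: eq_bigr => k _.
  exact: fibre_bracket_linl.
by move=> k kAB; rewrite !fctE xAB // xBA // scaler0 addr0.
Qed.

Lemma fun_bracket_single k l (x y : fibre D) :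
  fun_bracket (single_at k x) (single_at l y) = single_at (k + l) (fibre_bracket k l x y).
Proof.
rewrite (fun_bracketE (A := [fset k]%fset)); last first.
  by move=> k'; rewrite inE /single_at => /negPf->.
apply: funext => m; rewrite big_seq_fset1 /single_at eqxx subr_eq [l + k]addrC.
case: eqP => [->|_]; last exact: fibre_bracket0r.
by rewrite [k + l]addrC addrK.
Qed.

Lemma fun_bracket_lspan (A B : set (tau_fun D)) (S : subspace (tau_fun D)) :
  (forall f, A f -> finitely_supported f) ->
  (forall x y, A x -> B y -> S (fun_bracket x y)) ->
  forall x y, lspan A x -> lspan B y -> S (fun_bracket x y).
Proof.
move=> Afs AB.
have Sx x : A x -> forall y, lspan B y -> S (fun_bracket x y).
  move=> Ax; have xl := fun_bracket_linr (Afs _ Ax).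
  have Pc : S (fun_bracket x 0) /\ forall (c : C) (u v : tau_fun D),
      S (fun_bracket x u) -> S (fun_bracket x v) -> S (fun_bracket x (c *: u + v)).
    by split=> [|c u v Su Sv]; rewrite ?(linear_op0 xl) ?xl; [exact: ss0|exact: ssP].
  by apply: (lspan_sub (S := Subspace Pc)) => y By; exact: AB.
(* Linearity in the left argument requires finite supports, so this property is carried through the
   span together with the conclusion. *)
have Qc : (finitely_supported (0 : tau_fun D) /\
      forall y, lspan B y -> S (fun_bracket 0 y)) /\
    forall (c : C) (u v : tau_fun D),
    (finitely_supported u /\ forall y, lspan B y -> S (fun_bracket u y)) ->
    (finitely_supported v /\ forall y, lspan B y -> S (fun_bracket v y)) ->
    (finitely_supported (c *: u + v) /\
      forall y, lspan B y -> S (fun_bracket (c *: u + v) y)).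
  split=> [|c u v [fu Su] [fv Sv]].
    split=> [|y _]; first by exists fset0.
    rewrite (fun_bracketE (A := fset0)) // (_ : (fun _ => _) = 0); first exact: ss0.
    by apply: funext => m; rewrite big_seq_fset0.
  split=> [|y By]; first exact: finitely_supported_linear.
  by rewrite fun_bracket_linl //; apply: ssP; [exact: Su|exact: Sv].
move=> x y Ax; have [] // := @lspan_sub _ _ A (Subspace Qc) _ x Ax.
  by move=> f Af; split; [exact: Afs|exact: Sx].
by move=> _; apply.
Qed.

Lemma in_GammaP (r : Zn1) : reflect (forall i, ((sord D i)%:Z %| (r 0 i)%R)%Z) (in_Gamma D r).
Proof. exact: forallP. Qed.

Lemma in_Gamma0 : in_Gamma D 0.
Proof. by apply/in_GammaP => i; rewrite mxE dvdz0. Qed.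

Lemma in_GammaD r s : in_Gamma D r -> in_Gamma D s -> in_Gamma D (r + s).
Proof.
by move=> /in_GammaP hr /in_GammaP hs; apply/in_GammaP => i; rewrite mxE rpredD.
Qed.

Lemma gdegP (k : Zn1) (X : g) :
  X \in gdeg D k <-> forall i, sigma D i X = xi D i ^ (k 0 i) *: X.
Proof.
have eigP i a : (X \in passmx.leigenspace (sigma D i) a) = (sigma D i X == a *: X).
  by rewrite memv_ker add_lfunE opp_lfunE scale_lfunE id_lfunE subr_eq0.
rewrite memvE; split=> [/subv_bigcapP h i|h].
  by apply/eqP; rewrite -eigP memvE; exact: h.
by apply/subv_bigcapP => i _; rewrite -memvE eigP h.
Qed.

Lemma xi_neq0 i : xi D i != 0.
Proof.
apply/eqP => x0; have := prim_expr_order (sa_xi HD i); rewrite x0 expr0n.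
by rewrite eqn0Ngt (sa_ord_gt0 HD i) /= => /eqP; rewrite eq_sym oner_eq0.
Qed.

Lemma xi_Gamma i (r : int) : ((sord D i)%:Z %| r)%Z -> xi D i ^ r = 1.
Proof.
case/dvdzP => q ->.
by rewrite mulrC -exprz_exp -exprnP (prim_expr_order (sa_xi HD i)) exp1rz.
Qed.

Lemma gdegD k r (X : g) : in_Gamma D r -> X \in gdeg D k -> X \in gdeg D (k + r).
Proof.
move=> /in_GammaP hr /gdegP hX; apply/gdegP => i.
by rewrite mxE expfzDr ?xi_neq0 // (xi_Gamma (hr i)) mulr1 hX.
Qed.

Lemma gdeg_br k l (X X' : g) :
  X \in gdeg D k -> X' \in gdeg D l -> br X X' \in gdeg D (k + l).
Proof.
move=> /gdegP hX /gdegP hX'; apply/gdegP => i.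
rewrite (sa_aut HD) hX hX' mxE expfzDr ?xi_neq0 // -[X in br X _]addr0 brk_linl // brk0l // addr0.
by rewrite -[X in br _ X]addr0 brk_linr // brk0r // addr0 scalerA.
Qed.

(** The degree [k] part of [tau_hat], as a condition on a single value. *)
Definition hat_fibre k (x : fibre D) : Prop :=
  x.1.1 \in gdeg D k /\ (in_Gamma D k \/ x.1.2 = 0 /\ x.2 = 0).

Lemma hat_fibre_linear k c x y : hat_fibre k x -> hat_fibre k y -> hat_fibre k (c *: x + y).
Proof.
move=> [xg hx] [yg hy]; split; first by apply: rpredD => //; exact: rpredZ.
case: hx => [|[x1 x2]]; first by left.
case: hy => [|[y1 y2]]; first by left.
by right; rewrite /= x1 x2 y1 y2 !scaler0 !addr0.
Qed.

Lemma fibre_K_linear : linear_op (fun w : 'rV[C]_n.+1 => (0, w, 0) : fibre D).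
Proof. by move=> c x y; congr (_, _, _); rewrite /= ?scaler0 ?addr0. Qed.

Lemma fibre_d_linear : linear_op (fun u : 'rV[C]_n.+1 => (0, 0, u) : fibre D).
Proof. by move=> c x y; congr (_, _, _); rewrite /= ?scaler0 ?addr0. Qed.

Lemma fibre_split (X : g) (w u : 'rV[C]_n.+1) :
  (X, w, u) = (X, 0, 0) + (0, w, 0) + (0, 0, u) :> fibre D.
Proof. by congr (_, _, _); rewrite /= ?addr0 ?add0r. Qed.

Lemma fibreE (x : fibre D) : x = (x.1.1, 0, 0) + \sum_i x.1.2 0 i *: (0, delta_mx 0 i, 0)
  + \sum_i x.2 0 i *: (0, 0, delta_mx 0 i) :> fibre D.
Proof.
case: x => [[X w] u] /=; rewrite [LHS]fibre_split; congr (_ + _ + _).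
  rewrite {1}[w]row_sum_delta (linear_op_sum fibre_K_linear).
  by apply: eq_bigr => i _; rewrite (linear_opZ fibre_K_linear).
rewrite {1}[u]row_sum_delta (linear_op_sum fibre_d_linear).
by apply: eq_bigr => i _; rewrite (linear_opZ fibre_d_linear).
Qed.

Lemma tau_hat_single k (x : fibre D) : hat_fibre k x -> tau_hat D (single_at k x).
Proof.
move=> [xg hx]; have sl := @single_at_linear _ _ (fibre D) k.
rewrite [x]fibreE !(linear_opD sl) !(linear_op_sum sl).
apply: ssD; first apply: ssD.
- by apply: sub_lspan; left; exists k, x.1.1.
- apply: ss_sum => i _; case: hx => [kG|[-> _]]; last first.
    by rewrite mxE scale0r (linear_op0 sl); exact: ss0.
  rewrite (linear_opZ sl); apply: ssZ; apply: sub_lspan; right; exists k, i.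
  by split=> //; left.
- apply: ss_sum => i _; case: hx => [kG|[_ ->]]; last first.
    by rewrite mxE scale0r (linear_op0 sl); exact: ss0.
  rewrite (linear_opZ sl); apply: ssZ; apply: sub_lspan; right; exists k, i.
  by split=> //; right.
Qed.

Lemma K_relations_single r a : in_Gamma D r ->
  K_relations D (single_at r ((0, a *: cvec R r, 0) : fibre D)).
Proof.
move=> rG; have -> : (0, a *: cvec R r, 0) = a *: (0, cvec R r, 0) :> fibre D.
  by congr (_, _, _); rewrite /= scaler0.
rewrite (linear_opZ (@single_at_linear _ _ (fibre D) r)); apply: ssZ.
by apply: sub_lspan; exists r.
Qed.

Lemma sub_tau_hat f : K_relations D f -> tau_hat D f.
Proof.
apply: lspan_sub => _ [r [rG ->]]; apply: tau_hat_single; split=> /=; last by left.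
exact: rpred0.
Qed.

Lemma gen_finitely_supported (f : tau_fun D) :
  ((exists k X, X \in gdeg D k /\ f = single_at k ((X, 0, 0) : fibre D)) \/
  (exists r i, in_Gamma D r /\ (f = single_at r ((0, delta_mx 0 i, 0) : fibre D) \/
                             f = single_at r ((0, 0, delta_mx 0 i) : fibre D)))) ->
  finitely_supported f.
Proof.
by move=> [[k [X [_ ->]]]|[r [i [_ [->|->]]]]]; exact: finitely_supported_single.
Qed.

Lemma tau_hat_finitely_supported f : tau_hat D f -> finitely_supported f.
Proof. by apply: finitely_supported_lspan => f' /gen_finitely_supported. Qed.

Lemma K_relations_finitely_supported f : K_relations D f -> finitely_supported f.
Proof. by move=> /sub_tau_hat; exact: tau_hat_finitely_supported. Qed.

(** Only the derivation part [u] in degree [k] acts on the relation of degree [l], and the result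
    [dot u l *: (l + k)] in degree [k + l] is again a multiple of a relation. *)
Lemma K_relations_ideal_r f z : tau_hat D f -> K_relations D z -> K_relations D (fun_bracket f z).
Proof.
apply: fun_bracket_lspan => [f' /gen_finitely_supported//|x y].
have key k l X w u : in_Gamma D l -> hat_fibre k (X, w, u) ->
    K_relations D (fun_bracket (single_at k ((X, w, u) : fibre D))
                               (single_at l ((0, cvec R l, 0) : fibre D))).
  move=> lG [_ hwu]; rewrite fun_bracket_single /= brk0r // gform0r // if_same.
  rewrite !dot0l scaler0 !scale0r !mulr0 ?mul0r !addr0 scale0r addr0 !subr0 add0r -scalerDr.
  rewrite addrC -cvecD ?scaler0.
  case: hwu => [kG|[_ /= ->]]; first by apply: K_relations_single; exact: in_GammaD.
  by rewrite dot0l scale0r single_at0; exact: (ss0 (K_relations D)).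
move=> hx [l [lG ->]]; case: hx => [[k' [X [Xk ->]]]|[r [i [rG [->|->]]]]]; apply: key => //.
- by split=> //; right.
- by split=> /=; [exact: rpred0|left].
- by split=> /=; [exact: rpred0|left].
Qed.

Lemma K_relations_ideal_l f z : tau_hat D f -> K_relations D z -> K_relations D (fun_bracket z f).
Proof.
move=> hf hz; move: z f hz hf; apply: fun_bracket_lspan => [_ [r [_ ->]]|x y].
  exact: finitely_supported_single.
have key k l X w u : in_Gamma D l -> hat_fibre k (X, w, u) ->
    K_relations D (fun_bracket (single_at l ((0, cvec R l, 0) : fibre D))
       (single_at k ((X, w, u) : fibre D))).
  move=> lG [_ hwu]; rewrite fun_bracket_single /= brk0l // gform0l // if_same.
  rewrite !dot0l scaler0 !scale0r !mulr0 ?mul0r !addr0 scale0r ?addr0 ?subr0 !add0r.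
  rewrite -scalerDr -cvecD -scaleNr ?scaler0 ?subr0 ?oppr0.
  case: hwu => [kG|[_ /= ->]]; first by apply: K_relations_single; exact: in_GammaD.
  by rewrite dot0l oppr0 scale0r single_at0; exact: (ss0 (K_relations D)).
move=> [l [lG ->]] hx; case: hx => [[k' [X [Xk ->]]]|[r [i [rG [->|->]]]]]; apply: key => //.
- by split=> //; right.
- by split=> /=; [exact: rpred0|left].
- by split=> /=; [exact: rpred0|left].
Qed.

Lemma hat_fibre_bracket k l x y : hat_fibre k x -> hat_fibre l y ->
  hat_fibre (k + l) (fibre_bracket k l x y).
Proof.
case: x y => [[X w] u] [[Y z] v] [/= Xk hx] [/= Yl hy].
have h1 : dot u (cvec R l) *: Y \in gdeg D (k + l).
  case: hx => [kG|[_ ->]]; last by rewrite dot0l scale0r rpred0.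
  by apply: rpredZ; rewrite addrC; exact: gdegD.
have h2 : dot v (cvec R k) *: X \in gdeg D (k + l).
  case: hy => [lG|[_ ->]]; last by rewrite dot0l scale0r rpred0.
  by apply: rpredZ; exact: gdegD.
have h3 : br X Y + dot u (cvec R l) *: Y - dot v (cvec R k) *: X \in gdeg D (k + l).
  apply: rpredB; last exact: h2.
  by apply: rpredD; [exact: gdeg_br|exact: h1].
rewrite /fibre_bracket /hat_fibre; split; first exact: h3.
have [|klG] := boolP (in_Gamma D (k + l)); first by left.
have simp := (@dot0l R, @dot0r R, scale0r, scaler0, mulr0, mul0r, addr0, subr0).
right; case: hx => [kG|[-> ->]]; case: hy => [lG|[-> ->]].
- by move: klG; rewrite in_GammaD.
- by split; rewrite /= ?(negPf klG) !simp.
- by split; rewrite /= ?(negPf klG) !simp.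
- by split; rewrite /= ?(negPf klG) !simp.
Qed.

(** [tau_bracket] is computed on chosen representatives; exchanging these for the functions
    [single_at] changes the bracket by relations, which form a two-sided ideal. *)
Lemma tau_bracket_single k l (x y : fibre D) : hat_fibre k x -> hat_fibre l y ->
  tau_bracket (tau_pi (single_at k x)) (tau_pi (single_at l y)) =
  tau_pi (single_at (k + l) (fibre_bracket k l x y)).
Proof.
move=> hx hy; rewrite -fun_bracket_single /tau_bracket.
have hx' := tau_hat_single hx; have hy' := tau_hat_single hy.
set f := single_at k x in hx' *; set h := single_at l y in hy' *.
set f' := sq_repr (tau_pi f); set h' := sq_repr (tau_pi h).
have ff' : K_relations D (f' - f) by exact: sq_repr_pi.
have hh' : K_relations D (h' - h) by exact: sq_repr_pi.
have Tf' : tau_hat D f' by exact: sq_repr_in.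
have Th' : tau_hat D h' by exact: sq_repr_in.
have e : K_relations D (fun_bracket f' h' - fun_bracket f h).
  have -> : fun_bracket f' h' - fun_bracket f h =
      fun_bracket (f' - f) h' + fun_bracket f (h' - h).
    rewrite (linear_opB (fun_bracket_linr (tau_hat_finitely_supported hx'))).
    have -> : fun_bracket f' h' = fun_bracket (1 *: (f' - f) + f) h'.
      by rewrite scale1r subrK.
    rewrite fun_bracket_linl ?scale1r ?addrA //.
      exact: K_relations_finitely_supported.
    exact: finitely_supported_single.
  by apply: ssD; [exact: K_relations_ideal_l|exact: K_relations_ideal_r].
have Tfh : tau_hat D (fun_bracket f h).
  by rewrite fun_bracket_single; apply: tau_hat_single; exact: hat_fibre_bracket.
apply: sq_pi_eq => //; rewrite -(subrK (fun_bracket f h) (fun_bracket f' h')).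
by apply: ssD => //; exact: sub_tau_hat.
Qed.

End TauBracket.

Section Cons0.
Variables (R : realType) (n : nat).
Local Notation C := R[i].

Lemma cons0_0E (A : nmodType) (v : 'rV[A]_n) : cons0 v 0 ord0 = 0.
Proof. by rewrite mxE unlift_none. Qed.

Lemma cons0_liftE (A : nmodType) (v : 'rV[A]_n) j : cons0 v 0 (lift ord0 j) = v 0 j.
Proof. by rewrite mxE liftK. Qed.

Lemma cons0P (A : nmodType) (x y : 'rV[A]_n.+1) :
  x 0 ord0 = y 0 ord0 -> (forall j, x 0 (lift ord0 j) = y 0 (lift ord0 j)) -> x = y.
Proof. by move=> e0 e; apply/rowP => i; case: (unliftP ord0 i) => [j ->|->]. Qed.

Lemma cons0_linear : linear_op (@cons0 C n).
Proof.
by move=> c u v; apply: cons0P => [|j]; rewrite !mxE ?unlift_none ?liftK ?mulr0 ?addr0 ?mxE.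
Qed.

Lemma cons0D (u v : 'rV[int]_n) : cons0 (u + v) = cons0 u + cons0 v.
Proof. by apply: cons0P => [|j]; rewrite !mxE ?unlift_none ?liftK ?addr0 ?mxE. Qed.

Lemma cons00 (A : nmodType) : cons0 (0 : 'rV[A]_n) = 0.
Proof. by apply: cons0P => [|j]; rewrite !mxE ?unlift_none ?liftK ?mxE. Qed.

Lemma cvec_cons0 (r : 'rV[int]_n) : cvec R (cons0 r) = cons0 (cvec R r).
Proof. by apply: cons0P => [|j]; rewrite !mxE ?unlift_none ?liftK ?mxE. Qed.

Lemma dot_cons0 (u v : 'rV[C]_n) : dot (cons0 u) (cons0 v) = dot u v.
Proof.
rewrite /dot big_ord_recl !cons0_0E mul0r add0r; apply: eq_bigr => j _.
by rewrite !cons0_liftE.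
Qed.

Lemma cvec0 m : cvec R (0 : 'rV[int]_m) = 0.
Proof. exact: map_mx0. Qed.

Lemma cons0K (r : 'rV[int]_n) : tail0 (cons0 r) = r.
Proof. by apply/rowP => j; rewrite mxE cons0_liftE. Qed.

Lemma tail0K (r : 'rV[int]_n.+1) : r 0 ord0 = 0 -> cons0 (tail0 r) = r.
Proof. by move=> r0; apply: cons0P => [|j]; rewrite ?cons0_0E ?cons0_liftE // mxE. Qed.

End Cons0.

(** * Action on the highest weight vectors *)

Section Positivity.
Variables (R : realType) (n : nat) (D : datum R n) (HD : standing_assumptions D).
Local Notation C := R[i].
Local Notation g := (gg D).
Local Notation br := (@brk _ _ D).
Local Notation Zn1 := 'rV[int]_n.+1.
Local Notation form := (@gform _ _ D).
Local Notation h0dual := 'Hom(subvs_of (h0 D), C^o).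

Lemma Hdual_mulz (x : Hdual D) (l : int) :
  x *~ l = (x.1.1 *~ l, x.1.2 *~ l, x.2 *~ l).
Proof.
rewrite [LHS]surjective_pairing [(x *~ l).1]surjective_pairing.
by rewrite (raddfMz snd) (raddfMz fst) (raddfMz fst) (raddfMz snd).
Qed.

(** Among the simple roots only [alpha0] has a [delta_0] component, so [l] is its coefficient. *)
Lemma positiveH_ge0 (al : h0dual) (l : int) :
  positiveH (extH al + deltaH D ord0 *~ l) -> 0 <= l /\ (l = 0 -> al != 0).
Proof.
move=> [ne [c0 [c e]]]; split.
  have := congr1 (fun x : Hdual D => x.2 0 ord0) e.
  rewrite !raddfD /= Hdual_mulz /= add0r.
  rewrite raddfMn /= /alpha0 /= raddf_sum /= add0r big1; last first.
    by move=> i _; rewrite raddfMn /= mul0rn.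
  rewrite addr0 -scaler_int mxE mulmxnE !mxE !eqxx mulr1 => lc.
  have -> : l = c0%:Z by apply: (@intr_inj C); rewrite lc.
  exact: le0z_nat.
move=> l0; apply: contra_not_neq ne => ->; rewrite l0 mulr0z addr0.
by rewrite /extH.
Qed.

Lemma positiveH_imaginary (l : int) : 0 < l ->
  positiveH (extH (0 : h0dual) + deltaH D ord0 *~ l).
Proof.
case: l => // l l0; split.
  move=> /(congr1 (fun x : Hdual D => x.2 0 ord0)); rewrite raddfD /= Hdual_mulz /= add0r.
  rewrite -pmulrn mulmxnE !mxE !eqxx => /eqP; rewrite pnatr_eq0.
  by move=> /eqP le0; rewrite le0 in l0.
(* As [0] belongs to the enlarged root system, maximality makes [beta0] itself a combination of
   simple roots; then [l delta_0 = l alpha_0 + l beta_0]. *)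
have [c cE] : simple_combination (beta0 D - 0).
  by apply: (proj2 (sa_beta0 HD)); exact: Or31.
rewrite subr0 in cE; exists l, (fun i => (c i * l)%N).
have -> : \sum_i extH (simp i) *+ (c i * l) = extH (beta0 D) *+ l.
  have -> : extH (beta0 D) = \sum_i extH (simp i) *+ c i :> Hdual D.
    pose E (al : h0dual) : Hdual D := extH al.
    have El : linear_op E by move=> a x y; congr (_, _, _); rewrite /= ?scaler0 ?addr0.
    rewrite cE -/(E _) (linear_op_sum El); apply: eq_bigr => i _.
    by rewrite -[simp i *+ _]scaler_nat (linear_opZ El) scaler_nat.
  by rewrite -sumrMnl; apply: eq_bigr => i _; rewrite mulrnA.
rewrite /alpha0 mulrnDl addrAC -mulrnDl -pmulrn; congr (_ + _).
rewrite (_ : extH (- beta0 D) + extH (beta0 D) = 0) ?mul0rn //.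
by congr (_, _, _); rewrite /= ?addNr ?addr0.
Qed.

(** Invariance moves [ad h] from [Z] to [Y], where it acts by the nonzero scalar [al h]. *)
Lemma form_weight (al : h0dual) (Y Z : g) h N : wt_vector al Y -> al h != 0 ->
  iter N (br (vsval h)) Z = 0 -> form Y Z = 0.
Proof.
move=> wY alh; elim: N Z => [|N IHN] Z; first by move=> /= ->; rewrite gform0r.
rewrite iterSr => /IHN; have [_ _ inv _] := sa_form HD; rewrite -inv brkC // wY.
rewrite -scaleNr -[_ *: _]addr0 gform_linl // gform0l // addr0 => /eqP.
by rewrite mulf_eq0 oppr_eq0 (negPf alh) => /eqP.
Qed.

End Positivity.

Section Operators.
Variables (R : realType) (n : nat) (D : datum R n) (HD : standing_assumptions D).
Local Notation C := R[i].
Local Notation g := (gg D).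
Local Notation br := (@brk _ _ D).
Local Notation Zn := 'rV[int]_n.
Local Notation Zn1 := 'rV[int]_n.+1.
Local Notation form := (@gform _ _ D).
Variables (V : lmodType C) (rho : tau D -> {linear V -> V}).
Hypothesis V_mod : tau_module rho.

Definition op (k : Zn1) (x : fibre D) : V -> V := rho (tau_pi (single_at k x)).

Lemma op_linear k x : linear_op (op k x).
Proof. by move=> c u v; rewrite /op linearP. Qed.

Lemma tau_pi_linear c x y : tau_hat D x -> tau_hat D y ->
  tau_pi (c *: x + y) = c *: tau_pi x + tau_pi y.
Proof. exact: sq_pi_linear. Qed.

Lemma rho_linear c x y v : rho (c *: x + y) v = c *: rho x v + rho y v.
Proof. by case: V_mod => _ h _ _; exact: h. Qed.

Lemma rho0 v : rho 0 v = 0.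
Proof. by have := rho_linear (-1) 0 0 v; rewrite scaler0 addr0 scaleN1r addNr. Qed.

Lemma op_fibre_linear k c x y v : hat_fibre k x -> hat_fibre k y ->
  op k (c *: x + y) v = c *: op k x v + op k y v.
Proof.
move=> hx hy; rewrite /op (@single_at_linear _ _ (fibre D) k).
by rewrite tau_pi_linear ?rho_linear //; exact: tau_hat_single.
Qed.

Lemma op_fibre0 k v : op k 0 v = 0.
Proof. by rewrite /op single_at0 /tau_pi sq_pi0 rho0. Qed.

Lemma op_fibreD k x y v : hat_fibre k x -> hat_fibre k y ->
  op k (x + y) v = op k x v + op k y v.
Proof. by move=> hx hy; rewrite -[x]scale1r op_fibre_linear // !scale1r. Qed.

Lemma op_fibreZ k c x v : hat_fibre k x -> op k (c *: x) v = c *: op k x v.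
Proof.
move=> hx; have h0 : hat_fibre k (0 : fibre D).
  by split; [exact: rpred0|right].
by rewrite -[c *: x]addr0 op_fibre_linear // op_fibre0 addr0.
Qed.

Lemma op_comm k l x y v : hat_fibre k x -> hat_fibre l y ->
  op k x (op l y v) - op l y (op k x v) = op (k + l) (fibre_bracket k l x y) v.
Proof.
move=> hx hy; have [_ _ _ h] := V_mod.
by rewrite /op -tau_bracket_single //; symmetry; exact: h.
Qed.

Lemma op_K_relation r a v : in_Gamma D r -> op r (0, a *: cvec R r, 0) v = 0.
Proof.
move=> rG; have K := K_relations_single a rG.
rewrite /op (_ : tau_pi _ = 0) ?rho0 //.
by apply/sq_pi_eq0 => //; exact: sub_tau_hat.
Qed.

Lemma hat_fibre_X k (X : g) : X \in gdeg D k -> hat_fibre k (X, 0, 0).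
Proof. by split=> //; right. Qed.

Lemma hat_fibre_Kd k w u : in_Gamma D k -> hat_fibre k ((0, w, u) : fibre D).
Proof. by split; [exact: rpred0|left]. Qed.

Lemma hat_fibre_sum k (I : finType) (E : I -> fibre D) :
  (forall i, hat_fibre k (E i)) -> hat_fibre k (\sum_i E i).
Proof.
move=> hE; apply: (big_ind (hat_fibre k)) => [|x y hx hy|i _] //.
  by split; [exact: rpred0|right].
by rewrite -[x]scale1r; exact: hat_fibre_linear.
Qed.

Lemma op_fibre_sum k (I : finType) (E : I -> fibre D) v :
  (forall i, hat_fibre k (E i)) -> op k (\sum_i E i) v = \sum_i op k (E i) v.
Proof.
move=> hE; pose K x w := hat_fibre k x /\ op k x v = w.
suff [] : K (\sum_i E i) (\sum_i op k (E i) v) by [].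
apply: (big_rec2 K) => [|i x w _ [hx <-]].
  by split; [split; [exact: rpred0|right]|exact: op_fibre0].
by split; [rewrite -[E i]scale1r; exact: hat_fibre_linear|exact: op_fibreD].
Qed.

Definition plus_fibre (l : Zn1) (y : fibre D) :=
  (exists Y al, [/\ Y \in gdeg D l, wt_vector al Y,
    positiveH (extH al + deltaH D ord0 *~ l 0 ord0) & y = (Y, 0, 0)]) \/
  (exists w u, [/\ in_Gamma D l, 0 < l 0 ord0 & y = (0, w, u)]).

Lemma op_Kd_sum l (w u : 'rV[C]_n.+1) v : in_Gamma D l -> op l (0, w, u) v =
  \sum_i w 0 i *: op l (0, delta_mx 0 i, 0) v + \sum_i u 0 i *: op l (0, 0, delta_mx 0 i) v.
Proof.
move=> lG.
have hK i : hat_fibre l ((0, delta_mx 0 i, 0) : fibre D) by exact: hat_fibre_Kd.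
have hd i : hat_fibre l ((0, 0, delta_mx 0 i) : fibre D) by exact: hat_fibre_Kd.
rewrite (fibre_split 0 w u) (_ : (0, 0, 0) = 0 :> fibre D) // add0r.
have -> : (0, w, 0) = \sum_i w 0 i *: (0, delta_mx 0 i, 0) :> fibre D.
  by rewrite {1}[w]row_sum_delta (linear_op_sum (@fibre_K_linear _ _ D)); apply: eq_bigr => i _;
    rewrite (linear_opZ (@fibre_K_linear _ _ D)).
have -> : (0, 0, u) = \sum_i u 0 i *: (0, 0, delta_mx 0 i) :> fibre D.
  by rewrite {1}[u]row_sum_delta (linear_op_sum (@fibre_d_linear _ _ D)); apply: eq_bigr => i _;
    rewrite (linear_opZ (@fibre_d_linear _ _ D)).
have hZ c x : hat_fibre l x -> hat_fibre l (c *: x).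
  move=> hx; rewrite -[c *: x]addr0; apply: hat_fibre_linear => //.
  by split; [exact: rpred0|right].
rewrite op_fibreD; [|by apply: hat_fibre_sum => i; exact: hZ..].
rewrite !op_fibre_sum => [|i|i]; [|exact: hZ|exact: hZ].
by congr (_ + _); apply: eq_bigr => i _; rewrite op_fibreZ.
Qed.

Lemma TVP v : TV rho v <-> forall l y, plus_fibre l y -> op l y v = 0.
Proof.
split=> [Tv l y|h].
  move=> [[Y [al [Yl wY pos ->]]]|[w [u [lG l0 ->]]]].
    by apply: Tv; apply: sub_lspan; left; exists l, Y, al.
  rewrite op_Kd_sum //.
  have TK i : op l (0, delta_mx 0 i, 0) v = 0.
    by apply: Tv; apply: sub_lspan; right; exists l, i; split=> //; left.
  have Td i : op l (0, 0, delta_mx 0 i) v = 0.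
    by apply: Tv; apply: sub_lspan; right; exists l, i; split=> //; right.
  by rewrite !big1 ?addr0 // => i _; rewrite ?TK ?Td scaler0.
have Kc : rho 0 v = 0 /\ forall (c : C) x y, rho x v = 0 -> rho y v = 0 ->
    rho (c *: x + y) v = 0.
  split=> [|c x y xv yv]; first exact: rho0.
  by rewrite rho_linear xv yv scaler0 addr0.
apply: (lspan_sub (S := Subspace Kc)) => x /=.
move=> [[k [X [al [Xk wX pos ->]]]]|[r [i [rG r0 [->|->]]]]].
- by apply: (h k (X, 0, 0)); left; exists X, al.
- by apply: (h r (0, delta_mx 0 i, 0)); right; exists (delta_mx 0 i), 0.
- by apply: (h r (0, 0, delta_mx 0 i)); right; exists 0, (delta_mx 0 i).
Qed.

Lemma h0_gdeg0 h : h \in h0 D -> h \in gdeg D 0.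
Proof. by have [+ _ _ _] := sa_cartan0 HD; move/subvP; apply. Qed.

(** The centralizer of [h0] in [t_0]-degree zero. It normalizes [tau_plus], and the operators of [L]
    used below are of this kind. *)
Definition zero_fibre (k : Zn1) (x : fibre D) := [/\ k 0 ord0 = 0, hat_fibre k x &
  forall h, h \in h0 D -> br h x.1.1 = 0].

Lemma plus_hat l y : plus_fibre l y -> hat_fibre l y.
Proof.
by move=> [[Y [al [Yl _ _ ->]]]|[w [u [lG _ ->]]]]; [exact: hat_fibre_X|exact: hat_fibre_Kd].
Qed.

Lemma op_split k x v : hat_fibre k x -> op k x v = op k (x.1.1, 0, 0) v + op k (0, x.1.2, x.2) v.
Proof.
case: x => [[X w] u] [/= Xk hx]; rewrite -op_fibreD; [|by split=> //; right|].
  by congr (op k _ v); congr (_, _, _); rewrite /= ?addr0 ?add0r.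
by split=> //; exact: rpred0.
Qed.

Lemma wt_vector_linear (al : 'Hom(subvs_of (h0 D), C^o)) c (x y : g) :
  wt_vector al x -> wt_vector al y -> wt_vector al (c *: x + y).
Proof. by move=> hx hy h; rewrite brk_linr // hx hy scalerDr !scalerA mulrC. Qed.

Lemma wt_vector_br (al : 'Hom(subvs_of (h0 D), C^o)) (Y X : g) : wt_vector al Y ->
  (forall h, h \in h0 D -> br h X = 0) -> wt_vector al (br Y X).
Proof.
move=> wY hX h; have [_ _ _ jac] := sa_lie HD; have := jac (vsval h) Y X.
rewrite [br X (vsval h)]brkC // (hX _ (subvsP h)) oppr0 brk0r // addr0 wY.
rewrite -[_ *: Y]addr0 brk_linr // brk0r // addr0 [br X Y]brkC // scalerN => /eqP.
by rewrite subr_eq0 => /eqP.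
Qed.

Lemma Hom_neq0 (al : 'Hom(subvs_of (h0 D), C^o)) : al != 0 -> exists h, al h != 0.
Proof.
move=> al0; apply: contrapT => noh; move/eqP: al0; apply; apply/lfunP => h.
by rewrite zero_lfunE; apply: contrapT => /eqP alh; apply: noh; exists h.
Qed.

(** Bracketing with [x] keeps the [h0]-weight and the [t_0]-degree of a generator of [tau_plus].
    Only a central part in [t_0]-degree zero could leave [tau_plus]; it vanishes because the form
    pairs a nonzero weight trivially with weight zero. *)
Lemma TV_op k x v : zero_fibre k x -> TV rho v -> TV rho (op k x v).
Proof.
move=> [k0 hx xh] /TVP Tv; apply/TVP => l y ply; have hy := plus_hat ply.
have -> : op l y (op k x v) = op k x (op l y v) + op (l + k) (fibre_bracket l k y x) v.
  by rewrite -op_comm // addrC subrK.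
rewrite (Tv _ _ ply) (linear_op0 (@op_linear k x)) add0r.
have hb := hat_fibre_bracket HD hy hx; rewrite op_split //.
have lk0 : (l + k) 0 ord0 = l 0 ord0 by rewrite mxE k0 addr0.
have Kd_part : 0 < l 0 ord0 ->
    op (l + k) (0, (fibre_bracket l k y x).1.2, (fibre_bracket l k y x).2) v = 0.
  move=> l0; have [_ [lkG|[-> ->]]] := hb;
    last by rewrite (_ : (0, 0, 0) = 0 :> fibre D) // op_fibre0.
  by apply: Tv; right; eexists; eexists; split; [exact: lkG|rewrite lk0|].
case: x hx xh hb Kd_part => [[X w] u] hx xh hb Kd_part.
case: ply hy hb Kd_part => [[Y [al [Yl wY pos ->]]]|[w' [v' [lG l0 ->]]]] hy hb Kd_part; last first.
  rewrite Kd_part // addr0; have [hb1 _] := hb; apply: Tv; left.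
  exists (fibre_bracket l k (0, w', v') (X, w, u)).1.1, 0; split=> //; last first.
    by rewrite lk0; exact: positiveH_imaginary.
  move=> h /=; rewrite brk0l // add0r scaler0 subr0 lfunE /= scale0r.
  by rewrite -[_ *: X]addr0 brk_linr // brk0r // addr0 xh ?subvsP // scaler0.
have [l_ge0 l_al] := positiveH_ge0 pos.
have X_part : op (l + k) ((fibre_bracket l k (Y, 0, 0) (X, w, u)).1.1, 0, 0) v = 0.
  have [hb1 _] := hb; apply: Tv; left.
  exists (fibre_bracket l k (Y, 0, 0) (X, w, u)).1.1, al; split=> //; last by rewrite lk0.
  rewrite /= dot0l scale0r addr0 addrC -scaleNr; apply: wt_vector_linear => //.
  exact: wt_vector_br.
rewrite X_part add0r; move: l_ge0; rewrite le_eqVlt => /orP[/eqP l0|]; last exact: Kd_part.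
have [h alh] := Hom_neq0 (l_al (esym l0)).
have YX : form Y X = 0.
  by apply: (form_weight HD wY alh (N := 1)); rewrite /= xh // subvsP.
have simp := (@dot0l R, @dot0r R, scale0r, scaler0, mulr0, mul0r, addr0, subr0).
rewrite (_ : (0, _, _) = 0 :> fibre D) ?op_fibre0 //.
by congr (_, _, _); rewrite /= ?YX ?if_same !simp.
Qed.

(** Treating [h] as a [zero_fibre] would require [h0] to be abelian, whereas a Cartan subalgebra is
    defined here as nilpotent and self-normalizing. Instead, [ad h] multiplies a weight vector [Y]
    by a scalar, and the central term [(Y, h) sum_p l_p t^l K_p] is a relation of [tau]. *)
Lemma TV_h0 h v : h \in h0 D -> TV rho v -> TV rho (op 0 (h, 0, 0) v).
Proof.
move=> hh /TVP Tv; apply/TVP => l y ply; have hy := plus_hat ply.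
have hx : hat_fibre 0 ((h, 0, 0) : fibre D) by apply: hat_fibre_X; exact: h0_gdeg0.
have -> : op l y (op 0 (h, 0, 0) v) =
    op 0 (h, 0, 0) (op l y v) + op (l + 0) (fibre_bracket l 0 y (h, 0, 0)) v.
  by rewrite -op_comm // addrC subrK.
rewrite (Tv _ _ ply) (linear_op0 (@op_linear 0 _)) add0r addr0.
have simp := (@dot0l R, @dot0r R, cvec0, scale0r, scaler0, mulr0, mul0r, addr0, subr0).
case: ply hy => [[Y [al [Yl wY pos ->]]]|[w [u [lG l0 ->]]]] hy; last first.
  rewrite (_ : fibre_bracket _ _ _ _ = 0) ?op_fibre0 //.
  by congr (_, _, _); rewrite /= ?brk0l // ?gform0l // ?if_same !simp.
have -> : fibre_bracket l 0 ((Y, 0, 0) : fibre D) (h, 0, 0) =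
    - al (vsproj (h0 D) h) *: (Y, 0, 0) +
    (0, (if in_Gamma D (l + 0) then form Y h else 0) *: cvec R l, 0).
  congr (_, _, _); rewrite /= !simp ?add0r //.
  by rewrite brkC // -{1}(vsprojK hh) wY scaleNr.
have hK : hat_fibre l ((0, (if in_Gamma D (l + 0) then form Y h else 0) *: cvec R l, 0) : fibre D).
  rewrite addr0; case: ifP => lG; first exact: hat_fibre_Kd.
  by rewrite scale0r; split; [exact: rpred0|right].
rewrite op_fibre_linear // Tv ?scaler0 ?add0r; last by left; exists Y, al.
rewrite addr0; case: ifP => lG; first exact: op_K_relation.
by rewrite scale0r (_ : (0, 0, 0) = 0 :> fibre D) // op_fibre0.
Qed.

Lemma op_h0_comm h k x v : h \in h0 D -> zero_fibre k x ->
  op 0 (h, 0, 0) (op k x v) = op k x (op 0 (h, 0, 0) v).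
Proof.
move=> hh [k0 hx xh]; apply/eqP; rewrite -subr_eq0.
have hx' : hat_fibre 0 ((h, 0, 0) : fibre D) by apply: hat_fibre_X; exact: h0_gdeg0.
rewrite op_comm //; case: x hx xh => [[X w] u] hx /= xh.
have simp := (@dot0l R, @dot0r R, cvec0, scale0r, scaler0, mulr0, mul0r, addr0, subr0).
by rewrite xh // !simp (_ : (0, 0, 0) = 0 :> fibre D) // op_fibre0.
Qed.

Lemma op_d_comm i k x v : hat_fibre k x ->
  op 0 (0, 0, delta_mx 0 i) (op k x v) - op k x (op 0 (0, 0, delta_mx 0 i) v) =
  (k 0 i)%:~R *: op k x v.
Proof.
move=> hx; have hd := hat_fibre_Kd 0 (delta_mx 0 i) (in_Gamma0 D).
rewrite op_comm // add0r -op_fibreZ //; congr (op k _ v); case: x hx => [[X w] u] hx.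
have simp := (@dot0l R, @dot0r R, cvec0, scale0r, scaler0, mulr0, mul0r, addr0, subr0).
by congr (_, _, _); rewrite /= ?brk0l // !simp dot_deltal mxE ?add0r.
Qed.

End Operators.

(** * Commutation relations in [t_0]-degree zero *)

Section LOperators.
Variables (R : realType) (n : nat) (D : datum R n) (HD : standing_assumptions D).
Local Notation C := R[i].
Local Notation g := (gg D).
Local Notation br := (@brk _ _ D).
Local Notation Zn := 'rV[int]_n.
Local Notation Cn := 'rV[C]_n.
Local Notation form := (@gform _ _ D).
Variables (V : lmodType C) (rho : tau D -> {linear V -> V}).
Hypothesis V_mod : tau_module rho.
Variable C0 : C.
Hypothesis Ki_act : forall (i : 'I_n) v, rho (tK D 0 (lift ord0 i)) v = 0.
Local Notation op := (op rho).
Local Notation lat r := (in_Gamma D (cons0 r)).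

Definition d_op (u : Cn) (r : Zn) : V -> V := op (cons0 r) (0, 0, cons0 u).
Definition x_op (X : g) (k : Zn) : V -> V := op (cons0 k) (X, 0, 0).
(** There is no [K_0] component: commutators of the operators [d_op] and [x_op] produce only
    [K_1, ..., K_n], while [K_0] enters through [t_op]. *)
Definition z_op (c : Cn) (r : Zn) : V -> V := op (cons0 r) (0, cons0 c, 0).
Definition t_op (s : Zn) (v : V) : V := C0^-1 *: op (cons0 s) (0, delta_mx 0 ord0, 0) v.

Definition phi_coef (u v : Cn) (r s : Zn) : C :=
  - phi1_coef D * dot u (cvec R s) * dot v (cvec R r)
  + phi2_coef D * dot u (cvec R r) * dot v (cvec R s).

Definition form_coef (X X' : g) (k l : Zn) : C :=
  if in_Gamma D (cons0 k + cons0 l) then form X X' else 0.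

Lemma lat0 : lat 0.
Proof. by rewrite cons00; exact: in_Gamma0. Qed.

Lemma latD r s : lat r -> lat s -> lat (r + s).
Proof. by rewrite cons0D; exact: in_GammaD. Qed.

Lemma in_gring_gdeg k X : in_gring_ k X -> X \in gdeg D (cons0 k).
Proof.
move=> [[s0 _] sj]; apply/gdegP => i; case: (unliftP ord0 i) => [j ->|->].
  by rewrite cons0_liftE.
by rewrite cons0_0E expr0z scale1r.
Qed.

Lemma zero_d u r : lat r -> zero_fibre (cons0 r) ((0, 0, cons0 u) : fibre D).
Proof.
by move=> rG; split=> [||h _]; [exact: cons0_0E|exact: hat_fibre_Kd|exact: brk0r].
Qed.

Lemma zero_K w r : lat r -> zero_fibre (cons0 r) ((0, w, 0) : fibre D).
Proof.
by move=> rG; split=> [||h _]; [exact: cons0_0E|exact: hat_fibre_Kd|exact: brk0r].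
Qed.

Lemma zero_x X k : in_gring_ k X -> zero_fibre (cons0 k) ((X, 0, 0) : fibre D).
Proof.
move=> GX; split; [exact: cons0_0E|exact/hat_fibre_X/in_gring_gdeg|].
by case: GX => -[].
Qed.

Let simp := (@dot0l R, @dot0r R, cvec0, scale0r, scaler0, mulr0, mul0r, addr0, add0r, subr0, oppr0,
  @cvec_cons0 R n, @dot_cons0 R n).

Lemma hat_d u r : lat r -> hat_fibre (cons0 r) ((0, 0, cons0 u) : fibre D).
Proof. exact: hat_fibre_Kd. Qed.

Lemma hat_K w r : lat r -> hat_fibre (cons0 r) ((0, w, 0) : fibre D).
Proof. exact: hat_fibre_Kd. Qed.

Lemma hat_fibreZ k c (x : fibre D) : hat_fibre k x -> hat_fibre k (c *: x).
Proof.
move=> hx; rewrite -[c *: x]addr0; apply: hat_fibre_linear => //.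
by split; [exact: rpred0|right].
Qed.

Lemma d_op_linear u r : linear_op (d_op u r).
Proof. exact: op_linear. Qed.

Lemma x_op_linear X k : linear_op (x_op X k).
Proof. exact: op_linear. Qed.

Lemma z_op_linear c r : linear_op (z_op c r).
Proof. exact: op_linear. Qed.

Lemma t_op_linear s : linear_op (t_op s).
Proof.
by move=> c u v; rewrite /t_op (@op_linear _ _ _ _ rho) scalerDr !scalerA mulrC.
Qed.

Lemma d_op_u r v : lat r -> linear_op (fun u => d_op u r v).
Proof.
move=> rG c u w; rewrite /d_op -(op_fibre_linear V_mod); [|exact: hat_d..].
congr (op _ _ v); congr (_, _, _); rewrite /= ?scaler0 ?addr0 //.
exact: cons0_linear.
Qed.

Lemma z_op_c r v : lat r -> linear_op (fun c => z_op c r v).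
Proof.
move=> rG c u w; rewrite /z_op -(op_fibre_linear V_mod); [|exact: hat_K..].
congr (op _ _ v); congr (_, _, _); rewrite /= ?scaler0 ?addr0 //.
exact: cons0_linear.
Qed.

Lemma z_op0 c v : z_op c 0 v = 0.
Proof.
rewrite /z_op cons00 (op_Kd_sum V_mod) ?in_Gamma0 // big_ord_recl cons0_0E scale0r add0r.
rewrite big1 ?add0r => [|i _]; last first.
  by rewrite -[op _ _ _]/(rho (tK D 0 (lift ord0 i)) v) Ki_act scaler0.
by rewrite big1 // => i _; rewrite mxE scale0r.
Qed.

Lemma d_d u w r s v : lat r -> lat s ->
  d_op u r (d_op w s v) - d_op w s (d_op u r v) =
  dot u (cvec R s) *: d_op w (r + s) v - dot w (cvec R r) *: d_op u (r + s) v
  + phi_coef u w r s *: z_op (cvec R r) (r + s) v.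
Proof.
move=> rG sG; have rsG := latD rG sG.
have hd := hat_d _ rsG; have hK := hat_K _ rsG.
rewrite /d_op (op_comm HD V_mod); [|exact: hat_d..]; rewrite -cons0D.
rewrite (_ : fibre_bracket _ _ _ _ = dot u (cvec R s) *: (0, 0, cons0 w) +
  (- dot w (cvec R r) *: (0, 0, cons0 u) + phi_coef u w r s *: (0, cons0 (cvec R r), 0))).
  rewrite !(op_fibre_linear V_mod) ?(op_fibreZ V_mod) //; do ?exact: hat_fibreZ.
    by rewrite scaleNr addrA.
  by apply: hat_fibre_linear => //; exact: hat_fibreZ.
congr (_, _, _); rewrite /= ?brk0l // ?gform0l // ?if_same !simp ?scaleNr ?oppr0 ?add0r ?oppr0
  //; reflexivity.
Qed.

Lemma d_x u r X k v : lat r -> in_gring_ k X ->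
  d_op u r (x_op X k v) - x_op X k (d_op u r v) =
  dot u (cvec R k) *: x_op X (k + r) v.
Proof.
move=> rG /in_gring_gdeg GX.
have hX : hat_fibre (cons0 (k + r)) ((X, 0, 0) : fibre D).
  by apply: hat_fibre_X; rewrite cons0D; exact: gdegD.
rewrite /d_op (op_comm HD V_mod); [|exact: hat_d|exact: hat_fibre_X].
rewrite -cons0D [r + k]addrC /x_op -(op_fibreZ V_mod); last exact: hX.
congr (op _ _ v).
congr (_, _, _); rewrite /= ?brk0l // ?gform0l // ?if_same !simp ?add0r ?oppr0 //; reflexivity.
Qed.

Lemma x_x X X' k l v : in_gring_ k X -> in_gring_ l X' ->
  x_op X k (x_op X' l v) - x_op X' l (x_op X k v) =
  x_op (br X X') (k + l) v + form_coef X X' k l *: z_op (cvec R k) (k + l) v.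
Proof.
move=> /in_gring_gdeg GX /in_gring_gdeg GX'.
rewrite /x_op (op_comm HD V_mod); [|exact: hat_fibre_X..].
have hX : hat_fibre (cons0 (k + l)) ((br X X', 0, 0) : fibre D).
  by apply: hat_fibre_X; rewrite cons0D; exact: gdeg_br.
have -> : fibre_bracket (cons0 k) (cons0 l) ((X, 0, 0) : fibre D) (X', 0, 0) =
    (br X X', 0, 0) + form_coef X X' k l *: (0, cons0 (cvec R k), 0).
  congr (_, _, _); rewrite /= !simp ?add0r ?oppr0 //; reflexivity.
rewrite /form_coef -cons0D; case: ifP => klG; last first.
  by rewrite !scale0r !addr0.
rewrite (op_fibreD V_mod); [|exact: hX|exact/hat_fibreZ/hat_K].
by rewrite (op_fibreZ V_mod); last exact: hat_K.
Qed.

Lemma d_z u s c r v : lat s -> lat r ->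
  d_op u s (z_op c r v) - z_op c r (d_op u s v) =
  dot u (cvec R r) *: z_op c (r + s) v + dot u c *: z_op (cvec R s) (r + s) v.
Proof.
move=> sG rG; have rsG := latD rG sG.
rewrite /d_op (op_comm HD V_mod); [|exact: hat_d|exact: hat_K].
rewrite -cons0D [s + r]addrC /z_op -!(op_fibreZ V_mod); [|exact: hat_K..].
rewrite -(op_fibreD V_mod); [|exact/hat_fibreZ/hat_K..]; congr (op _ _ v).
congr (_, _, _); rewrite /= ?brk0l // ?gform0l // ?if_same !simp ?add0r ?oppr0 //; reflexivity.
Qed.

Lemma x_K X k w r v : in_gring_ k X -> lat r ->
  x_op X k (op (cons0 r) (0, w, 0) v) = op (cons0 r) (0, w, 0) (x_op X k v).
Proof.
move=> /in_gring_gdeg GX rG; apply/eqP; rewrite -subr_eq0.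
rewrite /x_op (op_comm HD V_mod); [|exact: hat_fibre_X|exact: hat_K].
rewrite (_ : fibre_bracket _ _ _ _ = 0) ?(op_fibre0 V_mod) //.
congr (_, _, _); rewrite /= ?brk0r // ?gform0r // ?if_same !simp ?add0r ?oppr0 //; reflexivity.
Qed.

Lemma K_K w r w' r' v : lat r -> lat r' ->
  op (cons0 r) (0, w, 0) (op (cons0 r') (0, w', 0) v) =
  op (cons0 r') (0, w', 0) (op (cons0 r) (0, w, 0) v).
Proof.
move=> rG rG'; apply/eqP; rewrite -subr_eq0 (op_comm HD V_mod); [|exact: hat_K..].
rewrite (_ : fibre_bracket _ _ _ _ = 0) ?(op_fibre0 V_mod) //.
congr (_, _, _); rewrite /= ?brk0r // ?gform0r // ?if_same !simp ?add0r ?oppr0 //; reflexivity.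
Qed.

(** No further central term appears, because [d_a] with [a > 0] and [K_0] have different indices in
    the Kronecker delta of the bracket. *)
Lemma d_t u r s v : lat r -> lat s ->
  d_op u r (t_op s v) = t_op s (d_op u r v) + dot u (cvec R s) *: t_op (r + s) v.
Proof.
move=> rG sG; have rsG := latD rG sG; apply/eqP; rewrite addrC -subr_eq /t_op.
rewrite (linear_opZ (@d_op_linear u r)) -scalerBr /d_op (op_comm HD V_mod); last first.
- exact: hat_K.
- exact: hat_d.
rewrite -cons0D scalerA mulrC -scalerA; apply/eqP; congr (_ *: _).
rewrite -(op_fibreZ V_mod); last exact: hat_K.
congr (op _ _ v).
have d0 : dot (cons0 u) (delta_mx 0 ord0) = 0 by rewrite dotC dot_deltal cons0_0E.
congr (_, _, _); rewrite /= ?brk0l // ?gform0l // ?d0 ?if_same !simp ?add0r ?oppr0 //; reflexivity.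
Qed.

Definition a_op (u : Cn) (r : Zn) (v : V) : V := d_op u r v - d_op u 0 v.

Lemma a_op_linear u r : linear_op (a_op u r).
Proof.
by move=> c x y; rewrite /a_op !d_op_linear scalerBr opprD addrACA.
Qed.

Lemma a_op_u r v : lat r -> linear_op (fun u => a_op u r v).
Proof.
move=> rG c x y; rewrite /a_op (d_op_u _ rG) (d_op_u _ lat0) scalerBr opprD.
exact: addrACA.
Qed.

Lemma a_op0 u v : a_op u 0 v = 0.
Proof. exact: subrr. Qed.

Lemma comm_sub (f f' h h' : V -> V) v : linear_op f -> linear_op f' ->
  linear_op h -> linear_op h' ->
  (f (h v - h' v) - f' (h v - h' v)) - (h (f v - f' v) - h' (f v - f' v)) =
  (f (h v) - h (f v)) - (f (h' v) - h' (f v)) - ((f' (h v) - h (f' v)) - (f' (h' v) - h' (f' v))).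
Proof.
move=> lf lf' lh lh'; rewrite !(linear_opB lf, linear_opB lf', linear_opB lh, linear_opB lh').
move: (f (h v)) (f (h' v)) (f' (h v)) (f' (h' v)) => a b c d.
move: (h (f v)) (h (f' v)) (h' (f v)) (h' (f' v)) => a' b' c' d'.
have e x y p q : x - p - (q - y) = x + y - (p + q) :> V by rewrite opprB addrACA -opprD.
rewrite subrACA [a - b - _]subrACA [c - d - _]subrACA !e; congr (_ - _).
by rewrite addrACA [RHS]addrACA [- b' - _]addrC.
Qed.

Lemma a_a u w r s v : lat r -> lat s ->
  a_op u r (a_op w s v) - a_op w s (a_op u r v) =
  dot u (cvec R s) *: (a_op w (r + s) v - a_op w s v)
  - dot w (cvec R r) *: (a_op u (r + s) v - a_op u r v)
  + phi_coef u w r s *: z_op (cvec R r) (r + s) v.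
Proof.
move=> rG sG; have lat0' := lat0.
have -> : a_op u r (a_op w s v) - a_op w s (a_op u r v) =
    (d_op u r (d_op w s v) - d_op w s (d_op u r v))
    - (d_op u r (d_op w 0 v) - d_op w 0 (d_op u r v))
    - ((d_op u 0 (d_op w s v) - d_op w s (d_op u 0 v))
    - (d_op u 0 (d_op w 0 v) - d_op w 0 (d_op u 0 v))).
  by apply: comm_sub; exact: d_op_linear.
rewrite !d_d // /phi_coef !simp.
have -> : a_op w (r + s) v - a_op w s v = d_op w (r + s) v - d_op w s v.
  by rewrite /a_op subrACA subrr subr0.
have -> : a_op u (r + s) v - a_op u r v = d_op u (r + s) v - d_op u r v.
  by rewrite /a_op subrACA subrr subr0.
by rewrite !scalerBr opprK opprB !addrA [LHS](ACl (1*5*4*2*3)).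
Qed.

Lemma a_x u r X k v : lat r -> in_gring_ k X ->
  a_op u r (x_op X k v) - x_op X k (a_op u r v) =
  dot u (cvec R k) *: (x_op X (k + r) v - x_op X k v).
Proof.
move=> rG GX; rewrite /a_op (linear_opB (@x_op_linear X k)) subrACA !d_x //; last exact: lat0.
by rewrite addr0 scalerBr.
Qed.

Lemma a_z u s c r v : lat s -> lat r ->
  a_op u s (z_op c r v) - z_op c r (a_op u s v) =
  dot u (cvec R r) *: (z_op c (r + s) v - z_op c r v)
  + dot u c *: z_op (cvec R s) (r + s) v.
Proof.
move=> sG rG; rewrite /a_op (linear_opB (@z_op_linear c r)) subrACA !d_z //; last exact: lat0.
rewrite addr0 cvec0 (linear_op0 (@z_op_c r v rG)) scaler0 addr0 scalerBr.
by rewrite addrAC.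
Qed.

Lemma a_t u r s v : lat r -> lat s ->
  a_op u r (t_op s v) = t_op s (a_op u r v) + dot u (cvec R s) *: (t_op (r + s) v - t_op s v).
Proof.
move=> rG sG; rewrite /a_op !d_t //; last exact: lat0.
by rewrite opprD addrACA (linear_opB (@t_op_linear s)) scalerBr add0r.
Qed.

Lemma x_t X k s v : in_gring_ k X -> lat s -> x_op X k (t_op s v) = t_op s (x_op X k v).
Proof. by move=> GX sG; rewrite /t_op (linear_opZ (@x_op_linear X k)) x_K. Qed.

Lemma z_t c r s v : lat r -> lat s -> z_op c r (t_op s v) = t_op s (z_op c r v).
Proof. by move=> rG sG; rewrite /t_op (linear_opZ (@z_op_linear c r)) /z_op K_K. Qed.

End LOperators.

(** * Action on the quotient T/W *)

Section QuotientOperators.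
Variables (R : realType) (n : nat) (D : datum R n) (HD : standing_assumptions D).
Local Notation C := R[i].
Local Notation g := (gg D).
Local Notation br := (@brk _ _ D).
Local Notation Zn := 'rV[int]_n.
Local Notation Cn := 'rV[C]_n.
Variables (V : lmodType C) (rho : tau D -> {linear V -> V}).
Hypothesis V_mod : tau_module rho.
Variable C0 : C.
Hypothesis Ki_act : forall (i : 'I_n) v, rho (tK D 0 (lift ord0 i)) v = 0.
Local Notation lat r := (in_Gamma D (cons0 r)).
Local Notation T := (TV rho).
Local Notation W := (WV rho C0).
Local Notation U := (Vt rho C0).
Local Notation pi := (@Vt_pi _ _ D V rho C0).
Local Notation m := (fun j : 'I_n => sord D (lift ord0 j)).

Definition good (f : V -> V) := [/\ linear_op f,
  forall v, T v -> T (f v) & forall v, W v -> W (f v)].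

Lemma W_gen s v : lat s -> T v -> W (t_op rho C0 s v - v).
Proof. by move=> sG Tv; apply: sub_lspan; exists s, v. Qed.

Lemma T_t s v : lat s -> T v -> T (t_op rho C0 s v).
Proof. by move=> sG Tv; apply: ssZ; apply: (TV_op HD V_mod) => //; exact: zero_K. Qed.

Lemma goodP f : linear_op f -> (forall v, T v -> T (f v)) ->
  (forall s v, lat s -> T v -> W (f (t_op rho C0 s v) - f v)) -> good f.
Proof.
move=> fl fT fW; split=> //.
have Kc : W (f 0) /\ forall (c : C) u v, W (f u) -> W (f v) -> W (f (c *: u + v)).
  split=> [|c u v Wu Wv]; first by rewrite (linear_op0 fl); exact: ss0.
  by rewrite fl; exact: ssP.
apply: (lspan_sub (S := Subspace Kc)) => _ [s [v [sG Tv ->]]] /=.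
rewrite -[_ *: _]/(t_op rho C0 s v) (linear_opB fl); exact: fW.
Qed.

Lemma T_d u r v : lat r -> T v -> T (d_op rho u r v).
Proof. by move=> rG Tv; apply: (TV_op HD V_mod) => //; exact: zero_d. Qed.

Lemma T_a u r v : lat r -> T v -> T (a_op rho u r v).
Proof. by move=> rG Tv; apply: ssB; apply: T_d => //; exact: lat0. Qed.

(** The commutator with [t^s] is [dot u s] times [t^(r + s) - t^s], which maps [T] into [W]. For
    [d_op u r] alone it would be a multiple of [t^(r + s)], which is the identity modulo [W]; hence
    the restriction to [I]. *)
Lemma good_a u r : lat r -> good (a_op rho u r).
Proof.
move=> rG; apply: goodP; first exact: a_op_linear.
  by move=> v; exact: T_a.
move=> s v sG Tv; rewrite (a_t HD V_mod) // addrAC; apply: ssD.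
  by apply: W_gen => //; exact: T_a.
apply: ssZ; rewrite -(subrK v (t_op rho C0 (r + s) v)) -addrA -[v - _]opprB.
by apply: ssB; apply: W_gen => //; exact: latD.
Qed.

Lemma T_x X k v : in_gring_ k X -> T v -> T (x_op rho X k v).
Proof. by move=> GX Tv; apply: (TV_op HD V_mod) => //; exact: zero_x. Qed.

Lemma good_x X k : in_gring_ k X -> good (x_op rho X k).
Proof.
move=> GX; apply: goodP; first exact: x_op_linear.
  by move=> v; exact: T_x.
move=> s v sG Tv; rewrite (x_t HD V_mod) //.
by apply: W_gen => //; exact: T_x.
Qed.

Lemma T_z c r v : lat r -> T v -> T (z_op rho c r v).
Proof. by move=> rG Tv; apply: (TV_op HD V_mod) => //; exact: zero_K. Qed.

Lemma good_z c r : lat r -> good (z_op rho c r).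
Proof.
move=> rG; apply: goodP; first exact: z_op_linear.
  by move=> v; exact: T_z.
move=> s v sG Tv; rewrite (z_t HD V_mod) //.
by apply: W_gen => //; exact: T_z.
Qed.

Definition induced (f : V -> V) (v : U) : U := pi (f (sq_repr v)).

Lemma T_repr (v : U) : T (sq_repr v).
Proof. exact: sq_repr_in. Qed.

Lemma induced_pi f t : good f -> T t -> induced f (pi t) = pi (f t).
Proof.
move=> [fl fT fW] Tt; apply: sq_pi_eq; [exact/fT/T_repr|exact: fT|].
by rewrite -(linear_opB fl); apply: fW; exact: sq_repr_pi.
Qed.

Lemma induced_linear f : good f -> linear_op (induced f).
Proof.
move=> gf c u v; have [fl fT fW] := gf.
rewrite -{1}[u]sq_reprK -{1}[v]sq_reprK -(sq_pi_linear _ _ (T_repr u) (T_repr v)).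
rewrite induced_pi //; last by apply: ssP; exact: T_repr.
by rewrite fl; apply: sq_pi_linear; apply: fT; exact: T_repr.
Qed.

Lemma induced_comp f h v : good f -> good h ->
  induced f (induced h v) = pi (f (h (sq_repr v))).
Proof. by move=> gf [_ hT _]; apply: induced_pi => //; apply/hT/T_repr. Qed.

Lemma latticeP r : lattice m r <-> lat r.
Proof.
split=> [[s ->]|/in_GammaP rG].
  apply/in_GammaP => i; case: (unliftP ord0 i) => [j ->|->]; last by rewrite cons0_0E dvdz0.
  by rewrite cons0_liftE mxE dvdz_mull.
exists (\row_j ((r 0 j)%R %/ (sord D (lift ord0 j))%:Z)%Z); apply/rowP => j; rewrite !mxE.
by rewrite divzK //; have := rG (lift ord0 j); rewrite cons0_liftE.
Qed.

Lemma in_gring_degD k r (X : g) : lat r -> in_gring_ k X -> in_gring_ (k + r) X.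
Proof.
move=> /in_GammaP rG [GX sX]; split=> // j; rewrite sX mxE expfzDr ?xi_neq0 //.
by have := rG (lift ord0 j); rewrite cons0_liftE => /(xi_Gamma HD)->; rewrite mulr1.
Qed.

Lemma brk_scale a b (x y : g) : br (a *: x) (b *: y) = (a * b) *: br x y.
Proof.
rewrite -[a *: x]addr0 brk_linl // brk0l // addr0 -[b *: y]addr0 brk_linr // brk0r // addr0.
by rewrite scalerA.
Qed.

Lemma in_gring_brk (X X' : g) : in_gring X -> in_gring X' -> in_gring (br X X').
Proof.
move=> [sX hX] [sX' hX']; split; first by rewrite (sa_aut HD) sX sX'.
move=> h hh; have [_ _ _ jac] := sa_lie HD; have := jac h X X'.
have hXh : br X' h = 0 by rewrite brkC // hX' // oppr0.
by rewrite hXh (hX h hh) !brk0r // !addr0.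
Qed.

Lemma in_gring_deg_brk k l (X X' : g) : in_gring_ k X -> in_gring_ l X' -> in_gring_ (k
  + l) (br X X').
Proof.
move=> [GX sX] [GX' sX']; split=> [|j]; first exact: in_gring_brk.
by rewrite (sa_aut HD) sX sX' mxE expfzDr ?xi_neq0 // brk_scale.
Qed.

Local Ltac solve_ss := repeat first [assumption |
  match goal with
  | |- ssset _ (_ *: _) => apply: ssZ
  | |- ssset _ (_ - _) => apply: ssB
  | |- ssset _ (_ + _) => apply: ssD
  end].

(** The identities come from those on [V]; the bookkeeping ensures that every term lies in [T], the
    domain on which the projection is linear. *)
Lemma quotient_relations : twisted_relations m br (@in_gring_ R n D)
  (fun u r => induced (a_op rho u r)) (fun X k => induced (x_op rho X k))
  (fun c r => induced (z_op rho c r)) (@phi_coef R n D) (@form_coef R n D).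
Proof.
have piB := @sq_piB _ _ T W; have piZ := @sq_piZ _ _ T W; have piD := @sq_piD _ _ T W.
split.
- by move=> u r /latticeP rG; exact/induced_linear/good_a.
- by move=> X k GX; exact/induced_linear/good_x.
- by move=> c r /latticeP rG; exact/induced_linear/good_z.
- move=> r w /latticeP rG c u u'; rewrite /induced a_op_u //.
  by apply: sq_pi_linear; apply: T_a => //; exact: T_repr.
- by move=> u w; rewrite /induced a_op0; exact: sq_pi0.
- move=> r w /latticeP rG c u u'; rewrite /induced z_op_c //.
  by apply: sq_pi_linear; apply: T_z => //; exact: T_repr.
- by move=> c w; rewrite /induced z_op0 //; exact: sq_pi0.
- by move=> k r X /latticeP rG; exact: in_gring_degD.
- by move=> k l X X'; exact: in_gring_deg_brk.
- move=> u v r s w /latticeP rG /latticeP sG; have rsG := latD rG sG.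
  have ga := good_a u rG; have gb := good_a v sG; have Tw := T_repr w.
  have Ta u' r' v' : lat r' -> T v' -> T (a_op rho u' r' v') by exact: T_a.
  have Tz := T_z (cvec R r) rsG Tw.
  have [Tar Tas] := (T_a u rG Tw, T_a v sG Tw).
  have [Tau Tav] := (T_a u rsG Tw, T_a v rsG Tw).
  rewrite !induced_comp // /induced /Vt_pi -!piB ?(a_a HD V_mod) //; first last.
  - exact: T_a.
  - exact: T_a.
  rewrite [LHS]piD; [|by solve_ss..]; rewrite [X in X + _ = _]piB; [|by solve_ss..].
  by rewrite !piZ; [|by solve_ss..].
- move=> u r X k w /latticeP rG GX; have GX' := in_gring_degD rG GX; have Tw := T_repr w.
  have ga := good_a u rG; have gb := good_x GX.
  have [Tx Tx'] := (T_x GX Tw, T_x GX' Tw); have Ta := T_a u rG Tw.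
  rewrite !induced_comp // /induced /Vt_pi -!piB //; [|exact: T_a|exact: T_x].
  by rewrite (a_x HD V_mod) // piZ; last by solve_ss.
- move=> X X' k l w GX GX'; have Tw := T_repr w; have GXX := in_gring_deg_brk GX GX'.
  have ga := good_x GX; have gb := good_x GX'.
  have [Tx Tx'] := (T_x GX Tw, T_x GX' Tw).
  rewrite !induced_comp // /induced /Vt_pi -!piB //; [|exact: T_x|exact: T_x].
  rewrite (x_x HD V_mod) // /form_coef -cons0D; case: ifP => klG; last by rewrite !scale0r !addr0.
  have [Tb Tz] := (T_x GXX Tw, T_z (cvec R k) klG Tw).
  by rewrite [LHS]piD; [|by solve_ss..]; rewrite piZ; last by solve_ss.
- move=> X X' k l; rewrite /form_coef -cons0D; case: ifP => [klG _|_]; last by rewrite eqxx.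
  exact/latticeP.
- move=> u s c r w /latticeP sG /latticeP rG; have rsG := latD rG sG; have Tw := T_repr w.
  have ga := good_a u sG; have gb := good_z c rG.
  have [Tz Ta] := (T_z c rG Tw, T_a u sG Tw).
  have [Tz' Tz''] := (T_z c rsG Tw, T_z (cvec R s) rsG Tw).
  rewrite !induced_comp // /induced /Vt_pi -!piB //; [|exact: T_a|exact: T_z].
  rewrite (a_z HD V_mod) // [LHS]piD; [|by solve_ss..].
  by rewrite !piZ; [|by solve_ss..].
- move=> X k c r w GX /latticeP rG; rewrite !induced_comp;
  [|exact: good_z|exact: good_x..|exact: good_z].
  by congr pi; exact: (x_K HD V_mod).
- move=> c r c' r' w /latticeP rG /latticeP rG'; rewrite !induced_comp; [|exact: good_z..].
  by congr pi; exact: (K_K HD V_mod).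
Qed.

End QuotientOperators.

(** * Finite dimensionality *)

Section FiniteDimension.
Variables (F : fieldType) (U : lmodType F).
Implicit Types A : set U.

Lemma finite_dim_seq A : finite_dim A <-> exists s : seq U, forall v, A v -> lspan [set` s] v.
Proof.
split=> [[k [b bP]]|[s sP]].
  exists [seq b i | i : 'I_k] => v /bP[c ->]; apply: ss_sum => i _; apply: ssZ.
  by apply: sub_lspan; apply/mapP; exists i; rewrite ?mem_enum.
exists (size s), (tnth (in_tuple s)) => v /sP.
pose K v := exists c : 'I_(size s) -> F, v = \sum_i c i *: tnth (in_tuple s) i.
have Kc : K 0 /\ forall (c : F) u v, K u -> K v -> K (c *: u + v).
  split=> [|c u w [cu ->] [cw ->]].
    by exists (fun=> 0); rewrite big1 // => i _; rewrite scale0r.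
  exists (fun i => c * cu i + cw i); rewrite scaler_sumr -big_split.
  by apply: eq_bigr => i _; rewrite scalerDl scalerA.
apply: (lspan_sub (S := Subspace Kc)) => x /= xs.
have /tnthP[i ->] : x \in in_tuple s by [].
exists (fun j => (j == i)%:R); rewrite (bigD1 i) //= eqxx scale1r big1 ?addr0 //.
by move=> j /negPf->; rewrite scale0r.
Qed.

Lemma finite_dim_sub A B : (forall v, A v -> B v) -> finite_dim B -> finite_dim A.
Proof. by move=> AB [k [b bP]]; exists k, b => v /AB; exact: bP. Qed.

Lemma lspan_mono A B : (forall v, A v -> B v) -> forall v, lspan A v -> lspan B v.
Proof. by move=> AB; apply: lspan_sub => v Av; exact/sub_lspan/AB. Qed.

Lemma finite_dim_lspan_union (I : finType) (B : I -> set U) :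
  (forall i, finite_dim (B i)) -> finite_dim (lspan [set v | exists i, B i v]).
Proof.
move=> Bfd; have /choice[s sP] : forall i, exists s : seq U, forall v, B i v -> lspan [set` s] v.
  by move=> i; apply/finite_dim_seq.
apply/finite_dim_seq; exists (flatten [seq s i | i : I]).
apply: lspan_sub => v [i Biv]; apply: lspan_mono (sP i v Biv) => x /= xs.
by apply/flattenP; exists (s i) => //; apply/mapP; exists i; rewrite ?mem_enum.
Qed.

End FiniteDimension.

Section FiniteDimensionalQuotient.
Variables (R : realType) (n : nat) (D : datum R n) (HD : standing_assumptions D).
Local Notation C := R[i].
Local Notation g := (gg D).
Local Notation Zn := 'rV[int]_n.
Local Notation Cn := 'rV[C]_n.
Variables (V : lmodType C) (rho : tau D -> {linear V -> V}).
Hypothesis V_mod : tau_module rho.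
Hypothesis V_int : tau_integrable rho.
Variable C0 : C.
Hypothesis K0_act : forall v, rho (tK D 0 ord0) v = C0 *: v.
Hypothesis Ki_act : forall (i : 'I_n) v, rho (tK D 0 (lift ord0 i)) v = 0.
Local Notation lat r := (in_Gamma D (cons0 r)).
Local Notation T := (TV rho).
Local Notation W := (WV rho C0).
Local Notation U := (Vt rho C0).
Local Notation pi := (@Vt_pi _ _ D V rho C0).
Local Notation m := (fun j : 'I_n => sord D (lift ord0 j)).

(** The weight [la + sum_i k_i delta_i] with [i] from [1] to [n]. *)
Definition shift (la : Hdual D) (k : Zn) : Hdual D :=
  (la.1.1, la.1.2, la.2 + cons0 (cvec R k)).

Lemma shift0 la : shift la 0 = la.
Proof. by rewrite /shift cvec0 cons00 addr0; case: la => [[]]. Qed.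

Lemma shiftD la k l : shift (shift la k) l = shift la (k + l).
Proof. by rewrite /shift /= -addrA cvecD (linear_opD (@cons0_linear R n)). Qed.

Lemma K_scalar i : exists c : C, forall v, rho (tK D 0 i) v = c *: v.
Proof.
case: (unliftP ord0 i) => [j ->|->]; last by exists C0.
by exists 0 => v; rewrite Ki_act scale0r.
Qed.

Lemma weight_vector_linear la c u v : weight_vector rho la u -> weight_vector rho la v ->
  weight_vector rho la (c *: u + v).
Proof.
move=> [hu ku du] [hv kv dv].
by split=> [h|i|i]; rewrite linearP /= ?hu ?hv ?ku ?kv ?du ?dv scalerDr !scalerA [c * _]mulrC.
Qed.

Lemma weight_vector0 la : weight_vector rho la 0.
Proof. by split=> *; rewrite linear0 scaler0. Qed.

Lemma weight_vector_op la k x v : zero_fibre (cons0 k) x -> weight_vector rho la v ->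
  weight_vector rho (shift la k) (op rho (cons0 k) x v).
Proof.
move=> zx [hv kv dv]; have [_ hx _] := zx; split=> [h|i|i] /=.
- rewrite -[LHS]/(op rho 0 (vsval h, 0, 0) (op rho (cons0 k) x v)).
  rewrite (op_h0_comm HD V_mod _ _ zx); last exact: subvsP.
  by rewrite -[op rho 0 _ v]/(rho (tX 0 (vsval h)) v) hv (linear_opZ (@op_linear _ _ _ _ rho _ _)).
- have [c cE] := K_scalar i.
  by rewrite cE -(linear_opZ (@op_linear _ _ _ _ rho _ _)) -cE kv (linear_opZ (@op_linear _ _ _ _
    rho _ _)).
- have := op_d_comm HD V_mod i v hx => /eqP; rewrite subr_eq => /eqP.
  rewrite -[op rho 0 _ (op _ _ _ _)]/(rho (td D 0 i) (op rho (cons0 k) x v)) => ->.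
  rewrite -[op rho 0 _ v]/(rho (td D 0 i) v) dv (linear_opZ (@op_linear _ _ _ _ rho _ _)).
  by rewrite -scalerDl addrC -cvec_cons0 !mxE.
Qed.

Definition T_weight la : set V := [set v | T v /\ weight_vector rho la v].

Lemma T_weight_closed la : T_weight la 0 /\
  forall (c : C) u v, T_weight la u -> T_weight la v -> T_weight la (c *: u + v).
Proof.
split=> [|c u v [Tu wu] [Tv wv]]; first by split; [exact: ss0|exact: weight_vector0].
by split; [exact: ssP|exact: weight_vector_linear].
Qed.

Lemma T_weight_pi_finite_dim la : finite_dim (pi @` T_weight la).
Proof.
have [_ wfd _] := V_int.
(* The spanning family of the weight space is replaced by one inside [T], where the projection is
   linear. *)
have : finite_dim (Subspace (T_weight_closed la)) by apply: finite_dim_sub (wfd la) => v [].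
move=> /finite_dim_basis[k [b [Tb bP]]]; exists k, (fun i => pi (b i)).
move=> _ [v Tv <-]; have [c ->] := bP v Tv; exists c.
rewrite /Vt_pi sq_pi_sum => [|i _]; last by apply: ssZ; case: (Tb i).
by apply: eq_bigr => i _; rewrite sq_piZ //; case: (Tb i).
Qed.

(** [T] is stable under [H], hence contains the weight components of its elements. *)
Lemma T_weight_decomposition t : T t -> exists (s : seq (Hdual D)) (E : Hdual D -> V),
  t = \sum_(la <- s) E la /\ forall la, la \in s -> T_weight la (E la).
Proof.
move=> Tt; have [/(_ t)[s [sw tE]] _ _] := V_int.
(* The weight is made a function of the vector, to serve as the key by which the terms of the sum
   are collected; distinct keys are then distinct weights. *)
have /choice[wt wtP] : forall v : V, exists la, (exists la', weight_vector rho la' v) ->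
    weight_vector rho la v.
  move=> v; have [[la wla]|no] := pselect (exists la', weight_vector rho la' v).
    by exists la.
  by exists 0 => ex; case: no.
pose key (p : C * V) := wt p.2.
pose E la := \sum_(p <- s | key p == la) p.1 *: p.2.
have wE la : weight_vector rho la (E la).
  have -> : E la = \sum_(p <- s | (p \in s) && (key p == la)) p.1 *: p.2.
    by rewrite /E big_seq_cond.
  apply: (big_ind (weight_vector rho la)) => [|x y wx wy|p /andP[ps /eqP<-]].
  - exact: weight_vector0.
  - by rewrite -[x]scale1r; exact: weight_vector_linear.
  - rewrite -[_ *: _]addr0; apply: weight_vector_linear; last exact: weight_vector0.
    by apply: wtP; exact: (sw p ps).
have tE' : t = \sum_(la <- undup (map key s)) E la by rewrite tE (sum_by_key _ key).
exists (undup (map key s)), E; split=> // la las; split=> //.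
pose f (h : subvs_of (h0 D) + 'I_n.+1 + 'I_n.+1) : V -> V := match h with
  | inl (inl x) => rho (tX 0 (vsval x)) | inl (inr i) => rho (tK D 0 i) | inr i
    => rho (td D 0 i) end.
pose chi (la : Hdual D) (h : subvs_of (h0 D) + 'I_n.+1 + 'I_n.+1) : C := match h with
  | inl (inl x) => la.1.1 x | inl (inr i) => la.1.2 0 i | inr i => la.2 0 i end.
apply: (@joint_eigenvectors _ _ _ _ f chi T _ _ (undup (map key s)) E) => //.
- by move=> [[x|i]|i] c u v; rewrite /f linearP.
- move=> [[x|i]|i] v Tv /=; first exact: (TV_h0 HD V_mod (subvsP x)).
    by have [c ->] := K_scalar i; exact: (ssZ (S := T)).
  apply: (TV_op HD V_mod (k := 0) (x := (0, 0, delta_mx 0 i))) => //.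
  by split=> [||h _]; [rewrite mxE|apply: hat_fibre_Kd; exact: in_Gamma0|exact: brk0r].
- exact: undup_uniq.
- move=> [[a b] c] [[a' b'] c'] _ _ ne; apply: contrapT => no; move/eqP: ne; apply.
  have eqchi h : chi (a, b, c) h = chi (a', b', c') h.
    by apply: contrapT => e; apply: no; exists h.
  congr (_, _, _).
  + by apply/lfunP => x; exact: (eqchi (inl (inl x))).
  + by apply/rowP => i; exact: (eqchi (inl (inr i))).
  + by apply/rowP => i; exact: (eqchi (inr i)).
- move=> w [[x|i]|i] _; have [hw kw dw] := wE w; [exact: hw|exact: kw|exact: dw].
- by rewrite -tE'.
Qed.

Lemma pi_t s v : lat s -> T v -> pi (t_op rho C0 s v) = pi v.
Proof. by move=> sG Tv; apply: sq_pi_eq => //; [exact: T_t|exact: W_gen]. Qed.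

Lemma finite_dim_stable (v : U) : exists N : subspace U, [/\ finite_dim N, N v,
  forall u r w, lat r -> N w -> N (induced (C0 := C0) (a_op rho u r) w) &
  forall X k w, in_gring_ k X -> N w -> N (induced (C0 := C0) (x_op rho X k) w)].
Proof.
have [s [E [vE wE]]] := T_weight_decomposition (T_repr v).
pose gen : set U := [set w | exists la k, la \in s /\ (pi @` T_weight (shift la k)) w].
pose N := lspan gen.
have Nind (f : V -> V) : good rho C0 f ->
    (forall la k t, T_weight (shift la k) t -> la \in s -> N (pi (f t))) ->
    forall w, N w -> N (induced (C0 := C0) f w).
  move=> gf fN; have fl := induced_linear gf.
  have Kc : N (induced f 0) /\ forall (c : C) x y, N (induced f x) -> N (induced f y) ->
      N (induced (C0 := C0) f (c *: x + y)).
    split=> [|c x y Nx Ny]; first by rewrite (linear_op0 fl); exact: ss0.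
    by rewrite fl; exact: ssP.
  apply: (lspan_sub (S := Subspace Kc)) => _ [la [k [las [t tw <-]]]] /=.
  by rewrite induced_pi //; [exact: fN tw las|case: tw].
have Nop la k r x t : la \in s -> zero_fibre (cons0 r) x -> T_weight (shift la k) t ->
    N (pi (op rho (cons0 r) x t)).
  move=> las zx [Tt wt]; apply: sub_lspan; exists la, (k + r); split=> //.
  exists (op rho (cons0 r) x t) => //; split; first exact: (TV_op HD V_mod zx).
  by rewrite -shiftD; exact: weight_vector_op.
exists N; split.
(* [B] bounds all the orders [m j], so the residues of [k] range over one finite type. With [r] the
   part of [k] in [Gamma], [t^(-r)] moves a vector to the weight of the residue without changing its
   class modulo [W]. *)
- pose B := (\sum_j m j)%N.
  pose box (f : {ffun 'I_n -> 'I_B.+1}) : Zn := \row_j (f j : nat)%:Z.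
  pose I := (seq_sub s * {ffun 'I_n -> 'I_B.+1})%type.
  pose Bs (i : I) : set U := pi @` T_weight (shift (val i.1) (box i.2)).
  have : finite_dim (lspan [set w | exists i, Bs i w]).
    by apply: finite_dim_lspan_union => i; exact: T_weight_pi_finite_dim.
  apply: finite_dim_sub; apply: lspan_mono => _ [la [k [las [t [Tt wt] <-]]]].
  pose f : {ffun 'I_n -> 'I_B.+1} := [ffun j => inord `|((k 0 j)%R %% (m j)%:Z)%Z|%N].
  have m0 j : 0 < (m j)%:Z :> int by exact: (sa_ord_gt0 HD).
  have fE j : (f j : nat)%:Z = ((k 0 j)%R %% (m j)%:Z)%Z.
    have x0 : 0 <= ((k 0 j)%R %% (m j)%:Z)%Z by rewrite modz_ge0 // gt_eqF.
    have xm : ((k 0 j)%R %% (m j)%:Z)%Z < (m j)%:Z by exact: ltz_pmod.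
    rewrite ffunE inordK ?gez0_abs // ltnS ltnW // -ltz_nat gez0_abs //.
    by apply: lt_le_trans xm _; rewrite lez_nat /B (bigD1 j) //= leq_addr.
  pose r : Zn := \row_j (((k 0 j)%R %/ (m j)%:Z)%Z * (m j)%:Z).
  have rG : lat (- r).
    apply/latticeP; exists (- \row_j ((k 0 j)%R %/ (m j)%:Z)%Z); apply/rowP => j.
    by rewrite !mxE mulNr.
  have kE : k - r = box f.
    by apply/rowP => j; rewrite !mxE fE {1}(divz_eq (k 0 j) (m j)%:Z) addrC addKr.
  exists (Sub la las, f); rewrite /Bs /=; exists (t_op rho C0 (- r) t).
    split; first exact: T_t.
    rewrite -kE -shiftD -[t_op _ _ _ _]addr0; apply: weight_vector_linear; last first.
      exact: weight_vector0.
    by apply: weight_vector_op => //; exact: zero_K.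
  exact: pi_t.
- rewrite -[v]sq_reprK vE big_seq sq_pi_sum => [|la las]; last by case: (wE la las).
  apply: ss_sum => la las; apply: sub_lspan; exists la, 0; split=> //.
  by exists (E la) => //; rewrite shift0; exact: wE.
- move=> u r w rG; apply: Nind; first exact: good_a.
  move=> la k t wt las; have [Tt _] := wt; rewrite /a_op /Vt_pi sq_piB; last 2 first.
  + exact: T_d.
  + exact: T_d (lat0 D) Tt.
  by apply: ssB; apply: (Nop la k) => //; apply: zero_d => //; exact: lat0.
move=> X k w GX; apply: Nind; first exact: good_x.
by move=> la l t wt las; apply: (Nop la l) => //; exact: zero_x.
Qed.

End FiniteDimensionalQuotient.

(** * Eigenvectors of an operator of finite order *)

Section FiniteOrder.
Variables (C : numFieldType) (E : lmodType C) (s : E -> E) (m : nat) (x : C).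
Hypotheses (m_gt0 : (0 < m)%N) (s_lin : linear_op s).
Hypotheses (s_order : forall v, iter m s v = v) (x_prim : m.-primitive_root x).

Lemma prim_root_sum t : (t < m)%N -> \sum_(l < m) x^-1 ^+ (l * t) = (m * (t == 0))%:R.
Proof.
move=> tm; have [->|t0] := eqVneq t 0%N.
  under eq_bigr => l _ do rewrite muln0 expr0.
  by rewrite sumr_const card_ord muln1.
rewrite muln0; under eq_bigr => l _ do rewrite mulnC exprM.
have y1 : x^-1 ^+ t - 1 != 0.
  rewrite subr_eq0 exprVn invr_eq1 -(prim_order_dvd x_prim).
  by apply: contraL tm => /dvdn_leq; rewrite lt0n -leqNgt; apply.
apply: (mulfI y1); rewrite mulr0 -subrX1 -exprM mulnC exprM.
by rewrite exprVn (prim_expr_order x_prim) invr1 expr1n subrr.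
Qed.

(** The projection to the eigenvalue [x ^+ l], as a discrete Fourier transform along the orbit of
    [v]. *)
Definition eigen_part (v : E) (l : nat) : E :=
  m%:R^-1 *: \sum_(t < m) x^-1 ^+ (l * t) *: iter t s v.

Lemma eigen_part_sum v : v = \sum_(l < m) eigen_part v l.
Proof.
rewrite -scaler_sumr exchange_big /=.
under eq_bigr => t _ do rewrite -scaler_suml prim_root_sum //.
case: m m_gt0 => // k _; rewrite big_ord_recl /= muln1 big1 => [|t _].
  by rewrite addr0 scalerA mulVf ?scale1r // pnatr_eq0.
by rewrite muln0 scale0r.
Qed.

Lemma eigen_partE v l : s (eigen_part v l) = x ^+ l *: eigen_part v l.
Proof.
have x0 : x != 0.
  apply/eqP => x0; have := prim_expr_order x_prim; rewrite x0 expr0n eqn0Ngt m_gt0 /= => /eqP.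
  by rewrite eq_sym oner_eq0.
rewrite /eigen_part (linear_opZ s_lin) (linear_op_sum s_lin) scalerA mulrC -scalerA.
congr (_ *: _); rewrite scaler_sumr.
transitivity (\sum_(t < m) x ^+ l *: (x^-1 ^+ (l * t.+1) *: iter t.+1 s v)).
  apply: eq_bigr => t _; rewrite (linear_opZ s_lin) scalerA mulnS exprD mulrA.
  by rewrite -exprMn mulfV // expr1n mul1r.
(* After the shift of index the last term wraps around to the first, as [s] and [x] both have [m]-th
   power one. *)
case: m m_gt0 s_order x_prim => // k _ sk xk.
rewrite big_ord_recr [RHS]big_ord_recl /= addrC; congr (_ + _).
have -> : s (iter k s v) = v by exact: sk.
by rewrite muln0 expr0 mulnC exprM exprVn (prim_expr_order xk) invr1 expr1n.
Qed.

Lemma eigen_part_in (S : subspace E) v l : (forall w, S w -> S (s w)) -> S v ->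
  S (eigen_part v l).
Proof.
move=> Ss Sv; apply: ssZ; apply: ss_sum => t _; apply: ssZ.
by elim: (t : nat) => //= k; exact: Ss.
Qed.

End FiniteOrder.

Lemma additive_coord (F : fieldType) (U : lmodType F) n (f : 'rV[int]_n -> U) :
  (forall q r, f (q + r) = f q + f r) ->
  forall q, f q = \sum_j (q 0 j)%:~R *: f (eps j).
Proof.
move=> fD; have f0 : f 0 = 0.
  by have /eqP := fD 0 0; rewrite addr0 -[X in X == _]addr0 (inj_eq (addrI _)) eq_sym => /eqP.
have fN q : f (- q) = - f q by apply/eqP; rewrite -addr_eq0 -fD addNr f0.
have fn j (k : nat) : f (k%:Z *: eps j) = k%:R *: f (eps j).
  elim: k => [|k IHk]; first by rewrite !scale0r f0.
  have -> : k.+1%:Z = k%:Z + 1 by rewrite -addn1.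
  by rewrite scalerDl scale1r fD IHk -natr1 scalerDl scale1r.
have fz j (k : int) : f (k *: eps j) = k%:~R *: f (eps j).
  by case: k => k; rewrite ?fn // NegzE scaleNr fN fn rmorphN scaleNr.
move=> q; rewrite {1}[q]row_sum_delta (big_morph f fD f0).
by apply: eq_bigr => j _; rewrite fz.
Qed.

(** * The algebra I + L(g) *)

Section LtElements.
Variables (R : realType) (n : nat) (D : datum R n) (HD : standing_assumptions D).
Local Notation C := R[i].
Local Notation g := (gg D).
Local Notation br := (@brk _ _ D).
Local Notation Zn := 'rV[int]_n.
Local Notation Cn := 'rV[C]_n.
Local Notation lat r := (in_Gamma D (cons0 r)).
Local Notation m := (fun j : 'I_n => sord D (lift ord0 j)).

Lemma sigma_linear i : linear_op (sigma D i).
Proof. by move=> c x y; rewrite linearP. Qed.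

Lemma in_gring_linear c (X X' : g) : in_gring X -> in_gring X' -> in_gring (c *: X + X').
Proof.
move=> [sX hX] [sX' hX']; split; first by rewrite linearP /= sX sX'.
by move=> h hh; rewrite brk_linr // hX // hX' // scaler0 addr0.
Qed.

Lemma in_gring0 : in_gring (0 : g).
Proof. by split=> [|h _]; [exact: linear0|exact: brk0r]. Qed.

Lemma in_gring_deg_linear k c (X X' : g) : in_gring_ k X -> in_gring_ k X' -> in_gring_ k (c *: X
  + X').
Proof.
move=> [GX sX] [GX' sX']; split=> [|j]; first exact: in_gring_linear.
by rewrite linearP /= sX sX' scalerDr !scalerA mulrC.
Qed.

Lemma in_gring_deg0 k : in_gring_ k (0 : g).
Proof. by split=> [|j]; [exact: in_gring0|rewrite linear0 scaler0]. Qed.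

Lemma in_gring_sigma j (X : g) : in_gring X -> in_gring (sigma D (lift ord0 j) X).
Proof.
move=> [sX hX]; split; first by rewrite (sa_comm HD) sX.
move=> h hh; have /gdegP/(_ (lift ord0 j)) := h0_gdeg0 HD hh.
by rewrite mxE expr0z scale1r => <-; rewrite -(sa_aut HD) hX // linear0.
Qed.

(** One automorphism at a time: [P q] asks for joint eigenvectors of the first [q], and splitting
    for the next one keeps these eigenvalues because the automorphisms commute. *)
Lemma in_gring_decomposition (X : g) : in_gring X -> exists s : seq (g * Zn),
  (forall p, p \in s -> in_gring_ p.2 p.1) /\ X = \sum_(p <- s) p.1.
Proof.
move=> GX; pose P q := exists s : seq (g * Zn), (forall p, p \in s -> in_gring p.1 /\
  forall j : 'I_n, (j < q)%N -> sigma D (lift ord0 j) p.1 = xi D (lift ord0 j) ^ p.2 0 j *: p.1) /\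
  X = \sum_(p <- s) p.1.
suff [s [sG XE]] : P n.
  by exists s; split=> // p /sG[Gp sp]; split=> // j; exact: sp.
suff H q : (q <= n)%N -> P q by exact: H.
elim: q => [_|q IHq qn].
  exists [:: (X, 0)]; rewrite big_seq1; split=> // p; rewrite inE => /eqP->.
  by split.
have [s [sG XE]] := IHq (ltnW qn); pose j := Ordinal qn; pose i := lift ord0 j.
have mi := sa_ord_gt0 HD i; have oi := sa_ord_id HD i; have xi_i := sa_xi HD i.
pose ep := eigen_part (sigma D i) (sord D i) (xi D i).
pose upd (k : Zn) (l : nat) : Zn := \row_j' (if j' == j then l%:Z else k 0 j').
exists [seq (ep p.1 l, upd p.2 l) | p <- s, l <- index_iota 0 (sord D i)]; split; last first.
  rewrite XE big_allpairs_dep big_seq [RHS]big_seq; apply: eq_bigr => p ps.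
  by rewrite /= big_mkord; exact: eigen_part_sum.
move=> _ /allpairsP[[p l] [ps _ ->]] /=; have [Gp sp] := sG p ps.
have Gc : in_gring (0 : g) /\ forall (c : C) (u v : g), in_gring u -> in_gring v ->
    in_gring (c *: u + v) by split; [exact: in_gring0|move=> c u v; exact: in_gring_linear].
split.
  apply: (@eigen_part_in _ _ _ _ _ (Subspace Gc)) => //= w.
  exact: in_gring_sigma.
move=> j' jq; rewrite mxE; case: eqP => [->|/eqP j'j].
  rewrite (eigen_partE mi (@sigma_linear i) oi xi_i) //.
have j'q : (j' < q)%N.
  by move: jq; rewrite ltnS leq_eqVlt => /orP[/eqP e|//]; case/eqP: j'j; exact: val_inj.
pose K (w : g) := sigma D (lift ord0 j') w = xi D (lift ord0 j') ^ p.2 0 j' *: w.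
have Kc : K 0 /\ forall (c : C) (u v : g), K u -> K v -> K (c *: u + v).
  split=> [|c u v Ku Kv]; first by rewrite /K linear0 scaler0.
  by rewrite /K linearP /= Ku Kv scalerDr !scalerA mulrC.
apply: (@eigen_part_in _ _ _ _ _ (Subspace Kc)); last exact: sp.
by move=> w /= Kw; rewrite /K (sa_comm HD) Kw linearZ.
Qed.

End LtElements.

Section LtAction.
Variables (R : realType) (n : nat) (D : datum R n) (HD : standing_assumptions D).
Local Notation C := R[i].
Local Notation g := (gg D).
Local Notation br := (@brk _ _ D).
Local Notation Zn := 'rV[int]_n.
Local Notation Cn := 'rV[C]_n.
Local Notation lat r := (in_Gamma D (cons0 r)).
Local Notation LF := (Zn -> L_fibre D).
Implicit Types (x y : LF) (X : g) (u : Cn) (k r : Zn).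

Lemma L_fibre_u_linear : linear_op (fun u : Cn => (u, 0) : L_fibre D).
Proof. by move=> c u v; congr (_, _); rewrite /= ?scaler0 ?addr0. Qed.

Lemma L_fibre_X_linear : linear_op (fun X : g => (0, X) : L_fibre D).
Proof. by move=> c u v; congr (_, _); rewrite /= ?scaler0 ?addr0. Qed.

Definition Xvec X k : LF := single_at k ((0, X) : L_fibre D).

Lemma Ivec_linear r : linear_op (fun u => Ivec D u r).
Proof.
move=> c u v; rewrite /Ivec (L_fibre_u_linear c u v) !(@single_at_linear _ _ (L_fibre D)).
by rewrite scalerBr opprD addrACA.
Qed.

Lemma Xvec_linear k : linear_op (Xvec^~ k).
Proof.
by move=> c X X'; rewrite /Xvec (L_fibre_X_linear c X X') (@single_at_linear _ _ (L_fibre D)).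
Qed.

Lemma Lt_Ivec u r : lat r -> Lt D (Ivec D u r).
Proof. by move=> rG; apply: sub_lspan; left; exists u, r. Qed.

Lemma Lt_Xvec X k : in_gring_ k X -> Lt D (Xvec X k).
Proof. by move=> GX; apply: sub_lspan; right; exists k, X. Qed.

Lemma Lt_decomposition x : Lt D x -> exists (s1 : seq (Cn * Zn)) (s2 : seq (g * Zn)),
  [/\ forall p, p \in s1 -> lat p.2, forall p, p \in s2 -> in_gring_ p.2 p.1 &
      x = \sum_(p <- s1) Ivec D p.1 p.2 + \sum_(p <- s2) Xvec p.1 p.2].
Proof.
pose K x := exists (s1 : seq (Cn * Zn)) (s2 : seq (g * Zn)),
  [/\ forall p, p \in s1 -> lat p.2, forall p, p \in s2 -> in_gring_ p.2 p.1 &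
      x = \sum_(p <- s1) Ivec D p.1 p.2 + \sum_(p <- s2) Xvec p.1 p.2].
have Kc : K 0 /\ forall (c : C) x y, K x -> K y -> K (c *: x + y).
  split=> [|c x' y' [s1 [s2 [h1 h2 ->]]] [t1 [t2 [k1 k2 ->]]]].
    by exists [::], [::]; split=> //; rewrite !big_nil addr0.
  exists ([seq (c *: p.1, p.2) | p <- s1] ++ t1), ([seq (c *: p.1, p.2) | p <- s2] ++ t2); split.
  - by move=> p; rewrite mem_cat => /orP[/mapP[q /h1 + ->]|/k1].
  - move=> p; rewrite mem_cat => /orP[/mapP[q /h2 hq ->]|/k2 //].
    by rewrite -[c *: q.1]addr0; apply: in_gring_deg_linear => //; exact: in_gring_deg0.
  - rewrite !big_cat !big_map /= scalerDr !scaler_sumr addrACA; congr (_ + _ + (_ + _)).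
      by apply: eq_bigr => p _; rewrite (linear_opZ (@Ivec_linear p.2)).
    by apply: eq_bigr => p _; rewrite (linear_opZ (@Xvec_linear p.2)).
apply: (lspan_sub (S := Subspace Kc)) => _ [[u [r [rG ->]]]|[k [X [GX ->]]]] /=.
  exists [:: (u, r)], [::]; rewrite big_seq1 big_nil addr0; split=> // p.
  by rewrite inE => /eqP->.
exists [::], [:: (X, k)]; rewrite big_seq1 big_nil add0r; split=> // p.
by rewrite inE => /eqP->.
Qed.

Lemma Lt_finitely_supported x : Lt D x -> finitely_supported x.
Proof.
apply: finitely_supported_lspan => _ [[u [r [_ ->]]]|[k [X [_ ->]]]]; last first.
  exact: finitely_supported_single.
rewrite /Ivec addrC -scaleN1r.
by apply: finitely_supported_linear; exact: finitely_supported_single.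
Qed.

Lemma Lt_quotE (A : {fset Zn}) x : (forall k, k \notin A -> x k = 0) ->
  Lt_quot x = (\sum_(r <- A) (cvec R r)^T *m (x r).1, \sum_(k <- A) (x k).2).
Proof.
move=> xA; congr (_, _); rewrite (fsbigTE A) // => k kA; rewrite xA //.
exact: mulmx0.
Qed.

Lemma Lt_quot_linear c x y : finitely_supported x -> finitely_supported y ->
  Lt_quot (c *: x + y) = c *: Lt_quot x + Lt_quot y.
Proof.
move=> [A xA] [B yB].
have xAB k : k \notin (A `|` B)%fset -> x k = 0 by rewrite inE negb_or => /andP[/xA].
have yAB k : k \notin (A `|` B)%fset -> y k = 0 by rewrite inE negb_or => /andP[_ /yB].
rewrite (Lt_quotE xAB) (Lt_quotE yAB) (@Lt_quotE (A `|` B)%fset); last first.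
  by move=> k kAB; rewrite !fctE xAB // yAB // scaler0 addr0.
congr (_, _); rewrite /= scaler_sumr -big_split; apply: eq_bigr => k _ //=.
by rewrite mulmxDr -scalemxAr.
Qed.

Lemma Lt_quot0 : Lt_quot (0 : LF) = 0.
Proof. by rewrite (@Lt_quotE fset0) // !big_seq_fset0. Qed.

Lemma Lt_quot_Ivec u r : Lt_quot (Ivec D u r) = ((cvec R r)^T *m u, 0).
Proof.
have fs k z : finitely_supported (single_at k z : LF) by exact: finitely_supported_single.
have single k u' : Lt_quot (single_at k ((u', 0) : L_fibre D)) = ((cvec R k)^T *m u', 0).
  rewrite (@Lt_quotE [fset k]%fset); last by move=> l; rewrite inE /single_at => /negPf->.
  by rewrite !big_seq_fset1 /single_at eqxx.
rewrite /Ivec addrC -scaleN1r Lt_quot_linear // !single cvec0 trmx0 mul0mx.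
by congr (_, _); rewrite /= ?scaler0 add0r.
Qed.

Lemma Lt_quot_Xvec X k : Lt_quot (Xvec X k) = (0, X).
Proof.
rewrite (@Lt_quotE [fset k]%fset); last by move=> l; rewrite inE /Xvec /single_at => /negPf->.
by rewrite !big_seq_fset1 /Xvec /single_at eqxx mulmx0.
Qed.

Lemma Lt_quot_sum (I : eqType) (s : seq I) (E : I -> LF) : (forall i, i \in s -> Lt D (E i)) ->
  Lt_quot (\sum_(i <- s) E i) = \sum_(i <- s) Lt_quot (E i).
Proof.
elim: s => [|i s IHs] LE; first by rewrite !big_nil Lt_quot0.
have LEs j : j \in s -> Lt D (E j) by move=> js; apply: LE; rewrite in_cons js orbT.
rewrite !big_cons -[E i]scale1r Lt_quot_linear ?scale1r ?IHs //.
  by apply/Lt_finitely_supported/LE; rewrite mem_head.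
by apply/Lt_finitely_supported/ss_sum_seq.
Qed.

Lemma Lt_quot_gring x : Lt D x -> gl_gring (Lt_quot x).
Proof.
move=> Lx; have [s1 [s2 [h1 h2 xE]]] := Lt_decomposition Lx.
have -> : Lt_quot x = \sum_(p <- s1) Lt_quot (Ivec D p.1 p.2)
  + \sum_(p <- s2) Lt_quot (Xvec p.1 p.2).
  rewrite xE -[X in Lt_quot (X + _)]scale1r Lt_quot_linear ?scale1r ?Lt_quot_sum //.
  - by move=> p /h2; exact: Lt_Xvec.
  - by move=> p /h1; exact: Lt_Ivec.
  - by apply/Lt_finitely_supported/ss_sum_seq => p /h1; exact: Lt_Ivec.
  - by apply/Lt_finitely_supported/ss_sum_seq => p /h2; exact: Lt_Xvec.
pose K (a : gl_g D) := gl_gring a.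
have K1 (a b : gl_g D) : K a -> K b -> K (a + b).
  by rewrite /K /gl_gring /= => ha hb; rewrite -[a.2]scale1r; exact: in_gring_linear.
have K0 : K 0 by exact: in_gring0.
apply: (K1 _ _); rewrite big_seq; apply: (big_ind K K0 K1) => p ps.
  by rewrite Lt_quot_Ivec; exact: in_gring0.
by rewrite Lt_quot_Xvec; case: (h2 p ps).
Qed.

Section Action.
Variables (V : lmodType C) (rho : tau D -> {linear V -> V}).
Hypothesis V_mod : tau_module rho.
Variable C0 : C.
Local Notation T := (TV rho).
Local Notation W := (WV rho C0).
Local Notation U := (Vt rho C0).

(** The representative of [to_tau x], named because it is linear in [x] everywhere, while the class
    map is linear only on [tau_hat]. *)
Definition to_tau_fun x : tau_fun D := fun k : 'rV[int]_n.+1 =>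
  if k 0 ord0 == 0 then let: (u, X) := x (tail0 k) in ((X, 0, cons0 u) : fibre D) else 0.

Lemma to_tau_fun_linear : linear_op to_tau_fun.
Proof.
move=> c x y; apply: funext => k; rewrite !fctE /to_tau_fun; case: eqP => _.
  case: (x _) => u X; case: (y _) => v Y.
  by congr (_, _, _); rewrite /= ?scaler0 ?addr0 //; exact: cons0_linear.
by rewrite scaler0 addr0.
Qed.

Lemma to_tau_fun_single k u X :
  to_tau_fun (single_at k ((u, X) : L_fibre D)) = single_at (cons0 k) ((X, 0, cons0 u) : fibre D).
Proof.
apply: funext => l; rewrite /to_tau_fun /single_at; case: eqP => [l0|/eqP l0]; last first.
  by case: (l =P cons0 k) l0 => [->|//]; rewrite cons0_0E.
have -> : (l == cons0 k) = (tail0 l == k).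
  by apply/eqP/eqP => [->|<-]; [exact: cons0K|rewrite tail0K].
by case: eqP => // _; congr (_, _, _); exact: cons00.
Qed.

Lemma tau_hat_Ivec u r : lat r -> tau_hat D (to_tau_fun (Ivec D u r)).
Proof.
move=> rG; rewrite /Ivec (linear_opB to_tau_fun_linear) !to_tau_fun_single.
by apply: ssB; apply: tau_hat_single; apply: hat_d => //; exact: lat0.
Qed.

Lemma tau_hat_Xvec X k : in_gring_ k X -> tau_hat D (to_tau_fun (Xvec X k)).
Proof.
move=> GX; rewrite /Xvec to_tau_fun_single cons00; apply: tau_hat_single.
exact/hat_fibre_X/in_gring_gdeg.
Qed.

Lemma rho_Ivec u r v : lat r -> rho (to_tau (Ivec D u r)) v = a_op rho u r v.
Proof.
move=> rG; rewrite -[to_tau _]/(tau_pi (to_tau_fun (Ivec D u r))) /Ivec.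
rewrite (linear_opB to_tau_fun_linear) !to_tau_fun_single addrC -scaleN1r tau_pi_linear.
- by rewrite (rho_linear V_mod) scaleN1r addrC.
- by apply: tau_hat_single; apply: hat_d; exact: lat0.
- by apply: tau_hat_single; exact: hat_d.
Qed.

Lemma rho_Xvec X k v : rho (to_tau (Xvec X k)) v = x_op rho X k v.
Proof.
rewrite -[to_tau _]/(tau_pi (to_tau_fun (Xvec X k))) /Xvec to_tau_fun_single cons00.
by [].
Qed.

Lemma good_Lt x : Lt D x -> tau_hat D (to_tau_fun x) /\ good rho C0 (rho (to_tau x)).
Proof.
have tE y : to_tau y = tau_pi (to_tau_fun y) by [].
have rl y : linear_op (rho (to_tau y)) by move=> c u v; rewrite linearP.
pose K x := tau_hat D (to_tau_fun x) /\ good rho C0 (rho (to_tau x)).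
have Kc : K 0 /\ forall (c : C) x y, K x -> K y -> K (c *: x + y).
  split=> [|c x' y [hx [_ xT xW]] [hy [_ yT yW]]].
    have h0 : tau_hat D (to_tau_fun 0) by rewrite (linear_op0 to_tau_fun_linear); exact: ss0.
    split=> //; split=> // v _;
      rewrite tE (linear_op0 to_tau_fun_linear) /tau_pi sq_pi0 (rho0 V_mod);
      exact: ss0.
  split; first by rewrite to_tau_fun_linear; exact: ssP.
  split=> // v hv; rewrite tE to_tau_fun_linear tau_pi_linear // (rho_linear V_mod); apply: ssP;
    rewrite -tE; [exact: xT|exact: yT|exact: xW|exact: yW].
apply: (lspan_sub (S := Subspace Kc)) => _ [[u [r [rG ->]]]|[k [X [GX ->]]]] /=.
  split; first exact: tau_hat_Ivec.
  have -> : (rho (to_tau (Ivec D u r)) : V -> V) = a_op rho u r.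
    by apply: funext => v; exact: rho_Ivec.
  exact: good_a.
split; first exact: tau_hat_Xvec.
have -> : (rho (to_tau (Xvec X k)) : V -> V) = x_op rho X k.
  by apply: funext => v; exact: rho_Xvec.
exact: good_x.
Qed.

Lemma Lt_act_linear x : Lt D x -> linear_op (Lt_act x : U -> U).
Proof. by move=> /good_Lt[_ gx]; exact: induced_linear gx. Qed.

Lemma Lt_act_x c x y (w : U) : Lt D x -> Lt D y ->
  Lt_act (c *: x + y) w = c *: Lt_act x w + Lt_act y w.
Proof.
move=> /good_Lt[hx [_ xT _]] /good_Lt[hy [_ yT _]].
rewrite /Lt_act -[to_tau (_ + _)]/(tau_pi (to_tau_fun (c *: x + y))) to_tau_fun_linear.
rewrite tau_pi_linear // (rho_linear V_mod); apply: sq_pi_linear.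
  exact: (xT _ (T_repr w)).
exact: (yT _ (T_repr w)).
Qed.

Lemma Lt_act_Ivec u r (w : U) : lat r -> Lt_act (Ivec D u r) w = induced (a_op rho u r) w.
Proof. by move=> rG; rewrite /Lt_act /induced rho_Ivec. Qed.

Lemma Lt_act_Xvec X k (w : U) : Lt_act (Xvec X k) w = induced (x_op rho X k) w.
Proof. by rewrite /Lt_act /induced rho_Xvec. Qed.

Lemma Lt_act0 (w : U) : Lt_act (0 : LF) w = 0.
Proof.
have := @Lt_act_x (-1) 0 0 w (ss0 _) (ss0 _).
by rewrite scaler0 addr0 scaleN1r addNr.
Qed.

Lemma Lt_act_sum (I : eqType) (s : seq I) (E : I -> LF) (w : U) :
  (forall i, i \in s -> Lt D (E i)) ->
  Lt_act (\sum_(i <- s) E i) w = \sum_(i <- s) Lt_act (E i) w.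
Proof.
elim: s => [|i s IHs] LE; first by rewrite !big_nil Lt_act0.
have LEs j : j \in s -> Lt D (E j) by move=> js; apply: LE; rewrite in_cons js orbT.
rewrite !big_cons -[E i]scale1r Lt_act_x ?scale1r ?IHs //; last exact: ss_sum_seq.
by apply: LE; rewrite mem_head.
Qed.

End Action.
End LtAction.

(** * Irreducible submodules of T/W *)

Section IrreducibleQuotient.
Variables (R : realType) (n : nat) (n_gt0 : (0 < n)%N).
Variables (D : datum R n) (HD : standing_assumptions D).
Local Notation C := R[i].
Local Notation g := (gg D).
Local Notation br := (@brk _ _ D).
Local Notation Zn := 'rV[int]_n.
Local Notation Cn := 'rV[C]_n.
Local Notation lat r := (in_Gamma D (cons0 r)).
Local Notation m := (fun j : 'I_n => sord D (lift ord0 j)).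
Variables (V : lmodType C) (rho : tau D -> {linear V -> V}).
Hypotheses (V_mod : tau_module rho) (V_int : tau_integrable rho).
Variable C0 : C.
Hypothesis K0_act : forall v, rho (tK D 0 ord0) v = C0 *: v.
Hypothesis Ki_act : forall (i : 'I_n) v, rho (tK D 0 (lift ord0 i)) v = 0.
Local Notation U := (Vt rho C0).
Variable M : subspace U.
Hypothesis M_irr : irreducible_on (Lt D) M Lt_act.

Local Notation A := (fun u r => induced (C0 := C0) (a_op rho u r)).
Local Notation Y := (fun X k => induced (C0 := C0) (x_op rho X k)).

Let TR := quotient_relations HD V_mod C0 Ki_act.

Lemma M_a u r w : lattice m r -> M w -> M (A u r w).
Proof.
move=> /latticeP rG Mw; rewrite -(Lt_act_Ivec V_mod) //; case: M_irr => _ st _.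
by apply: st => //; exact: Lt_Ivec.
Qed.

Lemma M_x X k w : in_gring_ k X -> M w -> M (Y X k w).
Proof.
move=> GX Mw; rewrite /= -Lt_act_Xvec; case: M_irr => _ st _.
by apply: st => //; exact: Lt_Xvec.
Qed.

Lemma Lt_act_decomposition (s1 : seq (Cn * Zn)) (s2 : seq (g * Zn)) (w : U) :
  (forall p, p \in s1 -> lat p.2) -> (forall p, p \in s2 -> in_gring_ p.2 p.1) ->
  Lt_act (\sum_(p <- s1) Ivec D p.1 p.2 + \sum_(p <- s2) Xvec p.1 p.2) w =
  \sum_(p <- s1) A p.1 p.2 w + \sum_(p <- s2) Y p.1 p.2 w.
Proof.
move=> h1 h2.
have L1 p : p \in s1 -> Lt D (Ivec D p.1 p.2) by move=> /h1; exact: Lt_Ivec.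
have L2 p : p \in s2 -> Lt D (Xvec p.1 p.2) by move=> /h2; exact: Lt_Xvec.
rewrite -[X in Lt_act (X + _)]scale1r (Lt_act_x HD V_mod); [|exact: ss_sum_seq..].
rewrite scale1r !(Lt_act_sum HD V_mod) //; congr (_ + _); last first.
  by apply: eq_bigr => p _; exact: Lt_act_Xvec.
by rewrite big_seq [RHS]big_seq; apply: eq_bigr => p /h1 pG; rewrite (Lt_act_Ivec V_mod).
Qed.

Lemma M_generated (K : subspace U) :
  (forall u r w, lattice m r -> K w -> M w -> K (A u r w)) ->
  (forall X k w, in_gring_ k X -> K w -> M w -> K (Y X k w)) ->
  (exists2 w, M w /\ K w & w != 0) -> forall w, M w -> K w.
Proof.
move=> KA KY [w0 [Mw0 Kw0] w00].
have MKc : (M 0 /\ K 0) /\ forall (c : C) u v, M u /\ K u -> M v /\ K v ->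
    M (c *: u + v) /\ K (c *: u + v).
  split=> [|c u v [Mu Ku] [Mv Kv]]; first by split; exact: ss0.
  by split; exact: ssP.
have [_ _ /(_ (@Subspace _ _ (fun v => M v /\ K v) MKc))[]] := M_irr.
- by move=> v [].
- move=> x v Lx [Mv Kv]; have [s1 [s2 [h1 h2 ->]]] := Lt_decomposition HD Lx.
  rewrite Lt_act_decomposition //; split; apply: ssD; apply: ss_sum_seq => p ps.
  + by apply: M_a => //; apply/latticeP; exact: h1.
  + by apply: M_x => //; exact: h2.
  + by apply: KA => //; apply/latticeP; exact: h1.
  + by apply: KY => //; exact: h2.
- by move=> /(_ w0 (conj Mw0 Kw0)) w0E; rewrite w0E eqxx in w00.
- by move=> h w /h[].
Qed.

Lemma M_neq0 : exists2 w, M w & w != 0.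
Proof. by case: M_irr. Qed.

Lemma M_finite_dim : finite_dim M.
Proof.
have [w Mw w0] := M_neq0.
have [N [Nfd Nw NA NY]] := finite_dim_stable HD V_mod V_int K0_act Ki_act w.
apply: finite_dim_sub Nfd; apply: M_generated; last by exists w.
- by move=> u r v /latticeP rG Nv _; exact: NA.
- by move=> X k v GX Nv _; exact: NY.
Qed.

Lemma m_gt0 i : (0 < m i)%N.
Proof. exact: (sa_ord_gt0 HD). Qed.

Lemma M_jet v : M v -> jet m (@in_gring_ R n D) A Y v.
Proof.
exact: (jet_all n_gt0 m_gt0 TR M_generated M_a M_x M_finite_dim M_neq0).
Qed.

Lemma xi_periodic (j : 'I_n) (d : int) : xi D (lift ord0 j) ^ d = 1 -> ((m j)%:Z %| d)%Z.
Proof.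
have xj := sa_xi HD (lift ord0 j).
case: d => d /eqP e; rewrite dvdzE /= (prim_order_dvd xj) //.
by rewrite NegzE -exprnN invr_eq1 in e.
Qed.

(** On a jet, [A u r w] is linear in [u] and additive in [r], so it depends only on the matrix
    [r^T u]. [Psi] is the resulting linear map, read off at the exponents [m_j e_j]. *)
Lemma kernel_I (s : seq (Cn * Zn)) w : M w -> (forall p, p \in s -> lat p.2) ->
  \sum_(p <- s) (cvec R p.2)^T *m p.1 = 0 -> \sum_(p <- s) A p.1 p.2 w = 0.
Proof.
move=> Mw sG s0; have [wA _] := M_jet Mw.
have lde j : lattice m (dilate m (eps j)) by eexists.
pose Psi (B : 'M[C]_n) := \sum_j A ((m j)%:R^-1 *: row j B) (dilate m (eps j)) w.
have Psi_lin : linear_op Psi.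
  move=> c B B'; rewrite /Psi scaler_sumr -big_split; apply: eq_bigr => j _ /=.
  rewrite -(tr_A TR w (lde j)) linearP scalerDr !scalerA mulrC.
  by [].
suff AE p : p \in s -> A p.1 p.2 w = Psi ((cvec R p.2)^T *m p.1).
  by rewrite (eq_big_seq _ AE) -(linear_op_sum Psi_lin) s0 (linear_op0 Psi_lin).
case: p => u r /= /sG /= /latticeP[q ->].
have := @additive_coord _ U n (fun q => A u (dilate m q) w).
move=> ->; last by move=> q' q''; rewrite dilateD; apply: wA; eexists.
apply: eq_bigr => j _; rewrite -(linear_opZ (tr_A TR w (lde j))); congr (induced (a_op rho _ _) w).
apply/rowP => l; rewrite !mxE big_ord1 !mxE intrM [_ * _%:~R]mulrC -mulrA -pmulrn mulKf //.
by rewrite pnatr_eq0 -lt0n m_gt0.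
Qed.

(** The terms are grouped by the joint eigenvalues of the [sigma_j], which determine [k] modulo
    [Gamma]. Each group of elements sums to zero by independence of eigenvectors, and on a jet all
    degrees in a group can be replaced by one [p0.2], where the action is linear in the element. *)
Lemma kernel_X (s : seq (g * Zn)) w : M w -> (forall p, p \in s -> in_gring_ p.2 p.1) ->
  \sum_(p <- s) p.1 = 0 -> \sum_(p <- s) Y p.1 p.2 w = 0.
Proof.
move=> Mw sG s0; have [_ wY] := M_jet Mw.
pose key (p : g * Zn) : Cn := \row_j xi D (lift ord0 j) ^ p.2 0 j.
have Ykey X k k' : in_gring_ k X -> key (X, k) = key (X, k') -> Y X k' w = Y X k w.
  move=> GX /rowP e; have kk : k' = k + (k' - k) by rewrite addrC subrK.
  rewrite [in LHS]kk; apply: wY; first exact: GX.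
  apply/latticeP/in_GammaP => i; case: (unliftP ord0 i) => [j ->|->]; last first.
    by rewrite cons0_0E dvdz0.
  rewrite cons0_liftE; apply: xi_periodic; rewrite !mxE expfzDr ?xi_neq0 //.
  by have := e j; rewrite !mxE /= => <-; rewrite -expfzDr ?xi_neq0 // subrr expr0z.
pose E (c : Cn) := \sum_(p <- s | key p == c) p.1.
have Es c : E c = \sum_(p <- s | (p \in s) && (key p == c)) p.1 by rewrite /E big_seq_cond.
have sE c j : sigma D (lift ord0 j) (E c) = c 0 j *: E c.
  rewrite Es (linear_op_sum (@sigma_linear _ _ D (lift ord0 j))) scaler_sumr;
    apply: eq_bigr => p /andP[ps /eqP<-].
  by rewrite mxE; case: (sG p ps) => _ ->.
pose keys := undup [seq key p | p <- s].
have E0 c : c \in keys -> E c = 0.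
  move=> ck; have Zc : (0 : g) = 0 /\ forall (a : C) (u v : g), u = 0 -> v = 0 -> a *: u + v = 0.
    by split=> // a u v -> ->; rewrite scaler0 addr0.
  apply: (@joint_eigenvectors _ _ _ _ (fun j => sigma D (lift ord0 j))
    (fun (c : Cn) j => c 0 j) (@Subspace _ _ (fun v : g => v = 0) Zc) _ _ keys E) ck.
  - by move=> j; exact: sigma_linear.
  - by move=> j v /= ->; exact: linear0.
  - exact: undup_uniq.
  - move=> c1 c2 _ _ ne; apply: contrapT => no; move/eqP: ne; apply; apply/rowP => j.
    by apply: contrapT => e; apply: no; exists j.
  - by move=> c1 j _; exact: sE.
  - by rewrite /= -sum_by_key.
rewrite (sum_by_key _ key) big_seq big1 // => c ck.
have [p0 ps0 cE] : exists2 p0, p0 \in s & c = key p0.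
  by move: ck; rewrite mem_undup => /mapP[p0 ps0 ->]; exists p0.
have Gk p : p \in s -> key p == c -> in_gring_ p0.2 p.1.
  move=> ps /eqP pc; have [Gp sp] := sG p ps; split=> // j.
  have /rowP/(_ j) : key p = key p0 by rewrite pc cE.
  by rewrite sp !mxE => ->.
have x_lin k : forall (s' : seq (g * Zn)), (forall p, p \in s' -> in_gring_ k p.1) ->
    in_gring_ k (\sum_(p <- s') p.1) /\
    \sum_(p <- s') Y p.1 k w = Y (\sum_(p <- s') p.1) k w.
  have act p : Lt_act (Xvec p k) w = Y p k w by exact: Lt_act_Xvec.
  elim=> [|p s' IHs] hs.
    rewrite !big_nil; split; first exact: in_gring_deg0.
    by rewrite -act (linear_op0 (@Xvec_linear _ _ D k)) (Lt_act0 HD V_mod).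
  have [|h1 h2] := IHs; first by move=> q qs; apply: hs; rewrite in_cons qs orbT.
  have hp : in_gring_ k p.1 by apply: hs; rewrite mem_head.
  rewrite !big_cons h2 -[X in X + \sum_(_ <- _) _.1]scale1r; split;
    first exact: in_gring_deg_linear.
  rewrite -!act (Xvec_linear k 1) (Lt_act_x HD V_mod) ?scale1r //; exact: Lt_Xvec.
rewrite -big_filter; set s' := [seq p <- s | key p == c].
have hs' p : p \in s' -> in_gring_ p0.2 p.1.
  by rewrite mem_filter => /andP[pc ps]; exact: Gk.
have -> : \sum_(p <- s') Y p.1 p.2 w = \sum_(p <- s') Y p.1 p0.2 w.
  apply: eq_big_seq => p ps'; have := ps'; rewrite mem_filter => /andP[/eqP pc ps].
  by apply: Ykey; [exact: hs'|rewrite -[RHS]/(key p) pc cE].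
have [_ ->] := x_lin p0.2 s' hs'.
have -> : \sum_(p <- s') p.1 = E c by rewrite /s' big_filter.
(* The empty sum yields that the loop [0] acts by zero. *)
rewrite E0 //; have [|_] := x_lin p0.2 [::]; first by [].
by rewrite !big_nil => <-.
Qed.

Lemma Lt_quot_decomposition (s1 : seq (Cn * Zn)) (s2 : seq (g * Zn)) :
  (forall p, p \in s1 -> lat p.2) -> (forall p, p \in s2 -> in_gring_ p.2 p.1) ->
  Lt_quot (\sum_(p <- s1) Ivec D p.1 p.2 + \sum_(p <- s2) Xvec p.1 p.2) =
  (\sum_(p <- s1) (cvec R p.2)^T *m p.1, \sum_(p <- s2) p.1).
Proof.
move=> h1 h2.
have L1 p : p \in s1 -> Lt D (Ivec D p.1 p.2) by move=> /h1; exact: Lt_Ivec.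
have L2 p : p \in s2 -> Lt D (Xvec p.1 p.2) by move=> /h2; exact: Lt_Xvec.
rewrite -[X in Lt_quot (X + _)]scale1r Lt_quot_linear; last 2 first.
- by apply: Lt_finitely_supported; exact: ss_sum_seq.
- by apply: Lt_finitely_supported; exact: ss_sum_seq.
rewrite scale1r !Lt_quot_sum //.
under eq_bigr do rewrite Lt_quot_Ivec.
under [X in _ + X]eq_bigr do rewrite Lt_quot_Xvec.
have l1 : linear_op (fun B : 'M[C]_n => (B, 0) : gl_g D).
  by move=> c B B'; congr (_, _); rewrite /= ?scaler0 ?addr0.
have l2 : linear_op (fun X : g => (0, X) : gl_g D).
  by move=> c X X'; congr (_, _); rewrite /= ?scaler0 ?addr0.
rewrite -(linear_op_sum l1) -(linear_op_sum l2).
by congr (_, _); rewrite /= ?addr0 ?add0r.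
Qed.

Lemma Lt_act_kernel x w : Lt D x -> Lt_quot x = 0 -> M w -> Lt_act x w = 0.
Proof.
move=> Lx; have [s1 [s2 [h1 h2 ->]]] := Lt_decomposition HD Lx.
rewrite Lt_quot_decomposition // => -[e1 e2] Mw.
by rewrite Lt_act_decomposition // kernel_I // kernel_X // addr0.
Qed.

Lemma Lt_act_quot x y w : Lt D x -> Lt D y -> Lt_quot x = Lt_quot y -> M w ->
  Lt_act x w = Lt_act y w.
Proof.
move=> Lx Ly e Mw; apply/eqP; rewrite -subr_eq0 addrC -scaleN1r.
rewrite -(Lt_act_x HD V_mod) //; apply/eqP/Lt_act_kernel => //; first exact: ssP.
rewrite Lt_quot_linear; try exact: Lt_finitely_supported.
by rewrite e scaleN1r addNr.
Qed.

Lemma Lt_actZB c x y w : Lt D x -> Lt D y ->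
  Lt_act (c *: (x - y)) w = c *: (Lt_act x w - Lt_act y w) :> U.
Proof.
move=> Lx Ly; have L0 := ss0 (Lt D).
rewrite -[c *: _]addr0 (Lt_act_x HD V_mod) //; last exact: ssB.
rewrite (Lt_act0 HD V_mod) addr0 [x - y]addrC -scaleN1r (Lt_act_x HD V_mod) //.
by rewrite scaleN1r addrC.
Qed.

Lemma Lt_quotZB c x y : Lt D x -> Lt D y ->
  Lt_quot (c *: (x - y)) = c *: (Lt_quot x - Lt_quot y).
Proof.
move=> Lx Ly; rewrite -[c *: _]addr0 Lt_quot_linear; last 2 first.
- by apply: Lt_finitely_supported; exact: ssB.
- exact/Lt_finitely_supported/ss0.
rewrite Lt_quot0 addr0 [x - y]addrC -scaleN1r Lt_quot_linear; try exact: Lt_finitely_supported.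
by rewrite scaleN1r addrC.
Qed.

(** Stands in for a bracket on [Lt]: all that [psi] requires is some element over the bracket of the
    images that acts on [M] as the commutator. *)
Definition bracket_lifts (x y : Zn -> L_fibre D) := exists z, [/\ Lt D z,
  Lt_quot z = gl_bracket (Lt_quot x) (Lt_quot y) &
  forall w, M w -> Lt_act z w = Lt_act x (Lt_act y w) - Lt_act y (Lt_act x w)].

Lemma gl_bracket_linl c (a a' b : gl_g D) :
  gl_bracket (c *: a + a') b = c *: gl_bracket a b + gl_bracket a' b.
Proof.
congr (_, _); rewrite /= ?brk_linl // mulmxDl mulmxDr -scalemxAl -scalemxAr scalerBr opprD.
exact: addrACA.
Qed.

Lemma gl_bracketC (a b : gl_g D) : gl_bracket a b = - gl_bracket b a.
Proof. by congr (_, _); rewrite /= ?opprB // brkC. Qed.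

Lemma bracket_liftsC x y : Lt D x -> Lt D y -> bracket_lifts x y -> bracket_lifts y x.
Proof.
move=> Lx Ly [z [Lz zq za]]; exists (- 1 *: (z - 0)); split.
- by apply: ssZ; rewrite subr0.
- by rewrite Lt_quotZB ?Lt_quot0 ?subr0 ?zq ?scaleN1r -?gl_bracketC //; exact: ss0.
- move=> w Mw; rewrite Lt_actZB ?(Lt_act0 HD V_mod) ?subr0 ?za ?scaleN1r ?opprB //.
  exact: ss0.
Qed.

Lemma bracket_lifts_linear c x x' y : Lt D x -> Lt D x' -> Lt D y ->
  bracket_lifts x y -> bracket_lifts x' y -> bracket_lifts (c *: x + x') y.
Proof.
move=> Lx Lx' Ly [z [Lz zq za]] [z' [Lz' zq' za']]; exists (c *: z + z'); split.
- exact: ssP.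
- by rewrite !Lt_quot_linear ?gl_bracket_linl ?zq ?zq' //; exact: Lt_finitely_supported.
move=> w Mw; rewrite !(Lt_act_x HD V_mod) // za // za' // (Lt_act_linear HD V_mod Ly).
by rewrite scalerBr opprD addrACA.
Qed.

Lemma bracket_lifts0 y : Lt D y -> bracket_lifts 0 y.
Proof.
move=> Ly; exists 0; split; first exact: ss0.
  rewrite Lt_quot0; have := gl_bracket_linl (-1) 0 0 (Lt_quot y).
  by rewrite scaler0 addr0 scaleN1r addNr => ->.
by move=> w _; rewrite !(Lt_act0 HD V_mod) (linear_op0 (Lt_act_linear HD V_mod Ly)) subr0.
Qed.

Lemma bracket_lifts_II u r v s : lat r -> lat s ->
  bracket_lifts (Ivec D u r) (Ivec D v s).
Proof.
move=> rG sG; have rsG := latD rG sG.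
have L t q : lat q -> Lt D (Ivec D t q) by exact: Lt_Ivec.
(* The right-hand side of [commAA]; the factor [1] gives it the shape of [Lt_quotZB] and
   [Lt_actZB]. *)
exists (1 *: (dot u (cvec R s) *: (Ivec D v (r + s) - Ivec D v s) -
  dot v (cvec R r) *: (Ivec D u (r + s) - Ivec D u r))).
have L1 : Lt D (dot u (cvec R s) *: (Ivec D v (r + s) - Ivec D v s)).
  by apply: ssZ; apply: ssB; exact: L.
have L2 : Lt D (dot v (cvec R r) *: (Ivec D u (r + s) - Ivec D u r)).
  by apply: ssZ; apply: ssB; exact: L.
split; first by apply: ssZ; exact: ssB.
  rewrite Lt_quotZB // !Lt_quotZB; try exact: L.
  rewrite scale1r !Lt_quot_Ivec cvecD [(_ + _)^T]linearD /=.
  (* This product rule for rank-one matrices is what makes [I(u, r) |-> r^T u] compatible with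
     brackets. *)
  have e (a b : 'rV[C]_n) (t q : Zn) : ((cvec R t)^T *m a) *m ((cvec R q)^T *m b) =
      dot a (cvec R q) *: ((cvec R t)^T *m b).
    rewrite mulmxA -[_ *m a *m _]mulmxA (_ : a *m (cvec R q)^T = (dot a (cvec R q))%:M).
      by rewrite mul_mx_scalar scalemxAl.
    apply/matrixP => i j; rewrite !ord1 !mxE eqxx mulr1n /dot.
    by apply: eq_bigr => l _; rewrite !mxE.
  congr (_, _); rewrite /= ?e; last by rewrite brk0l // !subr0 !scaler0 subr0.
  by rewrite !mulmxDl addrK [X in X - (cvec R r)^T *m u]addrC addrK.
move=> w Mw; rewrite Lt_actZB // !Lt_actZB; try exact: L.
rewrite scale1r !(Lt_act_Ivec V_mod) //; symmetry.
exact: (commAA TR M_generated M_a M_finite_dim M_neq0 u v (proj2 (latticeP _ _) rG)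
  (proj2 (latticeP _ _) sG) Mw).
Qed.

(** The lift lies in [F_1], in agreement with the two summands commuting in the quotient. *)
Lemma bracket_lifts_IX u r X k : lat r -> in_gring_ k X ->
  bracket_lifts (Ivec D u r) (Xvec X k).
Proof.
move=> rG GX; have GX' := in_gring_degD HD rG GX.
have [LX LX'] := (Lt_Xvec GX, Lt_Xvec GX').
exists (dot u (cvec R k) *: (Xvec X (k + r) - Xvec X k)); split.
- by apply: ssZ; exact: ssB.
- rewrite Lt_quotZB // !Lt_quot_Xvec subrr scaler0 Lt_quot_Ivec.
  by congr (_, _); rewrite /= ?mulmx0 ?mul0mx ?subr0 ?brk0l.
move=> w Mw; rewrite Lt_actZB // !Lt_act_Xvec !(Lt_act_Ivec V_mod) //.
by rewrite (tr_AY TR u w (proj2 (latticeP _ _) rG) GX).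
Qed.

Lemma bracket_lifts_XX X k X' l : in_gring_ k X -> in_gring_ l X' ->
  bracket_lifts (Xvec X k) (Xvec X' l).
Proof.
move=> GX GX'; exists (Xvec (br X X') (k + l)); split.
- by apply: Lt_Xvec; exact: in_gring_deg_brk.
- by rewrite !Lt_quot_Xvec; congr (_, _); rewrite /= mulmx0 subr0.
move=> w Mw; rewrite !Lt_act_Xvec; symmetry.
exact: (commYY TR M_generated M_a M_x M_finite_dim M_neq0 GX GX' Mw).
Qed.

Lemma Lt_bracket x y : Lt D x -> Lt D y -> bracket_lifts x y.
Proof.
(* Extension from generators by linearity is done on the left only; antisymmetry exchanges the two
   arguments. *)
have extend y' : Lt D y' -> (forall u r, lat r -> bracket_lifts (Ivec D u r) y') ->
    (forall X k, in_gring_ k X -> bracket_lifts (Xvec X k) y') ->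
    forall x', Lt D x' -> bracket_lifts x' y'.
  move=> Ly hI hX x' Lx'; pose K x := Lt D x /\ bracket_lifts x y'.
  have Kc : K 0 /\ forall (c : C) x1 x2, K x1 -> K x2 -> K (c *: x1 + x2).
    split=> [|c x1 x2 [L1 B1] [L2 B2]]; first by split; [exact: ss0|exact: bracket_lifts0].
    by split; [exact: ssP|exact: bracket_lifts_linear].
  suff [] : K x' by [].
  apply: (lspan_sub (S := Subspace Kc)) Lx' => _ [[u [r [rG ->]]]|[k [X [GX ->]]]] /=.
    by split; [exact: Lt_Ivec|exact: hI].
  by split; [exact: Lt_Xvec|exact: hX].
move=> Lx Ly; apply: (extend y) Lx => // [u r rG|X k GX].
  have LI := Lt_Ivec u rG; apply: bracket_liftsC => //.
  apply: (extend _ LI) Ly => [v s sG|X k GX]; first exact: bracket_lifts_II.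
  by apply: bracket_liftsC => //; [exact: Lt_Xvec|exact: bracket_lifts_IX].
have LX := Lt_Xvec GX; apply: bracket_liftsC => //.
by apply: (extend _ LX) Ly => [v s sG|X' l GX']; [exact: bracket_lifts_IX|exact: bracket_lifts_XX].
Qed.

Lemma Lt_quot_surjective a : gl_gring a -> exists2 x, Lt D x & Lt_quot x = a.
Proof.
case: a => B X; rewrite /gl_gring /= => /(in_gring_decomposition HD)[s [sG ->]].
(* Row [j] of [B] is produced by [I(m_j^-1 row_j B, m_j e_j)], whose exponent lies in [Gamma]. *)
pose s1 := [seq ((m j)%:R^-1 *: row j B, dilate m (eps j)) | j : 'I_n].
have h1 p : p \in s1 -> lat p.2.
  by move=> /mapP[j _ ->] /=; apply/latticeP; eexists.
exists (\sum_(p <- s1) Ivec D p.1 p.2 + \sum_(p <- s) Xvec p.1 p.2).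
  by apply: (ssD (S := Lt D)); apply: ss_sum_seq => p; [move/h1; exact: Lt_Ivec|move/sG;
    exact: Lt_Xvec].
rewrite Lt_quot_decomposition // /s1 big_map big_enum /=; congr (_, _).
apply/matrixP => i l; rewrite summxE (bigD1 i) //= big1 => [|j /negPf ji].
  rewrite !mxE big_ord1 !mxE !eqxx mul1r addr0 mulrA mulfV ?mul1r //.
  by rewrite pnatr_eq0 -lt0n m_gt0.
by rewrite !mxE big_ord1 !mxE eq_sym ji ?andbF mul0r ?mulr0z ?mul0r.
Qed.

(** [psi a] acts through an arbitrary preimage [sel a] in [Lt]. Two elements of [Lt] with the same
    image act alike on [M], and this carries linearity, brackets and irreducibility over. *)
Lemma factors_through_gl : exists psi : gl_g D -> U -> U,
  [/\ is_rep (@gl_gring _ _ D) (@gl_bracket _ _ D) M psi,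
      irreducible_on (@gl_gring _ _ D) M psi &
      forall x v, Lt D x -> M v -> Lt_act x v = psi (Lt_quot x) v].
Proof.
have /choice[sel selP] : forall a, exists x, gl_gring a -> Lt D x /\ Lt_quot x = a.
  move=> a; have [/Lt_quot_surjective[x Lx xa]|no] := pselect (gl_gring a).
    by exists x.
  by exists 0 => /no.
have [M_n0 st irr] := M_irr.
have psiE x v : Lt D x -> M v -> Lt_act x v = Lt_act (sel (Lt_quot x)) v.
  move=> Lx Mv; have [Ls se] := selP _ (Lt_quot_gring HD Lx).
  exact: Lt_act_quot.
have gl_lin c (a b : gl_g D) : gl_gring a -> gl_gring b -> gl_gring (c *: a + b).
  exact: in_gring_linear.
have gl_br (a b : gl_g D) : gl_gring a -> gl_gring b -> gl_gring (gl_bracket a b).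
  exact: in_gring_brk.
have psi_st : stable_on (@gl_gring _ _ D) M (fun a v => Lt_act (sel a) v).
  by move=> a v /selP[La _] Mv; exact: st.
exists (fun a v => Lt_act (sel a) v); split=> //.
- split=> // [c a b v Ga Gb Mv|c a v w /selP[La _] Mv Mw|a b v Ga Gb Mv].
  + have [La ea] := selP _ Ga; have [Lb eb] := selP _ Gb.
    have [Lc ec] := selP _ (gl_lin c _ _ Ga Gb).
    rewrite -(Lt_act_x HD V_mod) //; apply: Lt_act_quot => //; first exact: ssP.
    by rewrite ec Lt_quot_linear ?ea ?eb //; exact: Lt_finitely_supported.
  + exact: Lt_act_linear.
  + have [La ea] := selP _ Ga; have [Lb eb] := selP _ Gb.
    have [Lc ec] := selP _ (gl_br _ _ Ga Gb).
    have [z [Lz zq za]] := Lt_bracket La Lb.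
    by rewrite -za //; apply: Lt_act_quot => //; rewrite ec zq ea eb.
- split=> // N NM Nst; apply: irr => // x v Lx Nv.
  by rewrite psiE //; [apply: Nst => //; exact: Lt_quot_gring|exact: NM].
Qed.

End IrreducibleQuotient.

Theorem theorem9p4 (R : realType) (n : nat) (n_gt0 : (0 < n)%N)
  (D : datum R n) (HD : standing_assumptions D)
  (V : lmodType R[i]) (rho : tau D -> {linear V -> V})
  (V_mod : tau_module rho) (V_irr : tau_irreducible rho)
  (V_int : tau_integrable rho)
  (C0 : R[i]) (C0_gt0 : 0 < C0)
  (K0_act : forall v, rho (tK D 0 ord0) v = C0 *: v)
  (Ki_act : forall (i : 'I_n) v, rho (tK D 0 (lift ord0 i)) v = 0)
  (la : Hdual D) (la_T : exists v, [/\ TV rho v, weight_vector rho la v & v != 0])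
  (p : 'rV[int]_n) (Np : nat) (p_order : has_order D p Np)
  (theta : {linear Vt rho C0 -> Vt rho C0}) (theta_bij : bijective theta)
  (theta_Lt : forall x v, Lt D x -> theta (Lt_act x v) = Lt_act x (theta v))
  (theta_graded : forall k : 'rV[int]_n,
     theta @` Vt_ rho la C0 k = Vt_ rho la C0 (k - p))
  (theta_Np : forall v, iter Np theta v = v)
  (zeta : R[i]) (zeta_prim : Np.-primitive_root zeta)
  (M_irr : forall i : 'I_Np, irreducible_on (Lt D) (theta_eigen theta zeta i) Lt_act) :
  forall i : 'I_Np, finite_dim (theta_eigen theta zeta i) /\
    exists psi : gl_g D -> Vt rho C0 -> Vt rho C0,
      [/\ is_rep (@gl_gring _ _ D) (@gl_bracket _ _ D) (theta_eigen theta zeta i) psi,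
          irreducible_on (@gl_gring _ _ D) (theta_eigen theta zeta i) psi &
          forall x v, Lt D x -> theta_eigen theta zeta i v -> Lt_act x v = psi (Lt_quot x) v].
Proof.
move=> i; have Mc : theta_eigen theta zeta i 0 /\ forall (c : R[i]) u v,
    theta_eigen theta zeta i u -> theta_eigen theta zeta i v ->
    theta_eigen theta zeta i (c *: u + v).
  rewrite /theta_eigen; split=> [|c u v /= hu hv] /=; first by rewrite linear0 scaler0.
  by rewrite linearP /= hu hv scalerDr !scalerA mulrC.
pose M := Subspace Mc; have irr : irreducible_on (Lt D) M Lt_act by exact: M_irr.
split; first exact: (M_finite_dim HD V_mod V_int K0_act Ki_act irr).
exact: (factors_through_gl n_gt0 HD V_mod V_int K0_act Ki_act irr).
Qed.
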